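(* Let $T>0$, $H\in(0,1)$, $\varepsilon\in(0,H)$, and let $Y^H_t=\int_0^tK_H(t,s)\,dZ_s$, $t\in[0,T]$, where $K_H$ is the Molchan–Golosov kernel $$K_H(t,s)=C_Hs^{\frac12-H}\left(t^{H-\frac12}(t-s)^{H-\frac12}-(H-\tfrac12)\int_s^tu^{H-\frac32}(u-s)^{H-\frac12}\,du\right),\quad C_H=\left(\frac{2H\,\Gamma(H+\frac12)\Gamma(\frac32-H)}{\Gamma(2-2H)}\right)^{\frac12},$$ and $Z$ is a Lévy process with characteristic triplet $(a,0,\pi)$, $\pi$ symmetric. 1. Let $0<\int_{\mathbb R}x^2\,\pi(dx)<\infty$. Then there is a constant $C$ such that for all $0\le s<t\le T$ $$\mathbf E|Y^H_t-Y^H_s|^2\le C(t-s)^{2(H-\varepsilon)}.$$ If $H\in(\frac12,1)$, then the trajectories of $Y^H$ (up to modification) are $\varkappa$-Hölder continuous for any $\varkappa\in(0,H-\frac12)$. 2. Let $Z$ be a Brownian motion. Then for all $p\ge2$ there is a constant $C$ such that for all $0\le s<t\le T$ $$\mathbf E|Y^H_t-Y^H_s|^p\le C(t-s)^{p(H-\varepsilon)},$$ and the trajectories of $Y^H$ (up to modification) are $\varkappa$-Hölder continuous for any $\varkappa\in(0,H)$.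
   Context: $Z$ satisfies $\mathbf E e^{i\mu Z_t}=e^{t\Psi(\mu)}$ with $\Psi(\mu)=-\frac{a\mu^2}2+\int_{\mathbb R}(e^{i\mu x}-1-i\mu\tau(x))\pi(dx)$, where $\tau(x)=x$ for $|x|\le1$, $\tau(x)=x/|x|$ for $|x|>1$, $a\ge0$, and $\pi$ is a symmetric Lévy measure ($\pi(\{0\})=0$, $\int(x^2\wedge1)\pi(dx)<\infty$); the drift is zero. The integral with respect to $Z$ is understood (Rajput–Rosiński) as the limit in probability of integrals of elementary functions. Constants $C$ do not depend on $s,t$. *)

(* Defs.v *)
(* MathComp / MathComp-Analysis *)
From HB Require Import structures.
From mathcomp Require Import all_boot all_order all_algebra.
From mathcomp Require Import complex.
From mathcomp Require Import all_classical all_reals all_analysis.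

Set Implicit Arguments.
Unset Strict Implicit.
Unset Printing Implicit Defensive.

Import Order.TTheory GRing.Theory Num.Theory.
Import numFieldNormedType.Exports.
Import HBSimple.

Local Open Scope classical_set_scope.
Local Open Scope ring_scope.
Local Open Scope complex_scope.

Definition gamma_fun (R : realType) (z : R) : R :=
  \int[@lebesgue_measure R]_(x in `]0, +oo[) (x `^ (z - 1) * expR (- x)).

(* The Molchan-Golosov kernel, meant for 0 < s < t; the values it takes
   elsewhere (where powR may receive the base 0) play no role. *)
Definition MG_const (R : realType) (H : R) : R :=
  (2 * H * gamma_fun (H + 1/2) * gamma_fun (3/2 - H) / gamma_fun (2 - 2 * H))
    `^ (1/2).

Definition MG_kernel (R : realType) (H t s : R) : R :=
  MG_const H * s `^ (1/2 - H) *
  (t `^ (H - 1/2) * (t - s) `^ (H - 1/2)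
   - (H - 1/2) * \int[@lebesgue_measure R]_(u in `[s, t])
       (u `^ (H - 3/2) * (u - s) `^ (H - 1/2))).

Definition cexp (R : realType) (z : R[i]) : R[i] :=
  (expR (complex.Re z))%:C *
  (cos (complex.Im z) +i* sin (complex.Im z)).

Definition cintegral d (S : measurableType d) (R : realType)
    (mu : {measure set S -> \bar R}) (f : S -> R[i]) : R[i] :=
  (\int[mu]_x complex.Re (f x)) +i* (\int[mu]_x complex.Im (f x)).

Definition char_fun d (Omega : measurableType d) (R : realType)
    (P : probability Omega R) (X : Omega -> R) (m : R) : R[i] :=
  cintegral P (fun w => cexp ('i * (m * X w)%:C)).

Definition levy_tau (R : realType) (x : R) : R :=
  if `|x| <= 1 then x else x / `|x|.

Definition levy_measure (R : realType) (nu : {measure set R -> \bar R}) : Prop :=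
  nu [set 0] = 0%E /\
  (\int[nu]_x (Num.min (x ^+ 2) 1)%:E < +oo)%E.

Definition symmetric_measure (R : realType) (nu : {measure set R -> \bar R}) :
    Prop :=
  forall A : set R, measurable A -> nu ((fun x => - x) @^-1` A) = nu A.

(* Characteristic exponent of the triplet (a, 0, nu). *)
Definition levy_exponent (R : realType) (a : R)
    (nu : {measure set R -> \bar R}) (m : R) : R[i] :=
  - (a * m ^+ 2 / 2)%:C
  + cintegral nu (fun x : R =>
      cexp ('i * (m * x)%:C) - 1 - 'i * (m * levy_tau x)%:C).

Definition mutually_independent d (Omega : measurableType d) (R : realType)
    (P : probability Omega R) (n : nat) (X : 'I_n -> Omega -> R) : Prop :=
  forall B : 'I_n -> set R, (forall i, measurable (B i)) ->
    P [set w | forall i, B i (X i w)] = (\prod_(i < n) P (X i @^-1` B i))%E.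

Definition independent_increments d (Omega : measurableType d) (R : realType)
    (P : probability Omega R) (Z : R -> {RV P >-> R}) : Prop :=
  forall (n : nat) (t : nat -> R), 0 <= t 0%N ->
    (forall i, t i <= t i.+1) ->
    mutually_independent P (fun (i : 'I_n) w => Z (t i.+1) w - Z (t i) w).

(* A process on [0, +oo[; Z t is meaningful for t >= 0 only.  Path regularity
   is not required: a cadlag modification always exists. *)
Definition levy_process d (Omega : measurableType d) (R : realType)
    (P : probability Omega R) (Z : R -> {RV P >-> R}) : Prop :=
  [/\ {ae P, forall w, Z 0 w = 0},
      independent_increments Z,
      (forall s t : R, 0 <= s -> s <= t ->
        forall B : set R, measurable B ->
          P [set w | B (Z t w - Z s w)] = P (Z (t - s) @^-1` B)) &
      (forall t e : R, 0 <= t -> 0 < e ->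
        P [set w | e <= `|Z s w - Z t w|]
          @[s --> within [set s | 0 <= s] (nbhs t)] --> 0%E)].

Definition has_triplet d (Omega : measurableType d) (R : realType)
    (P : probability Omega R) (Z : R -> {RV P >-> R})
    (a : R) (nu : {measure set R -> \bar R}) : Prop :=
  forall m t : R, 0 <= t ->
    char_fun P (Z t) m = cexp (t%:C * levy_exponent a nu m).

(* A multiple sigma > 0 of the standard Brownian motion is allowed: the triplet
   is then (sigma ^+ 2, 0, 0). *)
Definition brownian_motion d (Omega : measurableType d) (R : realType)
    (P : probability Omega R) (Z : R -> {RV P >-> R}) : Prop :=
  [/\ {ae P, forall w, Z 0 w = 0},
      independent_increments Z,
      (exists2 sigma : R, 0 < sigma &
        forall s t : R, 0 <= s -> s < t ->
        forall B : set R, measurable B ->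
          P [set w | B (Z t w - Z s w)]
            = normal_prob 0 (sigma * Num.sqrt (t - s)) B) &
      {ae P, forall w, {within `[0, +oo[, continuous (fun t : R => Z t w : R)}}].

Definition cvg_in_probability d (Omega : measurableType d) (R : realType)
    (P : probability Omega R) (X_ : nat -> Omega -> R) (X : Omega -> R) : Prop :=
  forall e : R, 0 < e -> P [set w | e <= `|X_ n w - X w|] @[n --> \oo] --> 0%E.

(* The independently scattered random measure generated by Z on the Borel
   subsets of [0, T]; M A is meaningful for such A only. *)
Definition levy_random_measure d (Omega : measurableType d) (R : realType)
    (P : probability Omega R) (T : R) (Z : R -> {RV P >-> R})
    (M : set R -> {RV P >-> R}) : Prop :=
  (forall A : nat -> set R,
     (forall i, measurable (A i) /\ A i `<=` `[0, T]) -> trivIset setT A ->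
     (forall n, mutually_independent P (fun i : 'I_n => M (A i) : Omega -> R)) /\
     {ae P, forall w,
       (\sum_(0 <= i < n) M (A i) w) @[n --> \oo] --> M (\bigcup_i A i) w}) /\
  (forall t : R, 0 <= t <= T -> {ae P, forall w, M `[0, t]%classic w = Z t w}).

Definition elementary_integral d (Omega : measurableType d) (R : realType)
    (P : probability Omega R) (M : set R -> {RV P >-> R}) (A : set R)
    (f : {sfun measurableTypeR R >-> R}) (w : Omega) : R :=
  \sum_(y \in range f) y * M (A `&` f @^-1` [set y]) w.

(* X is (a version of) the Rajput-Rosinski integral of f over B against M.
   The control measure of M is a multiple of Lebesgue measure. *)
Definition RR_integral d (Omega : measurableType d) (R : realType)
    (P : probability Omega R) (M : set R -> {RV P >-> R}) (B : set R)
    (f : R -> R) (X : {RV P >-> R}) : Prop :=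
  measurable_fun B f /\
  exists f_ : nat -> {sfun measurableTypeR R >-> R},
    [/\ {ae @lebesgue_measure R, forall u, B u -> f_ n u @[n --> \oo] --> f u},
        (forall A : set R, measurable A -> A `<=` B ->
          exists XA : {RV P >-> R},
            cvg_in_probability P (fun n => elementary_integral M A (f_ n)) XA) &
        cvg_in_probability P (fun n => elementary_integral M B (f_ n)) X].

(* Y t = \int_0^t K t s dZ s for t in [0, T]. *)
Definition volterra_process d (Omega : measurableType d) (R : realType)
    (P : probability Omega R) (T : R) (Z : R -> {RV P >-> R})
    (K : R -> R -> R) (Y : R -> {RV P >-> R}) : Prop :=
  exists2 M : set R -> {RV P >-> R}, levy_random_measure T Z M &
    forall t : R, 0 <= t <= T -> RR_integral M `[0, t]%classic (K t) (Y t).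

Definition modification d (Omega : measurableType d) (R : realType)
    (P : probability Omega R) (T : R) (Y Y' : R -> {RV P >-> R}) : Prop :=
  forall t : R, 0 <= t <= T -> {ae P, forall w, Y' t w = Y t w}.

Definition hoelder_continuous (R : realType) (T kappa : R) (y : R -> R) : Prop :=
  exists c : R, forall s t : R, 0 <= s <= T -> 0 <= t <= T ->
    `|y t - y s| <= c * `|t - s| `^ kappa.

(* Main.v *)
(** By symmetry of [nu] the characteristic exponent is real, [- psi], and the
    random measure of a Borel set [A] has exponent [lambda A * psi]; hence an
    elementary integral [I] of [f] over [A] satisfies
      [E cos (m I) = exp (- int_A psi (m f))].
    This passes to Rajput-Rosinski limits without any domination: since the
    integrals of [h_ n] converge over every Borel set, so do, after taking
    logarithms, the numbers [int_A psi (m (h_ n))], and a gliding-hump argument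
    (Vitali-Hahn-Saks) shows that their limit is countably additive in [A],
    hence equal to [int_A psi (m h)].  For [h = K_H t - K_H s * \1_[0, s]] this
    gives [E cos (m (Y t - Y s)) = exp (- int psi (m h))] for small [m].

    Letting [m] tend to [0] (Fatou), the bound [psi m <= c m^2] yields
    [E (Y t - Y s)^2 <= 2 c int h^2].  For Brownian motion [psi m = psi 1 * m^2],
    so the means of [(2 - 2 cos (m (Y t - Y s)))^k] are those of a centred
    Gaussian variable with variance proportional to [int h^2], which bounds all
    even moments.  Everything is thus reduced to
    [int h^2 <= C (t - s)^(2 (H - eps))], a consequence of pointwise bounds on
    the kernel, and to Kolmogorov's criterion. *)
Require Import Defs.
From HB Require Import structures.
From mathcomp Require Import all_boot all_order all_algebra.
From mathcomp Require Import complex finmap.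
From mathcomp Require Import all_classical all_reals all_analysis.
From mathcomp Require Import measurable_realfun.
From mathcomp Require Import ring lra zify.

Set Implicit Arguments.
Unset Strict Implicit.
Unset Printing Implicit Defensive.

Import Order.TTheory GRing.Theory Num.Theory.
Import numFieldNormedType.Exports.

Local Open Scope classical_set_scope.
Local Open Scope ring_scope.

(** The definition of the stochastic integral grants approximants that converge almost everywhere
    and integrals that converge in probability over every Borel subset, but no dominating function;
    the Borel subsets are what the gliding hump feeds on. Taking logarithms of cosine means requires
    that these means stay away from 0 in the limit, which is why the identities are restricted to
    small [m]. That range suffices, because moments only see the characteristic function near 0.

    The loss [eps] comes from the kernel. For [u < s] its increment is controlled by that of (v -
    u)^(H - 1/2); a bound of order (t - s)^H would leave the non-integrable singularity 1 / (s - u)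
    in the square. Giving up a power [e] of the distance turns it into (s - u)^(2 e - 1). Between
    [s] and [t] nothing is lost. The two Hoelder ranges differ because Kolmogorov's criterion costs
    1/2 with second moments, and arbitrarily little with even moments of high order. *)

Section bounded_integrals.
Context d (T : measurableType d) (R : realType).
Variable mu : {measure set T -> \bar R}.

Lemma bounded_integrable (D : set T) (f : T -> R) (M : R) : measurable D ->
  (mu D < +oo)%E -> measurable_fun D f -> (forall x, D x -> `|f x| <= M) ->
  mu.-integrable D (EFin \o f).
Proof.
move=> mD fD mf fM; apply: measurable_bounded_integrable => //.
exists M; split; first exact: num_real.
by move=> y My x Dx; apply: le_trans (fM x Dx) _; rewrite ltW.
Qed.

Lemma dominated_cvg_Rintegral (D : set T) (f_ : nat -> T -> R) (f g : T -> R) :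
  measurable D -> (forall n, measurable_fun D (f_ n)) -> measurable_fun D f ->
  {ae mu, forall x, D x -> f_ n x @[n --> \oo] --> f x} ->
  mu.-integrable D (EFin \o g) -> (forall n x, D x -> `|f_ n x| <= g x) ->
  \int[mu]_(x in D) f_ n x @[n --> \oo] --> \int[mu]_(x in D) f x.
Proof.
move=> mD mf_ mf cf ig fg.
have h1 n : measurable_fun D (EFin \o f_ n : T -> \bar R) by exact/measurable_EFinP.
have h2 : measurable_fun D (EFin \o f : T -> \bar R) by exact/measurable_EFinP.
have h3 : {ae mu, forall x, D x -> (EFin \o f_ n) x @[n --> \oo] --> (f x)%:E}.
  by apply: filterS cf => x h Dx; apply: cvg_EFin; [exact: nearW | exact: h].
have h4 : {ae mu, forall x n, D x -> (`|(EFin \o f_ n) x| <= (EFin \o g) x)%E}.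
  by apply: aeW => x n Dx; rewrite lee_fin; exact: fg.
have [i1 _ c1] := dominated_convergence mD h1 h2 h3 ig h4.
rewrite /Rintegral; apply: fine_cvg; rewrite fineK//.
exact: integrable_fin_num.
Qed.

Lemma bounded_cvg_Rintegral (D : set T) (f_ : nat -> T -> R) (f : T -> R)
    (M : R) :
  measurable D -> (mu D < +oo)%E ->
  (forall n, measurable_fun D (f_ n)) -> measurable_fun D f ->
  {ae mu, forall x, D x -> f_ n x @[n --> \oo] --> f x} ->
  (forall n x, D x -> `|f_ n x| <= M) ->
  \int[mu]_(x in D) f_ n x @[n --> \oo] --> \int[mu]_(x in D) f x.
Proof.
move=> mD fD mf_ mf cf fM; apply: (@dominated_cvg_Rintegral _ _ _ (cst `|M|)) => //.
  by apply: (@bounded_integrable _ _ `|M|) => // x _; rewrite normr_id.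
by move=> n x Dx; rewrite (le_trans (fM n x Dx))// ler_norm.
Qed.

(** Fatou's lemma with an almost everywhere limit and bounds that vary with [n]: it gives moments
    from difference quotients, improper integrals from truncations and, with [l = 0], almost sure
    equality of two variables. *)
Lemma fatou_le (D : set T) (f_ : nat -> T -> R) (f : T -> R) (u : nat -> \bar R)
    (l : \bar R) : measurable D -> (forall n, measurable_fun D (f_ n)) ->
  measurable_fun D f -> (forall n x, D x -> 0 <= f_ n x) ->
  {ae mu, forall x, D x -> f_ n x @[n --> \oo] --> f x} ->
  (forall n, (\int[mu]_(x in D) (f_ n x)%:E <= u n)%E) -> u n @[n --> \oo] --> l ->
  (\int[mu]_(x in D) (f x)%:E <= l)%E.
Proof.
move=> mD mf_ mf f0 cf fu ul.
have mE n : measurable_fun D (EFin \o f_ n : T -> \bar R) by exact/measurable_EFinP.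
have -> : (\int[mu]_(x in D) (f x)%:E =
    \int[mu]_(x in D) limn_einf (fun n => (f_ n x)%:E))%E.
  apply: ae_eq_integral => //.
  - exact/measurable_EFinP.
  - rewrite /limn_einf; apply: measurableT_comp => //.
    apply: measurable_fun_limn_esup => n.
    by apply/(@measurable_EFinP _ _ _ D (fun x => - f_ n x)); exact: measurableT_comp.
  - apply: filterS cf => x /[apply] cfx.
    have c : (f_ n x)%:E @[n --> \oo] --> (f x)%:E.
      by apply: cvg_EFin; [exact: nearW | exact: cfx].
    by have [-> _] := cvg_limn_einf_sup c.
apply: le_trans (fatou mu mD mE _) _; first by move=> n x Dx; rewrite lee_fin f0.
have [<- _] := cvg_limn_einf_sup ul.
rewrite !limn_einf_lim; apply: lee_lim.
- exact: is_cvg_einfs.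
- exact: is_cvg_einfs.
- apply: nearW => n; apply: le_ereal_inf_tmp => _ [m nm <-].
  apply: (le_trans (ereal_inf_lbound _) (fu m)); by exists m.
Qed.

End bounded_integrals.

(** * Gliding hump *)

Section gliding_hump.
Variable R : realType.

(** If the tails of [w] did not vanish, monotonicity would keep them above some [e]. Since each
    [v n] is small on far tails, one can pick indices whose mass near [e] sits in successive
    disjoint blocks. The union of every other block then looks heavy at even stages and light at odd
    ones, against convergence of [v n] on it. *)
Lemma gliding_hump (v : nat -> set nat -> R) (w : set nat -> R) :
  (forall n A, 0 <= v n A) ->
  (forall n A B, A `&` B = set0 -> v n (A `|` B) = v n A + v n B) ->
  (forall n, v n [set k | (K <= k)%N] @[K --> \oo] --> 0) ->
  (forall A, v n A @[n --> \oo] --> w A) ->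
  w [set k | (K <= k)%N] @[K --> \oo] --> 0.
Proof.
move=> v0 vD vt vw.
pose tl K : set nat := [set k | (K <= k)%N].
have vS n A B : A `<=` B -> v n A <= v n B.
  by move=> AB; rewrite -(setDUK AB) vD ?lerDl// setDIK.
have w0 A : 0 <= w A.
  by apply: (ler_cvg_to (@cvg_cst _ 0 _ _ _) (vw A)); exact: nearW.
have wS A B : A `<=` B -> w A <= w B.
  by move=> AB; apply: (ler_cvg_to (vw A) (vw B)); apply: nearW => n; exact: vS.
have vsplit n K S : v n S = v n (S `&` `I_K) + v n (S `&` tl K).
  rewrite -vD; last first.
    rewrite -subset0 => k [[_ /= kK] [_]]; rewrite /tl /=; lia.
  congr (v n _); rewrite -setIUr; apply/seteqP; split => k; last by case.
  by move=> Sk; split => //; rewrite /tl /=; case: (ltnP k K); [left|right].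
suff h e : 0 < e -> exists K, w (tl K) < e.
  apply/cvgrPdist_lt => e /h[K Ke]; exists K => // K' /= KK'.
  rewrite sub0r normrN ger0_norm//; apply: le_lt_trans Ke.
  by apply: wS => k /=; exact: leq_trans.
move=> e0; apply: contrapT => /forallNP h.
have {}h K : e <= w (tl K) by rewrite leNgt; apply/negP.
(* The contradiction spends seven errors of size [dl]: three in [c1] and four in [c2]. *)
pose dl := e / 8.
have dl0 : 0 < dl by rewrite divr_gt0.
(* Pointwise convergence is uniform over the finitely many subsets of [I_K]; the induction peels off
   the point [K]. *)
have unif K e1 : 0 < e1 -> exists N, forall n, (N <= n)%N ->
    forall S, S `<=` `I_K -> `|w S - v n S| < e1.
  elim: K e1 => [|K ih] e1 e10.
    have /cvgrPdist_lt/(_ _ e10)[N _ hN] := vw set0.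
    exists N => n /hN hn S; rewrite II0 subset0 => ->; exact: hn.
  have [N hN] := ih _ (divr_gt0 e10 (@ltr0n R 2)).
  have /cvgrPdist_lt/(_ _ (divr_gt0 e10 (@ltr0n R 2)))[N' _ hN'] := vw [set K].
  exists (maxn N N') => n; rewrite geq_max => /andP[Nn N'n] S SK.
  have [SKK|SKK] := pselect (S K).
    have SE : S = (S `&` `I_K) `|` [set K].
      apply/seteqP; split => k.
        move=> Sk; have := SK _ Sk; rewrite /= ltnS leq_eqVlt => /predU1P[->|kK].
          by right.
        by left; split.
      by move=> [[]//|/= ->].
    have I0 : (S `&` `I_K) `&` [set K] = set0.
      by rewrite -subset0 => k [[_ /= +] /= kK]; rewrite kK ltnn.
    have wE : w S = w (S `&` `I_K) + w [set K].
      have vE : (fun n => v n S) = (fun n => v n (S `&` `I_K) + v n [set K]).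
        by apply/funext => m; rewrite {1}SE vD.
      have := vw S; rewrite vE => c.
      exact: (cvg_unique _ c (cvgD (vw _) (vw _))).
    rewrite wE {2}SE vD// opprD addrACA.
    apply: le_lt_trans (ler_normD _ _) _.
    have h1 := hN n Nn (S `&` `I_K) (@subIsetr _ _ _).
    have h2 := hN' n N'n; rewrite /= in h2; lra.
  apply: lt_trans (hN n Nn S _) _; last by lra.
  move=> k Sk; have := SK _ Sk; rewrite /= ltnS leq_eqVlt => /predU1P[kK|//].
  by rewrite kK in Sk.
(* One stage: an index that agrees with [w] up to [dl] on all subsets of the first [K] integers and
   sees more than [e - dl] beyond them, and a cutoff beyond which it sees less than [dl]. Its hump
   lies in between. *)
have next K : exists nK : nat * nat, [/\ (K < nK.2)%N, (K <= nK.1)%N,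
    (forall S, S `<=` `I_K -> `|w S - v nK.1 S| < dl),
    e - dl < v nK.1 (tl K) & v nK.1 (tl nK.2) < dl].
  have [N hN] := unif K _ dl0.
  have /cvgrPdist_lt/(_ _ dl0)[N' _ hN'] := vw (tl K).
  pose n := maxn (maxn N N') K.
  have /cvgrPdist_lt/(_ _ dl0)[K' _ hK'] := vt n.
  exists (n, maxn K' K.+1); split => /=.
  - by rewrite leq_maxr.
  - by rewrite leq_maxr.
  - by apply: hN; rewrite /n; lia.
  - have := hN' n; rewrite /= => /(_ ltac:(rewrite /n; lia)).
    by rewrite ltr_norml => /andP[_]; have := h K; lra.
  - have := hK' (maxn K' K.+1) (leq_maxl _ _); rewrite sub0r normrN.
    by rewrite ger0_norm.
have [f hf] := choice next.
pose kp := fix kp j := if j is i.+1 then (f (kp i)).2 else 0%N.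
pose nn j := (f (kp j)).1.
have kpS j : (kp j < kp j.+1)%N by have [] := hf (kp j).
have kple i j : (i <= j)%N -> (kp i <= kp j)%N.
  move=> /subnK <-; elim: (j - i)%N => // m ih; rewrite addSn.
  exact: leq_trans ih (ltnW (kpS _)).
have jkp j : (j <= kp j)%N.
  by elim: j => // j ih; exact: leq_ltn_trans ih (kpS j).
have jnn j : (j <= nn j)%N.
  by have [_ + _ _ _] := hf (kp j); exact: leq_trans (jkp j).
(* The union of the even-numbered blocks between successive cutoffs. *)
pose S : set nat := [set k | exists i, ~~ odd i /\ (kp i <= k < kp i.+1)%N].
have blk i j k : (kp i <= k < kp i.+1)%N -> (kp j <= k < kp j.+1)%N -> i = j.
  move=> /andP[ik ki] /andP[jk kj]; apply/eqP; rewrite eqn_leq.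
  apply/andP; split; rewrite leqNgt; apply/negP => lt.
    by have := kple _ _ lt; lia.
  by have := kple _ _ lt; lia.
have Sodd j : odd j -> S `&` tl (kp j) `<=` tl (kp j.+1).
  move=> oj k [[i [ei ik]] jk]; rewrite /tl /= leqNgt; apply/negP => kj.
  have ij : i = j by apply: (@blk _ _ k) => //; apply/andP; split; [exact: jk|].
  by rewrite ij oj in ei.
have /cvgrPdist_lt/(_ _ dl0)[N _ hN] := vw S.
pose j := N.*2.+1.
have oj : odd j by rewrite /j /= odd_double.
have Nj : (N <= j)%N by rewrite /j -addnn; lia.
clearbody j.
(* At an odd stage [S] misses the hump, so that beyond [kp j] only the light tail after the next
   cutoff counts. *)
have c1 : w S - dl < w (S `&` `I_(kp j)) + 2 * dl.
  have h1 := hN (nn j) (leq_trans Nj (jnn j)).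
  have [_ _ h2 _ h3] := hf (kp j).
  have := h2 _ (@subIsetr _ S `I_(kp j)).
  have := vS (nn j) _ _ (Sodd j oj).
  rewrite -/(nn j) -[(f (kp j)).2]/(kp j.+1) in h2 h3 *.
  move: h1; rewrite (vsplit (nn j) (kp j) S) !ltr_norml => /andP[? ?] ? /andP[? ?].
  lra.
(* At the following even stage [S] contains the whole hump. Both estimates refer to the same initial
   part of [S], because [S] has no point in the odd block. *)
have c2 : w (S `&` `I_(kp j.+1)) + e - 3 * dl < w S + dl.
  have h1 := hN (nn j.+1) (leq_trans Nj (leq_trans (leqnSn _) (jnn j.+1))).
  have [_ _ h2 h4 h3] := hf (kp j.+1).
  have := h2 _ (@subIsetr _ S `I_(kp j.+1)).
  rewrite -/(nn j.+1) -[(f (kp j.+1)).2]/(kp j.+2) in h2 h3 h4 *.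
  have := vsplit (nn j.+1) (kp j.+2) (tl (kp j.+1)).
  have : v (nn j.+1) (tl (kp j.+1) `&` `I_(kp j.+2)) <= v (nn j.+1) (S `&` tl (kp j.+1)).
    apply: vS => k [jk kj]; split => //; exists j.+1; split; first by rewrite /= oj.
    by apply/andP.
  have : v (nn j.+1) (tl (kp j.+1) `&` tl (kp j.+2)) <= v (nn j.+1) (tl (kp j.+2)).
    by apply: vS => k [].
  move: h1; rewrite (vsplit (nn j.+1) (kp j.+1) S) !ltr_norml => /andP[? ?] ? ? ? /andP[? ?].
  lra.
have c3 : S `&` `I_(kp j) = S `&` `I_(kp j.+1).
  apply/seteqP; split => k [Sk /= kj]; split => //=.
    exact: ltn_trans kj (kpS j).
  rewrite ltnNge; apply/negP => jk.
  by have := Sodd j oj k (conj Sk jk); rewrite /tl /= leqNgt kj.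
rewrite -c3 in c2; have : e = 8 * dl by rewrite /dl mulrC divfK.
lra.
Qed.

End gliding_hump.

(** * Law of the random measure *)

Section uncorrelated.
Import HBNNSimple.
Context d (Omega : measurableType d) (R : realType).
Variable P : probability Omega R.

Lemma Pfin : (P setT < +oo)%E.
Proof. by rewrite probability_setT ltry. Qed.

(** Approximation of [g] by simple functions. The choice of the full set for [B] forces [c] to be
    the mean of [W]; as a parameter, its value can be read off from the induction in
    [sum_exponent]. *)
Lemma uncorrelated_factor (W X : Omega -> R) (g : R -> R) (K M c : R) :
  measurable_fun setT W -> measurable_fun setT X -> measurable_fun setT g ->
  (forall w, `|W w| <= K) -> (forall x, `|g x| <= M) ->
  (forall B, measurable B ->
     \int[P]_w (W w * \1_B (X w)) = c * \int[P]_w \1_B (X w)) ->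
  \int[P]_w (W w * g (X w)) = c * \int[P]_w g (X w).
Proof.
move=> mW mX mg WK gM h.
have K0 : 0 <= K by apply: le_trans (WK point).
have M0 : 0 <= M by apply: le_trans (gM point).
have mgX (f : R -> R) : measurable_fun setT f ->
  measurable_fun setT (fun w => f (X w)) by move=> mf; exact: measurableT_comp.
have iW (f : R -> R) (L : R) : measurable_fun setT f -> (forall x, `|f x| <= L) ->
  P.-integrable setT (EFin \o (fun w => W w * f (X w))).
  move=> mf fL; apply: (@bounded_integrable _ _ _ _ _ _ (K * L)) => //.
  - exact: Pfin.
  - by apply: measurable_funM => //; exact: mgX.
  - by move=> w _; rewrite normrM ler_pM.
have iX (f : R -> R) (L : R) : measurable_fun setT f -> (forall x, `|f x| <= L) ->
  P.-integrable setT (EFin \o (fun w => f (X w))).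
  move=> mf fL; apply: (@bounded_integrable _ _ _ _ _ _ L) => //.
  - exact: Pfin.
  - exact: mgX.
have m1 (B : set R) : measurable B -> measurable_fun setT (\1_B : R -> R).
  by move=> mB; exact: measurable_indic.
have b1 (B : set R) x : `|\1_B x : R| <= 1.
  by rewrite indicE; case: (x \in B); rewrite ?normr1 ?normr0.
have hs (s : seq R) (B : R -> set R) : (forall y, measurable (B y)) ->
  \int[P]_w (W w * \sum_(y <- s) (y * \1_(B y) (X w))) =
  c * \int[P]_w \sum_(y <- s) (y * \1_(B y) (X w)).
  move=> mB; have mS s' : measurable_fun setT
    (fun x => \sum_(y <- s') (y * \1_(B y) x) : R).
    by apply: measurable_sum => y; apply: measurable_funM => //; exact: m1.
  have bS s' x : `|\sum_(y <- s') (y * \1_(B y) x) : R| <= \sum_(y <- s') `|y|.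
    apply: le_trans (ler_norm_sum _ _ _) _; apply: ler_sum => y _.
    by rewrite normrM ler_piMr.
  elim: s => [|y s ih].
    under eq_Rintegral do rewrite big_nil mulr0.
    under [in RHS]eq_Rintegral do rewrite big_nil.
    by rewrite /Rintegral integral0 mulr0.
  under eq_Rintegral do rewrite big_cons mulrDr mulrCA.
  under [in RHS]eq_Rintegral do rewrite big_cons.
  rewrite RintegralD//; last first.
  - exact: iW _ _ (mS s) (bS s).
  - under [_ \o _]funext do rewrite /= mulrCA.
    apply: (@iW (fun x => y * \1_(B y) x) `|y|).
      by apply: measurable_funM => //; exact: m1.
    by move=> x; rewrite normrM ler_piMr.
  rewrite RintegralD//; last first.
  - exact: iX _ _ (mS s) (bS s).
  - apply: (@iX (fun x => y * \1_(B y) x) `|y|).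
      by apply: measurable_funM => //; exact: m1.
    by move=> x; rewrite normrM ler_piMr.
  rewrite (RintegralZl y measurableT (iW _ 1 (m1 _ (mB y)) (b1 _))).
  rewrite (RintegralZl y measurableT (iX _ 1 (m1 _ (mB y)) (b1 _))).
  by rewrite ih h// mulrDr mulrCA.
(* Approximation from below by simple functions needs a nonnegative function; the shift is undone at
   the end with the constant case [hM]. *)
pose g' x := g x + M.
have g'0 x : 0 <= g' x by rewrite /g'; have := gM x; rewrite ler_norml => /andP[]; lra.
have mg' : measurable_fun setT g' by exact: measurable_funD.
have mg'E : measurable_fun setT (EFin \o g') by exact/measurable_EFinP.
pose f n := nnsfun_approx measurableT mg'E n.
have fg' n x : `|f n x| <= M + M.
  have g'E y : setT y -> (0 <= (EFin \o g') y)%E by rewrite lee_fin.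
  rewrite ger0_norm//.
  have := le_approx (x := x) n g'E I.
  rewrite -nnsfun_approxE lee_fin => /le_trans; apply.
  by rewrite /g'; have := gM x; rewrite ler_norml => /andP[]; lra.
have cf x : f n x @[n --> \oo] --> g' x.
  have g'E y : setT y -> (0 <= (EFin \o g') y)%E by rewrite lee_fin.
  by have /fine_cvg := cvg_nnsfun_approx measurableT mg'E g'E (x := x) I.
have hf n : \int[P]_w (W w * f n (X w)) = c * \int[P]_w f n (X w).
  have fE x : f n x = \sum_(y <- fset_set (range (f n)))
      (y * \1_(f n @^-1` [set y]) x).
    by rewrite [LHS]fimfunE fsbig_finite.
  under eq_Rintegral do rewrite fE.
  under [in RHS]eq_Rintegral do rewrite fE.
  by apply: hs => y; exact: measurable_sfunP.
have hg' : \int[P]_w (W w * g' (X w)) = c * \int[P]_w g' (X w).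
  have c1 : \int[P]_w (W w * f n (X w)) @[n --> \oo] -->
      \int[P]_w (W w * g' (X w)).
    apply: (@bounded_cvg_Rintegral _ _ _ _ _ _ _ (K * (M + M))) => //.
    - exact: Pfin.
    - by move=> n; apply: measurable_funM => //; exact: mgX.
    - by apply: measurable_funM => //; exact: mgX.
    - by apply: aeW => w _; apply: cvgM; [exact: cvg_cst | exact: cf].
    - by move=> n w _; rewrite normrM ler_pM.
  have c2 : c * \int[P]_w (f n (X w)) @[n --> \oo] -->
      c * \int[P]_w (g' (X w)).
    apply: cvgM; first exact: cvg_cst.
    apply: (@bounded_cvg_Rintegral _ _ _ _ _ _ _ (M + M)) => //.
    - exact: Pfin.
    - by move=> n; exact: mgX.
    - exact: mgX.
    - by apply: aeW => w _; exact: cf.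
  apply: (cvg_unique _ c1); rewrite //.
  by rewrite (_ : (fun n => _) = fun n => c * \int[P]_w (f n (X w)))//;
    apply/funext.
have hM : \int[P]_w (W w * M) = c * \int[P]_w (cst M w).
  have := hs [:: M] (fun=> setT) (fun=> measurableT).
  by under eq_Rintegral do rewrite big_seq1 indicT mulr1;
   under [in RHS]eq_Rintegral do rewrite big_seq1 indicT mulr1.
have : \int[P]_w (W w * g' (X w) - W w * M) =
    c * \int[P]_w (g' (X w) - cst M w).
  have bg' x : `|g' x| <= M + M.
    by rewrite /g' ler_norml; have := gM x; rewrite ler_norml => /andP[? ?]; apply/andP; lra.
  have bM (x : R) : `|cst M x| <= M by rewrite ger0_norm.
  rewrite (RintegralB measurableT (iW g' _ mg' bg') (iW (cst M) M _ bM))//.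
  rewrite (RintegralB measurableT (iX g' _ mg' bg') (iX (cst M) M _ bM))//.
  by rewrite hg' hM mulrBr.
under eq_Rintegral do rewrite -mulrBr addrK.
by under [in RHS]eq_Rintegral do rewrite addrK.
Qed.

End uncorrelated.

Section independent_pairs.
Context d (Omega : measurableType d) (R : realType).
Variable P : probability Omega R.

Lemma Rintegral_indic_comp (X : Omega -> R) (B : set R) :
  measurable_fun setT X -> measurable B ->
  \int[P]_w \1_B (X w) = fine (P (X @^-1` B)).
Proof.
move=> mX mB; rewrite /Rintegral; congr fine.
transitivity (\int[P]_x (\1_(X @^-1` B) x)%:E)%E.
  by apply: eq_integral => w _; rewrite !indicE.
by rewrite integral_indic ?setIT// -[X in measurable X]setTI; exact: mX.
Qed.

(** Indicators are replaced by functions one factor at a time: first [f] against an indicator of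
    [Y], then [g] against the weight [f (X w)]. *)
Lemma expectation_indep (X Y : Omega -> R) (f g : R -> R) (K L : R) :
  measurable_fun setT X -> measurable_fun setT Y ->
  measurable_fun setT f -> measurable_fun setT g ->
  (forall x, `|f x| <= K) -> (forall x, `|g x| <= L) ->
  (forall A B, measurable A -> measurable B ->
    P [set w | A (X w) /\ B (Y w)] = (P (X @^-1` A) * P (Y @^-1` B))%E) ->
  \int[P]_w (f (X w) * g (Y w)) = (\int[P]_w f (X w)) * \int[P]_w g (Y w).
Proof.
move=> mX mY mf mg fK gL ind.
have fin (A : set Omega) : measurable A -> P A \is a fin_num.
  by move=> mA; exact: fin_num_measure.
have mpre (U : Omega -> R) A : measurable_fun setT U -> measurable A ->
    measurable (U @^-1` A).
  by move=> mU mA; rewrite -[X in measurable X]setTI; exact: mU.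
have b1 (B : set R) x : `|\1_B x : R| <= 1.
  by rewrite indicE; case: (x \in B); rewrite ?normr1 ?normr0.
apply: (@uncorrelated_factor _ _ _ _ _ _ _ K L) => //.
  exact: measurableT_comp.
move=> B mB; under eq_Rintegral do rewrite mulrC.
rewrite mulrC.
apply: (@uncorrelated_factor _ _ _ _ _ _ _ 1 K) => //.
  exact: measurableT_comp (measurable_indic mB) _.
move=> A mA; rewrite !Rintegral_indic_comp// -fineM; [|exact/fin/mpre|exact/fin/mpre].
rewrite muleC -ind// /Rintegral; congr fine.
have mAB : measurable [set w | A (X w) /\ B (Y w)].
  by rewrite (_ : [set _ | _] = X @^-1` A `&` Y @^-1` B)//; apply: measurableI; exact: mpre.
transitivity (\int[P]_x (\1_[set w | A (X w) /\ B (Y w)] x)%:E)%E.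
  apply: eq_integral => w _; rewrite !indicE -natrM mulnb; congr (nat_of_bool _)%:R%:E.
  by apply/idP/idP => [/andP[/set_mem Bw /set_mem Aw]|/set_mem[Aw Bw]];
    [exact/mem_set | apply/andP; split; exact/mem_set].
by rewrite integral_indic ?setIT.
Qed.

End independent_pairs.

Section random_measure.
Context d (Omega : measurableType d) (R : realType).
Variables (P : probability Omega R) (T : R).
Variables (Z : R -> {RV P >-> R}) (M : set R -> {RV P >-> R}).
Hypothesis hM : levy_random_measure T Z M.
Local Notation lam := (@lebesgue_measure R).

(** The empty sets form a disjoint sequence, so the sums of [n] copies of [x] converge, and their
    consecutive differences [x] tend to 0. *)
Lemma random_measure0 : {ae P, forall w, M set0 w = 0}.
Proof.
have [h _] := hM.
have tI : trivIset setT (fun _ : nat => set0 : set R).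
  by apply/trivIsetP => i j _ _ _; rewrite set0I.
have hA (i : nat) : measurable (set0 : set R) /\ set0 `<=` `[0, T]%classic.
  by split => //; exact: sub0set.
have [_] := h (fun=> set0) hA tI; apply: filterS => w; rewrite bigcup0//.
set x := M set0 w => c.
have c1 : (\sum_(0 <= i < n.+1) x) @[n --> \oo] --> x.
  by rewrite (cvg_shiftS (fun n => \sum_(0 <= i < n) x)).
have : (\sum_(0 <= i < n.+1) x - \sum_(0 <= i < n) x) @[n --> \oo] --> x - x.
  exact: cvgB.
under eq_fun do rewrite big_nat_recr//= addrAC subrr add0r.
by rewrite subrr => c2; apply: (cvg_unique _ (@cvg_cst _ x _ _ _) c2).
Qed.

Lemma random_measureU (A B : set R) : measurable A -> measurable B ->
  A `<=` `[0, T] -> B `<=` `[0, T] -> A `&` B = set0 ->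
  {ae P, forall w, M (A `|` B) w = M A w + M B w}.
Proof.
move=> mA mB AT BT AB.
have [h0 _] := hM.
have hA (i : nat) : measurable (bigcup2 A B i) /\ bigcup2 A B i `<=` `[0, T]%classic.
  by case: i => [|[|i]]; rewrite /bigcup2/=; split => //; exact: sub0set.
have tI : trivIset setT (bigcup2 A B) by rewrite -trivIset_bigcup2.
have [_] := h0 (bigcup2 A B) hA tI.
have M0 := random_measure0; rewrite bigcup2E => h.
near=> w.
have M0w : M set0 w = 0 by near: w.
have : (\sum_(0 <= i < n.+2) M (bigcup2 A B i) w) @[n --> \oo] --> M (A `|` B) w.
  rewrite (cvg_shiftS (fun n => \sum_(0 <= i < n.+1) M (bigcup2 A B i) w)).
  rewrite (cvg_shiftS (fun n => \sum_(0 <= i < n) M (bigcup2 A B i) w)).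
  by near: w.
under eq_fun do rewrite big_nat_recl//= big_nat_recl//= big1 ?addr0//.
by move=> c; apply/esym; apply: (cvg_unique _ (@cvg_cst _ _ _ _ _) c).
Unshelve. all: by end_near. Qed.

Lemma random_measure_indep (A B : set R) : measurable A -> measurable B ->
  A `<=` `[0, T] -> B `<=` `[0, T] -> A `&` B = set0 ->
  forall U V, measurable U -> measurable V ->
    P [set w | U (M A w) /\ V (M B w)] =
    (P (M A @^-1` U) * P (M B @^-1` V))%E.
Proof.
move=> mA mB AT BT AB U V mU mV.
have [h0 _] := hM.
have hA (i : nat) : measurable (bigcup2 A B i) /\ bigcup2 A B i `<=` `[0, T]%classic.
  by case: i => [|[|i]]; rewrite /bigcup2/=; split => //; exact: sub0set.
have tI : trivIset setT (bigcup2 A B) by rewrite -trivIset_bigcup2.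
have [/(_ 2%N) + _] := h0 (bigcup2 A B) hA tI.
move=> /(_ (fun i : 'I_2 => if val i == 0%N then U else V)).
rewrite !big_ord_recl big_ord0/= mule1 => <-; last by move=> i; case: ifP.
congr (P _); apply/seteqP; split => w /=.
  by move=> [Uw Vw] [[|[|//]] i2].
move=> h; split; first exact: (h ord0).
exact: (h (@Ordinal 2 1 isT)).
Qed.

Lemma Rintegral_cstP (r : R) : \int[P]_w (cst r w) = r.
Proof.
rewrite Rintegral_cst//; transitivity (r * 1); last exact: mulr1.
congr (_ * _); exact: (congr1 fine (probability_setT P)).
Qed.

Lemma ae_eq_Rintegral (f g : Omega -> R) :
  measurable_fun setT f -> measurable_fun setT g ->
  {ae P, forall w, f w = g w} -> \int[P]_w f w = \int[P]_w g w.
Proof.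
move=> mf mg fg; rewrite /Rintegral; congr fine; apply: ae_eq_integral => //.
- exact/measurable_EFinP.
- exact/measurable_EFinP.
- by apply: filterS fg => w ->.
Qed.

Lemma measurable_cosM (X : Omega -> R) (m : R) :
  measurable_fun setT X -> measurable_fun setT (fun w => cos (m * X w)).
Proof.
move=> mX; apply: (measurableT_comp (f := @cos R)).
  by apply: continuous_measurable_fun; exact: continuous_cos.
exact: measurable_funM.
Qed.

Lemma measurable_sinM (X : Omega -> R) (m : R) :
  measurable_fun setT X -> measurable_fun setT (fun w => sin (m * X w)).
Proof.
move=> mX; apply: (measurableT_comp (f := @sin R)).
  by apply: continuous_measurable_fun; exact: continuous_sin.
exact: measurable_funM.
Qed.

Lemma norm_cos_le1 (x : R) : `|cos x| <= 1.
Proof. by rewrite ler_norml cos_geN1 cos_le1. Qed.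

Lemma norm_sin_le1 (x : R) : `|sin x| <= 1.
Proof. by rewrite ler_norml sin_geN1 sin_le1. Qed.

Lemma integrable_cosM (X : Omega -> R) (m : R) : measurable_fun setT X ->
  P.-integrable setT (EFin \o (fun w => cos (m * X w))).
Proof.
move=> mX; apply: (@bounded_integrable _ _ _ _ _ _ 1) => //.
- exact: Pfin.
- exact: measurable_cosM.
- by move=> w _; exact: norm_cos_le1.
Qed.

Variable psi : R -> R.
Hypothesis T0 : 0 < T.
Hypothesis hcos : forall m t, 0 <= t <= T ->
  \int[P]_w cos (m * Z t w) = expR (- (t * psi m)).
Hypothesis hsin : forall m t, 0 <= t <= T -> \int[P]_w sin (m * Z t w) = 0.

(** A real characteristic function, split into real and imaginary parts. The vanishing sine mean is
    carried along because the addition formulas mix both parts. *)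
Definition has_exponent (X : Omega -> R) (c : R) := forall m,
  \int[P]_w cos (m * X w) = expR (- (c * psi m)) /\ \int[P]_w sin (m * X w) = 0.

Lemma has_exponent_ae (X Y : Omega -> R) (c : R) :
  measurable_fun setT X -> measurable_fun setT Y ->
  {ae P, forall w, X w = Y w} -> has_exponent X c -> has_exponent Y c.
Proof.
move=> mX mY XY hX m; have [<- <-] := hX m; split; apply: ae_eq_Rintegral;
  by [exact: measurable_cosM | exact: measurable_sinM | apply: filterS XY => w ->].
Qed.

Lemma lebesgue_sub0T (A : set R) : measurable A -> A `<=` `[0, T] ->
  lam A \is a fin_num.
Proof.
move=> mA AT; rewrite ge0_fin_numE//; apply: (@le_lt_trans _ _ (lam `[0, T]%classic)).
  by apply: le_measure; rewrite ?inE.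
by rewrite lebesgue_measure_itv/= lte_fin T0 -EFinB ltry.
Qed.

(** Multiplicativity of the characteristic function over disjoint sets, in real form. No law is
    prescribed for [A] and [B], so that [lawD] can solve these equations for an unknown summand. *)
Lemma random_measure_addition (A B : set R) : measurable A -> measurable B ->
  A `<=` `[0, T] -> B `<=` `[0, T] -> A `&` B = set0 -> forall m,
  \int[P]_w cos (m * M (A `|` B) w) =
    (\int[P]_w cos (m * M A w)) * (\int[P]_w cos (m * M B w)) -
    (\int[P]_w sin (m * M A w)) * (\int[P]_w sin (m * M B w)) /\
  \int[P]_w sin (m * M (A `|` B) w) =
    (\int[P]_w sin (m * M A w)) * (\int[P]_w cos (m * M B w)) +
    (\int[P]_w cos (m * M A w)) * (\int[P]_w sin (m * M B w)).
Proof.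
move=> mA mB AT BT AB m.
have ind := random_measure_indep mA mB AT BT AB.
have mMA : measurable_fun setT (M A) by [].
have mMB : measurable_fun setT (M B) by [].
have mc : measurable_fun setT (fun x : R => cos (m * x)).
  apply: (measurableT_comp (f := @cos R)).
    by apply: continuous_measurable_fun; exact: continuous_cos.
  exact: measurable_funM.
have ms : measurable_fun setT (fun x : R => sin (m * x)).
  apply: (measurableT_comp (f := @sin R)).
    by apply: continuous_measurable_fun; exact: continuous_sin.
  exact: measurable_funM.
have bc x : `|cos (m * x)| <= 1 := norm_cos_le1 _.
have bs x : `|sin (m * x)| <= 1 := norm_sin_le1 _.
have ip (f g : R -> R) : measurable_fun setT f -> measurable_fun setT g ->
    (forall x, `|f x| <= 1) -> (forall x, `|g x| <= 1) ->
    P.-integrable setT (EFin \o (fun w => f (M A w) * g (M B w))).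
  move=> mf mg bf bg; apply: (@bounded_integrable _ _ _ _ _ _ (1 * 1)) => //.
  - exact: Pfin.
  - by apply: measurable_funM; exact: measurableT_comp.
  - by move=> w _; rewrite normrM ler_pM.
have hU := random_measureU mA mB AT BT AB; split.
- rewrite -(expectation_indep (f := fun x => cos (m * x)) (g := fun x => cos (m * x)) mMA mMB mc mc bc bc ind).
  rewrite -(expectation_indep (f := fun x => sin (m * x)) (g := fun x => sin (m * x)) mMA mMB ms ms bs bs ind).
  rewrite -(RintegralB measurableT (ip _ _ mc mc bc bc) (ip _ _ ms ms bs bs)).
  apply: ae_eq_Rintegral.
  + exact: measurable_cosM.
  + by apply: measurable_funB; apply: measurable_funM; first [exact: measurable_cosM | exact: measurable_sinM].
  + by apply: filterS hU => w ->; rewrite mulrDr cosD.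
- rewrite -(expectation_indep (f := fun x => sin (m * x)) (g := fun x => cos (m * x)) mMA mMB ms mc bs bc ind).
  rewrite -(expectation_indep (f := fun x => cos (m * x)) (g := fun x => sin (m * x)) mMA mMB mc ms bc bs ind).
  rewrite -(RintegralD measurableT (ip _ _ ms mc bs bc) (ip _ _ mc ms bc bs)).
  apply: ae_eq_Rintegral.
  + exact: measurable_sinM.
  + by apply: measurable_funD; apply: measurable_funM; first [exact: measurable_cosM | exact: measurable_sinM].
  + by apply: filterS hU => w ->; rewrite mulrDr sinD.
Qed.

Let law (A : set R) := has_exponent (M A) (fine (lam A)).

Let law0 : law set0.
Proof.
move=> m; rewrite measure0 mul0r oppr0 expR0; split.
  transitivity (\int[P]_w (cst 1 w)); last exact: Rintegral_cstP.
  apply: ae_eq_Rintegral => //; first exact: measurable_cosM.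
  by apply: filterS random_measure0 => w ->; rewrite mulr0 cos0.
transitivity (\int[P]_w (cst 0 w)); last exact: Rintegral_cstP.
apply: ae_eq_Rintegral => //; first exact: measurable_sinM.
by apply: filterS random_measure0 => w ->; rewrite mulr0 sin0.
Qed.

Let law_itv t : 0 <= t <= T -> law `[0, t]%classic.
Proof.
move=> t0T; have [_ /(_ _ t0T) h] := hM.
rewrite /law; have -> : fine (lam `[0, t]%classic) = t.
  rewrite lebesgue_measure_itv/= lte_fin; case: ltP => [_|t0].
    by rewrite oppr0 adde0.
  by apply/eqP; rewrite eq_le t0 andbT; case/andP: t0T.
apply: (@has_exponent_ae (Z t)) => //; last by move=> m; split; [exact: hcos|exact: hsin].
by apply: filterS h => w ->.
Qed.

Let lawU (A B : set R) : measurable A -> measurable B ->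
  A `<=` `[0, T] -> B `<=` `[0, T] -> A `&` B = set0 ->
  law A -> law B -> law (A `|` B).
Proof.
move=> mA mB AT BT AB lA lB m.
have [-> ->] := random_measure_addition mA mB AT BT AB m.
have [-> ->] := lA m; have [-> ->] := lB m.
rewrite !(mul0r, mulr0, subr0, addr0) measureU// fineD ?lebesgue_sub0T//.
by rewrite mulrDl opprD expRD.
Qed.

(** Division in the addition formulas: the laws of the interval and of [A] are known, and the cosine
    mean of [A] is an exponential, hence nonzero. The sine equation gives 0, the cosine equation the
    difference of exponents. *)
Let lawD (A : set R) : measurable A -> A `<=` `[0, T] -> law A -> law (`[0, T] `\` A).
Proof.
move=> mA AT lA m.
have mD : measurable (`[0, T]%classic `\` A) by exact: measurableD.
have DT : `[0, T]%classic `\` A `<=` `[0, T] by move=> x [].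
have AD : A `&` (`[0, T] `\` A) = set0 by rewrite setDIK.
have [] := random_measure_addition mA mD AT DT AD m.
have TT : 0 <= T <= T by rewrite ltW//=.
rewrite setDUK//; have [-> ->] := law_itv TT m; have [-> ->] := lA m.
rewrite !mul0r subr0 add0r => h1 /esym/eqP.
rewrite mulf_eq0 gt_eqF ?expR_gt0//= => /eqP ->; split => //.
have nz : expR (- (fine (lam A) * psi m)) != 0 by rewrite gt_eqF ?expR_gt0.
have e : fine (lam `[0, T]%classic) = fine (lam A) + fine (lam (`[0, T]%classic `\` A)).
  by rewrite -fineD ?lebesgue_sub0T// -measureU// setDUK.
move: h1 nz; rewrite e mulrDl opprD expRD.
by move=> h1 nz; apply/esym; exact: (mulfI nz h1).
Qed.

Lemma sum_random_measure (A : nat -> set R) (n : nat) :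
  (forall i, measurable (A i) /\ A i `<=` `[0, T]) -> trivIset setT A ->
  {ae P, forall w, M (\bigcup_(i < n) A i) w = \sum_(0 <= i < n) M (A i) w}.
Proof.
move=> hA tA; elim: n => [|n ih].
  apply: filterS random_measure0 => w h.
  by rewrite bigcup_mkord big_ord0 big_nil.
have mU : measurable (\bigcup_(i < n) A i).
  by apply: bigcup_measurable => i _; case: (hA i).
have UT : \bigcup_(i < n) A i `<=` `[0, T].
  by move=> x [i _ Aix]; case: (hA i) => _; exact.
have UA : (\bigcup_(i < n) A i) `&` A n = set0.
  rewrite -subset0 => x [[i /= ni Aix] Anx].
  have := tA i n I I (ex_intro _ x (conj Aix Anx)) => E.
  by rewrite E ltnn in ni.
have [mAn AnT] := hA n.
have h := random_measureU mU mAn UT AnT UA.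
apply: filterS2 ih h => w ih h.
by rewrite bigcup_mkord big_ord_recr/= -bigcup_mkord h ih big_nat_recr.
Qed.

(** Finite unions are settled by [lawU]. Bounded convergence along the almost sure convergence of
    the sums, and continuity of Lebesgue measure from below, carry the law to the limit. *)
Let law_bigcup (A : nat -> set R) :
  (forall i, measurable (A i) /\ A i `<=` `[0, T]) -> trivIset setT A ->
  (forall i, law (A i)) -> law (\bigcup_i A i).
Proof.
move=> hA tA lA m; have [h0 _] := hM; have {h0} [_ h] := h0 A hA tA.
have mU n : measurable (\bigcup_(i < n) A i).
  by apply: bigcup_measurable => i _; case: (hA i).
have UT n : \bigcup_(i < n) A i `<=` `[0, T].
  by move=> x [i _ Aix]; case: (hA i) => _; exact.
have mUU : measurable (\bigcup_i A i).
  by apply: bigcup_measurable => i _; case: (hA i).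
have UUT : \bigcup_i A i `<=` `[0, T].
  by move=> x [i _ Aix]; case: (hA i) => _; exact.
have lU n : law (\bigcup_(i < n) A i).
  elim: n => [|n ih]; first by rewrite bigcup_mkord big_ord0.
  rewrite bigcup_mkord big_ord_recr/= -bigcup_mkord; have [mAn AnT] := hA n.
  apply: lawU => //.
  rewrite -subset0 => x [[i /= ni Aix] Anx].
  have := tA i n I I (ex_intro _ x (conj Aix Anx)) => E.
  by rewrite E ltnn in ni.
have mS n : measurable_fun setT (fun w => \sum_(0 <= i < n) M (A i) w : R).
  exact: measurable_sum.
have lS n : has_exponent (fun w => \sum_(0 <= i < n) M (A i) w)
    (fine (lam (\bigcup_(i < n) A i))).
  apply: has_exponent_ae (lU n) => //.
  exact: sum_random_measure.
have cl : fine (lam (\bigcup_(i < n) A i)) @[n --> \oo] --> fine (lam (\bigcup_i A i)).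
  apply: fine_cvg; rewrite fineK ?lebesgue_sub0T//.
  have -> : \bigcup_i A i = \bigcup_n \bigcup_(i < n) A i.
    apply/seteqP; split => x [i _ Aix]; first by exists i.+1 => //; exists i => /=.
    by case: Aix => j _ Ajx; exists j.
  apply: nondecreasing_cvg_mu => //.
    by apply: bigcup_measurable => i _; exact: mU.
  move=> k n kn; apply/subsetPset => x [i /= ik Aix]; exists i => //=.
  exact: leq_trans kn.
split.
- have c1 : \int[P]_w cos (m * \sum_(0 <= i < n) M (A i) w) @[n --> \oo] -->
      \int[P]_w cos (m * M (\bigcup_i A i) w).
    apply: (@bounded_cvg_Rintegral _ _ _ _ _ _ _ 1) => //.
    + exact: Pfin.
    + by move=> n; exact: measurable_cosM.
    + exact: measurable_cosM.
    + apply: filterS h => w h _; apply: continuous_cvg; first exact: continuous_cos.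
      by apply: cvgM => //; exact: cvg_cst.
    + by move=> n w _; exact: norm_cos_le1.
  apply: (cvg_unique _ c1) => //.
  rewrite (_ : (fun n => _) = fun n => expR (- (fine (lam (\bigcup_(i < n) A i)) * psi m))).
    apply: continuous_cvg; first exact: continuous_expR.
    by apply: cvgN; apply: cvgM => //; exact: cvg_cst.
  by apply/funext => n; have [-> _] := lS n m.
- have c1 : \int[P]_w sin (m * \sum_(0 <= i < n) M (A i) w) @[n --> \oo] -->
      \int[P]_w sin (m * M (\bigcup_i A i) w).
    apply: (@bounded_cvg_Rintegral _ _ _ _ _ _ _ 1) => //.
    + exact: Pfin.
    + by move=> n; exact: measurable_sinM.
    + exact: measurable_sinM.
    + apply: filterS h => w h _; apply: continuous_cvg; first exact: continuous_sin.
      by apply: cvgM => //; exact: cvg_cst.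
    + by move=> n w _; exact: norm_sin_le1.
  apply: (cvg_unique _ c1) => //.
  rewrite (_ : (fun n => _) = fun n => 0); first exact: cvg_cst.
  by apply/funext => n; have [_ ->] := lS n m.
Qed.

(** The hypotheses give the law for initial intervals only. The sets with the right law form a
    Dynkin class, and half-lines are closed under intersection and generate the Borel sets. *)
Lemma random_measure_exponent (A : set R) : measurable A -> A `<=` `[0, T] ->
  has_exponent (M A) (fine (lam A)).
Proof.
(* The trace on the time interval lets the Dynkin class live on the whole line, while [M] is
   meaningful only inside. *)
pose D : set (set R) := [set A | measurable A /\ law (A `&` `[0, T])].
have dD : dynkin D.
  split.
  - split; first exact: measurableT.
    by rewrite setTI; apply: law_itv; rewrite ltW//=.
  - move=> B [mB lB]; split; first exact: measurableC.
    have -> : ~` B `&` `[0, T] = `[0, T] `\` (B `&` `[0, T]).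
      apply/seteqP; split => x /=; first by move=> [Bx xT]; split => // -[].
      by move=> [xT Bx]; split => // xB; exact: Bx.
    by apply: lawD => //; exact: measurableI.
  - move=> F tF hF; split.
      by apply: bigcup_measurable => i _; case: (hF i).
    rewrite setI_bigcupl; apply: law_bigcup.
    + move=> i; split; last by move=> x [].
      by apply: measurableI => //; case: (hF i).
    + apply/trivIsetP => i j _ _ ij; move/trivIsetP : tF => /(_ i j I I ij) h.
      by rewrite setIACA h set0I.
    + by move=> i; case: (hF i).
have GD : @RGenOInfty.G R `<=` D.
  move=> _ [x ->].
  have -> : `]x, +oo[%classic = ~` `]-oo, x]%classic :> set R by rewrite setCitvl.
  case: dD => _ h _; apply: h; split => //.
  have [x0|x0] := ltP x 0.
    have -> : `]-oo, x] `&` `[0, T] = set0 :> set R; last exact: law0.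
    by rewrite -subset0 => y []; rewrite /= !in_itv/= => yx /andP[y0 _]; lra.
  have -> : `]-oo, x] `&` `[0, T] = `[0, Num.min x T]%classic :> set R.
    apply/seteqP; split => y; rewrite /= !in_itv/= le_min.
      by move=> [-> /andP[-> ->]].
    by move=> /and3P[-> -> ->].
  by apply: law_itv; rewrite le_min x0 ltW//= ge_min lexx orbT.
have IG : setI_closed (@RGenOInfty.G R).
  move=> _ _ [x ->] [y ->]; exists (Num.max x y).
  by apply/seteqP; split => z; rewrite /= !in_itv/= !andbT gt_max => /andP.
have sD : <<s @RGenOInfty.G R >> `<=` D.
  by rewrite -setI_closed_g_dynkin_g_sigma_algebra// => B /(_ D); apply; split.
move=> mA AT; rewrite -(setIidl AT).
have : D A.
  apply: sD.
  rewrite -[<<s _ >> A]/((@RGenOInfty.G R).-sigma.-measurable A) -RGenOInfty.measurableE.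
  exact: mA.
by case.
Qed.


Let prod_indic (A : nat -> set R) (n : nat) (B : nat -> set R) :
  (forall i, measurable (A i) /\ A i `<=` `[0, T]) -> trivIset setT A ->
  (forall i, measurable (B i)) ->
  \int[P]_w (\prod_(0 <= i < n) \1_(B i) (M (A i) w)) =
  \prod_(0 <= i < n) \int[P]_w \1_(B i) (M (A i) w).
Proof.
move=> hA tA mB; have [h _] := hM; have {h} [/(_ n) ind _] := h A hA tA.
have mpre i : measurable (M (A i) @^-1` B i).
  by rewrite -[X in measurable X]setTI; exact: measurable_funP.
have {}ind := ind (fun i => B i) (fun i => mB i).
have mS : measurable [set w | forall i : 'I_n, B i (M (A i) w)].
  rewrite (_ : [set _ | _] = \bigcap_i [set w | (i < n)%N -> B i (M (A i) w)]).
    apply: bigcapT_measurable => i; have [ni|ni] := ltnP i n.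
      rewrite (_ : [set _ | _] = M (A i) @^-1` B i); first exact: mpre.
      by apply/seteqP; split => w /=; [exact | move=> + _].
    rewrite (_ : [set _ | _] = setT)//.
    by apply/seteqP; split => w //= _; rewrite ltnNge ni.
  apply/seteqP; split => w h i; last exact: (h i I (ltn_ord i)).
  by move=> _ /= ni; exact: (h (Ordinal ni)).
transitivity (fine (P [set w | forall i : 'I_n, B i (M (A i) w)])).
  rewrite /Rintegral; congr fine.
  transitivity (\int[P]_w (\1_[set w | forall i : 'I_n, B i (M (A i) w)] w)%:E)%E.
    apply: eq_integral => w _; congr _%:E; rewrite big_mkord indicE.
    have [h|/existsNP[i h]] := pselect (forall i : 'I_n, B i (M (A i) w)).
      by rewrite mem_set// big1// => i _; rewrite indicE mem_set.
    rewrite memNset; last by move=> /(_ i).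
    by apply/eqP/prodf_eq0; exists i => //; rewrite indicE memNset.
  by rewrite integral_indic ?setIT.
rewrite ind big_mkord.
rewrite (eq_bigr (fun i : 'I_n => (\int[P]_w \1_(B i) (M (A i) w))%:E)).
  by rewrite -(big_morph EFin EFinM erefl).
move=> i _; rewrite Rintegral_indic_comp// fineK//; exact: fin_num_measure.
Qed.

(** Mutual independence is given for events. Indicators are therefore exchanged for trigonometric
    functions one index at a time, by [uncorrelated_factor], instead of factoring a product of [n]
    functions at once. *)
Lemma sum_exponent (A : nat -> set R) (c : nat -> R) (n : nat) :
  (forall i, measurable (A i) /\ A i `<=` `[0, T]) -> trivIset setT A -> forall m,
  \int[P]_w cos (m * \sum_(0 <= i < n) c i * M (A i) w) =
    expR (- \sum_(0 <= i < n) fine (lam (A i)) * psi (m * c i)) /\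
  \int[P]_w sin (m * \sum_(0 <= i < n) c i * M (A i) w) = 0.
Proof.
move=> hA tA m.
pose S k w := m * \sum_(0 <= i < k) c i * M (A i) w.
pose E k := expR (- \sum_(0 <= i < k) fine (lam (A i)) * psi (m * c i)).
pose Q (B : nat -> set R) k w := \prod_(k <= i < n) (\1_(B i) (M (A i) w) : R).
have mM i : measurable_fun setT (M (A i)) by [].
have mS k : measurable_fun setT (S k).
  by apply: measurable_funM => //; apply: measurable_sum => i; exact: measurable_funM.
have m1 (B : set R) i : measurable B -> measurable_fun setT (fun w => \1_B (M (A i) w) : R).
  by move=> mB; exact: measurableT_comp (measurable_indic mB) _.
have mQ B k : (forall i, measurable (B i)) -> measurable_fun setT (Q B k).
  by move=> mB; apply: measurable_prod => i _; exact: m1.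
have bQ B k w : `|Q B k w| <= 1.
  rewrite /Q; elim/big_ind: _ => [|x y hx hy|i _]; first by rewrite normr1.
    by rewrite normrM mulr_ile1.
  by rewrite indicE; case: (_ \in _); rewrite ?normr1 ?normr0.
have mc : measurable_fun setT (@cos R).
  by apply: continuous_measurable_fun; exact: continuous_cos.
have ms : measurable_fun setT (@sin R).
  by apply: continuous_measurable_fun; exact: continuous_sin.
(* The hybrid statement: the first [k] terms already sit inside the cosine or sine, the others still
   appear as indicators. *)
have key k : (k <= n)%N -> forall B, (forall i, measurable (B i)) ->
    \int[P]_w (cos (S k w) * Q B k w) =
      E k * \prod_(k <= i < n) \int[P]_w \1_(B i) (M (A i) w) /\
    \int[P]_w (sin (S k w) * Q B k w) = 0.
  elim: k => [_ B mB|k ih kn B mB].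
    have S0 w : S 0%N w = 0 by rewrite /S big_nil mulr0.
    split.
      under eq_Rintegral do rewrite S0 cos0 mul1r.
      by rewrite /E big_nil oppr0 expR0 mul1r prod_indic.
    under eq_Rintegral do rewrite S0 sin0 mul0r.
    exact: Rintegral_cstP.
  pose C := \prod_(k.+1 <= i < n) \int[P]_w \1_(B i) (M (A i) w).
  have hW (U : set R) : measurable U ->
      \int[P]_w (cos (S k w) * Q B k.+1 w * \1_U (M (A k) w)) =
        E k * C * \int[P]_w \1_U (M (A k) w) /\
      \int[P]_w (sin (S k w) * Q B k.+1 w * \1_U (M (A k) w)) =
        0 * \int[P]_w \1_U (M (A k) w).
    (* The induction hypothesis with an arbitrary set [U] in position [k] is exactly what
       [uncorrelated_factor] asks for with the variable [M (A k)]. *)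
    move=> mU; pose B' i := if i == k then U else B i.
    have mB' i : measurable (B' i) by rewrite /B'; case: ifP.
    have [h1 h2] := ih (ltnW kn) B' mB'.
    have QE w : Q B' k w = Q B k.+1 w * \1_U (M (A k) w).
      rewrite /Q big_ltn// mulrC; congr (_ * _); last by rewrite /B' eqxx.
      rewrite [LHS]big_nat_cond [RHS]big_nat_cond.
      by apply: eq_bigr => i /andP[/andP[ki _] _]; rewrite /B' gtn_eqF.
    split.
      under eq_Rintegral do rewrite -mulrA -QE.
      rewrite h1 -mulrA; congr (_ * _); rewrite big_ltn// mulrC; congr (_ * _).
        rewrite /C [LHS]big_nat_cond [RHS]big_nat_cond.
        by apply: eq_bigr => i /andP[/andP[ki _] _]; rewrite /B' gtn_eqF.
      by rewrite /B' eqxx.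
    by under eq_Rintegral do rewrite -mulrA -QE; rewrite h2 mul0r.
  have SE w : S k.+1 w = S k w + m * c k * M (A k) w.
    by rewrite /S big_nat_recr//= mulrDr mulrA.
  have [Ec Es] := random_measure_exponent (hA k).1 (hA k).2 (m * c k).
  have mW (f : R -> R) : measurable_fun setT f ->
      measurable_fun setT (fun w => f (S k w) * Q B k.+1 w).
    by move=> mf; apply: measurable_funM; [exact: measurableT_comp|exact: mQ].
  have bW (f : R -> R) : (forall x, `|f x| <= 1) -> forall w, `|f (S k w) * Q B k.+1 w| <= 1.
    by move=> bf w; rewrite normrM mulr_ile1.
  have mg (g : R -> R) : measurable_fun setT g ->
      measurable_fun setT (fun x => g (m * c k * x)).
    by move=> hg; apply: measurableT_comp => //; exact: measurable_funM.
  have iW (f g : R -> R) : measurable_fun setT f -> measurable_fun setT g ->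
      (forall x, `|f x| <= 1) -> (forall x, `|g x| <= 1) ->
      P.-integrable setT (EFin \o (fun w => f (S k w) * Q B k.+1 w * g (m * c k * M (A k) w))).
    move=> mf hg bf bg; apply: (@bounded_integrable _ _ _ _ _ _ 1) => //.
    - exact: Pfin.
    - apply: measurable_funM; first exact: mW.
      by apply: measurableT_comp => //; exact: measurable_funM.
    - by move=> w _; rewrite normrM mulr_ile1// bW.
  have F (f g : R -> R) a : measurable_fun setT f -> measurable_fun setT g ->
      (forall x, `|f x| <= 1) -> (forall x, `|g x| <= 1) ->
      (forall U, measurable U ->
        \int[P]_w (f (S k w) * Q B k.+1 w * \1_U (M (A k) w)) =
        a * \int[P]_w \1_U (M (A k) w)) ->
      \int[P]_w (f (S k w) * Q B k.+1 w * g (m * c k * M (A k) w)) =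
      a * \int[P]_w g (m * c k * M (A k) w).
    move=> mf hg bf bg; apply: (@uncorrelated_factor _ _ _ _ _ _ (fun x => g (m * c k * x)) 1 1) => //.
    - exact: mW.
    - exact: mg.
    - exact: bW.
  have EE : E k.+1 = E k * expR (- (fine (lam (A k)) * psi (m * c k))).
    by rewrite /E big_nat_recr//= opprD expRD.
  have bc := norm_cos_le1; have bs := norm_sin_le1.
  split.
    under eq_Rintegral do rewrite SE cosD mulrBl mulrAC (mulrAC (sin _)).
    rewrite (RintegralB measurableT (iW _ _ mc mc bc bc) (iW _ _ ms ms bs bs)).
    rewrite (F _ _ (E k * C) mc mc bc bc (fun U mU => (hW U mU).1)).
    rewrite (F _ _ 0 ms ms bs bs (fun U mU => (hW U mU).2)).
    by rewrite mul0r subr0 Ec EE mulrAC.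
  under eq_Rintegral do rewrite SE sinD mulrDl mulrAC (mulrAC (cos _)).
  rewrite (RintegralD measurableT (iW _ _ ms mc bs bc) (iW _ _ mc ms bc bs)).
  rewrite (F _ _ (E k * C) mc ms bc bs (fun U mU => (hW U mU).1)).
  rewrite (F _ _ 0 ms mc bs bc (fun U mU => (hW U mU).2)).
  by rewrite mul0r add0r Es mulr0.
have [] := key n (leqnn n) (fun=> setT) (fun=> measurableT).
rewrite big_geq// mulr1 => h1 h2; split.
  apply: etrans h1; apply: eq_Rintegral => w _.
  by rewrite /Q big_geq// mulr1.
apply: etrans h2; apply: eq_Rintegral => w _.
by rewrite /Q big_geq// mulr1.
Qed.

End random_measure.

(** * Elementary integrals of simple functions *)

Section elementary_integrals.
Import HBSimple.
Context d (Omega : measurableType d) (R : realType).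
Variables (P : probability Omega R) (T : R).
Variables (Z : R -> {RV P >-> R}) (M : set R -> {RV P >-> R}).
Hypothesis hM : levy_random_measure T Z M.
Local Notation lam := (@lebesgue_measure R).
Local Notation sfunR := {sfun measurableTypeR R >-> R}.
Implicit Types (f g : sfunR) (A : set R).

Let mpre f (y : R) : measurable (f @^-1` [set y] : set R).
Proof.
rewrite -[X in measurable X]setTI.
exact: (@measurable_funPT _ _ _ _ f measurableT _ (measurable_set1 y)).
Qed.

Lemma elementary_integral_seq A f w :
  elementary_integral M A f w =
  \sum_(y <- fset_set (range f)) y * M (A `&` f @^-1` [set y]) w.
Proof. by rewrite /elementary_integral fsbig_finite. Qed.

Lemma measurable_elementary_integral A f :
  measurable_fun setT (elementary_integral M A f).
Proof.
under [elementary_integral M A f]funext do rewrite elementary_integral_seq.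
by apply: measurable_sum => y; exact: measurable_funM.
Qed.

(** Indexed by [nat], since [levy_random_measure] speaks of infinite disjoint sequences; the first
    [n] cells make up [A]. *)
Definition partition_seq (A : set R) (C : nat -> set R) (n : nat) :=
  [/\ forall i, measurable (C i) /\ C i `<=` `[0, T]%classic, trivIset setT C &
      A = \bigcup_(i < n) C i].

(** Additivity of [M] holds off a null set that depends on the sets involved; the range of [f] and
    the partition are finite, so finitely many null sets are collected. Two functions can then be
    handled on one partition instead of on their separate level sets. *)
Lemma elementary_integral_partition A f (C : nat -> set R) (c : nat -> R) n :
  measurable A -> partition_seq A C n ->
  (forall i u, C i u -> f u = c i) ->
  {ae P, forall w, elementary_integral M A f w = \sum_(0 <= i < n) c i * M (C i) w}.
Proof.
move=> mA [hC tC AC] fc.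
have split_y y : {ae P, forall w, M (A `&` f @^-1` [set y]) w =
    \sum_(0 <= i < n) M (C i `&` f @^-1` [set y]) w}.
  have -> : A `&` f @^-1` [set y] = \bigcup_(i < n) (C i `&` f @^-1` [set y]).
    by rewrite AC setI_bigcupl.
  apply: (sum_random_measure hM) => [i|]; last exact: trivIset_setIr.
  split; last by move=> x [/(hC i).2].
  by apply: measurableI; [exact: (hC i).1 | exact: mpre].
have split_s (s : seq R) : {ae P, forall w,
    \sum_(y <- s) y * M (A `&` f @^-1` [set y]) w =
    \sum_(y <- s) y * \sum_(0 <= i < n) M (C i `&` f @^-1` [set y]) w}.
  elim: s => [|y s ih]; first by apply: aeW => w; rewrite !big_nil.
  by apply: filterS2 ih (split_y y) => w ih h; rewrite !big_cons ih h.
apply: filterS2 (split_s (fset_set (range f))) (random_measure0 hM) => w h M0.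
rewrite elementary_integral_seq h.
under eq_bigr do rewrite mulr_sumr.
rewrite exchange_big/=; apply: eq_bigr => i _.
(* On an empty cell [c i] need not be a value of [f]; there both sides vanish since [M set0]
   does. *)
have [C0|/set0P[u Cu]] := eqVneq (C i) set0.
  by rewrite C0 M0 mulr0 big1// => y _; rewrite set0I M0 mulr0.
have ci : c i \in fset_set (range f).
  by rewrite in_fset_set// inE; exists u => //; exact: fc.
rewrite (bigD1_seq (c i) ci (fset_uniq _))/= big1 ?addr0; last first.
  move=> y yc; rewrite (_ : _ `&` _ = set0) ?M0 ?mulr0//.
  rewrite -subset0 => v [Cv /= fv]; move/eqP : yc; apply.
  by rewrite -fv; exact: fc.
congr (_ * M _ w); apply/seteqP; split => v; first by move=> [].
by move=> Cv; split => //=; exact: fc.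
Qed.

Lemma common_partition A f g : measurable A -> A `<=` `[0, T] ->
  exists n C (c e : nat -> R), partition_seq A C n /\
    forall i u, C i u -> f u = c i /\ g u = e i.
Proof.
move=> mA AT.
(* All pairs of values, attained jointly or not: some cells may be empty, but the list has no
   repetition, which gives disjointness. *)
pose s := [seq (y, z) | y <- fset_set (range f), z <- fset_set (range g)].
have us : uniq s by rewrite allpairs_uniq// => -[? ?] [? ?] _ _.
pose q i := nth (0, 0) s i : R * R.
pose C i := if (i < size s)%N then
  A `&` (f @^-1` [set (q i).1] `&` g @^-1` [set (q i).2]) else set0.
exists (size s), C, (fun i => (q i).1), (fun i => (q i).2); split; last first.
  by move=> i u; rewrite /C; case: ifP => // _ [_ []].
split.
- move=> i; rewrite /C; case: ifP => _; last by split => //; exact: sub0set.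
  split; last by move=> u [/AT].
  by apply: measurableI => //; apply: measurableI; exact: mpre.
- move=> i j _ _ [u []]; rewrite /C; case: ifP => // i_s [_ [/= fi gi]].
  case: ifP => // js [_ [/= fj gj]].
  apply/eqP; rewrite -(nth_uniq (0, 0) i_s js us) -/(q i) -/(q j).
  by rewrite [q i]surjective_pairing [q j]surjective_pairing -fi -gi -fj -gj.
- apply/seteqP; split => u; last first.
    by move=> [i /= i_s]; rewrite /C i_s => -[].
  move=> Au; have fgs : (f u, g u) \in s.
    by apply: allpairs_f; rewrite in_fset_set// inE; exists u.
  exists (index (f u, g u) s) => /=; first by rewrite index_mem.
  by rewrite /C index_mem fgs /q nth_index.
Qed.

Lemma elementary_integralB A f g : measurable A -> A `<=` `[0, T] ->
  {ae P, forall w, elementary_integral M A (f - g) w =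
    elementary_integral M A f w - elementary_integral M A g w}.
Proof.
move=> mA AT; have [n [C [c [e [hC ce]]]]] := common_partition f g mA AT.
have hf := @elementary_integral_partition A f C c n mA hC (fun i u Cu => (ce i u Cu).1).
have hg := @elementary_integral_partition A g C e n mA hC (fun i u Cu => (ce i u Cu).2).
have hfg := @elementary_integral_partition A (f - g) C (fun i => c i - e i) n mA hC.
have {}hfg := hfg ltac:(by move=> i u /ce[<- <-]).
apply: filterS3 hf hg hfg => w -> -> ->.
by rewrite -sumrB; apply: eq_bigr => i _; rewrite mulrBl.
Qed.

(** Turns an integral over part of [A] into one over [A], so that integrals up to two different
    times can be subtracted under a single kernel. *)
Lemma elementary_integral_restrict A B f (mB : measurable (B : set (measurableTypeR R))) :
  measurable A -> A `<=` `[0, T] ->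
  {ae P, forall w, elementary_integral M A (f * indic_sfun _ mB) w =
    elementary_integral M (A `&` B) f w}.
Proof.
move=> mA AT; have [n [C [c [e [hC ce]]]]] := common_partition f (indic_sfun _ mB) mA AT.
have h1 := @elementary_integral_partition A (f * indic_sfun _ mB) C (fun i => c i * e i) n mA hC.
have {}h1 := h1 ltac:(by move=> i u /ce[<- <-]).
have [hC1 hC2 hC3] := hC.
have hD : partition_seq (A `&` B) (fun i => C i `&` B) n.
  split.
  - move=> i; split; last by move=> u [/(hC1 i).2].
    by apply: measurableI => //; exact: (hC1 i).1.
  - exact: trivIset_setIr.
  - by rewrite hC3 setI_bigcupl.
have mAB : measurable (A `&` B) by exact: measurableI.
have h2 := @elementary_integral_partition (A `&` B) f _ c n mAB hD
  (fun i u CBu => (ce i u CBu.1).1).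
apply: filterS3 h1 h2 (random_measure0 hM) => w -> -> M0.
apply: eq_bigr => i _.
have [C0|/set0P[u Cu]] := eqVneq (C i) set0; first by rewrite C0 set0I !M0 !mulr0.
have eE v : C i v -> e i = \1_B v by move=> /ce[_ <-].
have [Bu|nBu] := pselect (B u).
  rewrite (eE u Cu) indicE mem_set// mulr1; congr (_ * M _ w).
  apply/seteqP; split => v; last by move=> [].
  move=> Cv; split => //; have := eE v Cv; rewrite (eE u Cu) !indicE mem_set//.
  by have [//|nBv] := pselect (B v); rewrite memNset// => /eqP; rewrite oner_eq0.
rewrite (eE u Cu) indicE memNset// mulr0 mul0r (_ : _ `&` _ = set0) ?M0 ?mulr0//.
rewrite -subset0 => v [Cv Bv]; have := eE v Cv; rewrite (eE u Cu) !indicE memNset//.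
by rewrite mem_set// => /eqP; rewrite eq_sym oner_eq0.
Qed.

Variable psi : R -> R.
Hypothesis T0 : 0 < T.
Hypothesis mpsi : measurable_fun setT psi.
Hypothesis hcos : forall m t, 0 <= t <= T ->
  \int[P]_w cos (m * Z t w) = expR (- (t * psi m)).
Hypothesis hsin : forall m t, 0 <= t <= T -> \int[P]_w sin (m * Z t w) = 0.

Lemma elementary_integral_exponent A f (m : R) : measurable A -> A `<=` `[0, T] ->
  \int[P]_w cos (m * elementary_integral M A f w) =
  expR (- \int[lam]_(u in A) psi (m * f u)).
Proof.
move=> mA AT; have [n [C [c [e [hC ce]]]]] := common_partition f f mA AT.
have h := @elementary_integral_partition A f C c n mA hC (fun i u Cu => (ce i u Cu).1).
have [hC1 hC2 hC3] := hC.
have [h1 _] := sum_exponent hM T0 hcos hsin c n hC1 hC2 m.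
transitivity (\int[P]_w cos (m * \sum_(0 <= i < n) c i * M (C i) w)).
  apply: ae_eq_Rintegral.
  - apply: measurable_cosM; exact: measurable_elementary_integral.
  - by apply: measurable_cosM; apply: measurable_sum => i; exact: measurable_funM.
  - by apply: filterS h => w ->.
rewrite h1; congr (expR (- _)).
have fin i : lam (C i) \is a fin_num.
  by have [? ?] := hC1 i; exact: (lebesgue_sub0T T0).
have mpf (D : set R) : measurable_fun D (fun u => psi (m * f u)).
  apply: measurable_funTS; apply: (measurableT_comp mpsi).
  by apply: measurable_funM => //; exact: (@measurable_funPT _ _ _ _ f).
rewrite hC3 bigcup_mkord /Rintegral -(big_mkord xpredT C) integral_bigsetU_EFin//=; first last.
- by apply/measurable_EFinP; exact: mpf.
- exact: sub_trivIset hC2.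
- exact: iota_uniq.
- by move=> i; exact: (hC1 i).1.
rewrite (eq_bigr (fun i => (fine (lam (C i)) * psi (m * c i))%:E)).
  by rewrite -(big_morph EFin EFinD erefl).
move=> i _; rewrite (eq_integral (cst (psi (m * c i))%:E)).
  by have mCi := (hC1 i).1; rewrite integral_cst// EFinM fineK// muleC.
by move=> u /set_mem Cu; rewrite (ce i u Cu).1.
Qed.

End elementary_integrals.

(** * Kolmogorov's continuity criterion *)

Section dyadic_interpolation.
Variable R : realType.
Variables (T kappa c : R) (y : R -> R).
Hypothesis T0 : 0 < T.
Hypothesis k0 : 0 < kappa.
Hypothesis c0 : 0 <= c.
Local Notation r := (2 `^ kappa : R).
Definition dyadic (n j : nat) : R := T * j%:R / 2 ^+ n.
Hypothesis hy : forall n j, (j < 2 ^ n)%N ->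
  `|y (dyadic n j.+1) - y (dyadic n j)| <= c / r ^+ n.

Definition dyadic_index (n : nat) (t : R) := Num.truncn (2 ^+ n * t / T).
Definition dyadic_floor (n : nat) (t : R) := dyadic n (dyadic_index n t).
Local Notation a n t := (y (dyadic_floor n t)).

Let p20 n : 0 < 2 ^+ n :> R. Proof. by rewrite exprn_gt0. Qed.
Let r1 : 1 < r.
Proof. by rewrite -[ltLHS](powRr0 2); rewrite /powR gt_eqF// ltr_expR mul0r mulr_gt0// ln_gt0// ltr1n. Qed.
Let r0 : 0 < r. Proof. exact: lt_trans r1. Qed.

Lemma dyadic_indexP n t : 0 <= t ->
  (dyadic_index n t)%:R <= 2 ^+ n * t / T < (dyadic_index n t).+1%:R.
Proof.
move=> t0; apply: truncn_itv.
by rewrite mulr_ge0 ?invr_ge0 ?mulr_ge0// ltW.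
Qed.

Lemma dyadic_index_le n t : 0 <= t <= T -> (dyadic_index n t <= 2 ^ n)%N.
Proof.
move=> /andP[t0 tT]; have /andP[h _] := dyadic_indexP n t0.
rewrite -(ler_nat R) natrX; apply: le_trans h _.
by rewrite ler_pdivrMr// ler_pM2l.
Qed.

Lemma dyadic_floor_bounds n t : 0 <= t ->
  dyadic_floor n t <= t < dyadic_floor n t + T / 2 ^+ n.
Proof.
move=> t0; have /andP[h1 h2] := dyadic_indexP n t0.
rewrite /dyadic_floor /dyadic; apply/andP; split.
  by rewrite ler_pdivrMr//; move: h1; rewrite ler_pdivlMr//; lra.
rewrite -mulrDl ltr_pdivlMr//; move: h2; rewrite ltr_pdivrMr// -natr1; lra.
Qed.

Lemma dyadic_floor_itv n t : 0 <= t <= T -> 0 <= dyadic_floor n t <= T.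
Proof.
move=> /andP[t0 tT]; have /andP[h _] := dyadic_floor_bounds n t0.
rewrite (le_trans h)// andbT /dyadic_floor /dyadic.
by rewrite !mulr_ge0 ?invr_ge0// ltW.
Qed.

Let dyadic_double n j : dyadic n.+1 j.*2 = dyadic n j.
Proof.
rewrite /dyadic -muln2 natrM exprS; field.
by rewrite gt_eqF.
Qed.

(** Halving the mesh keeps the lower grid point or moves it by one step of the finer grid. *)
Let step n t : 0 <= t <= T -> `|a n.+1 t - a n t| <= c / r ^+ n.+1.
Proof.
move=> /[dup] tT /andP[t0 _].
have /andP[h1 h2] := dyadic_indexP n t0.
have /andP[g1 g2] := dyadic_indexP n.+1 t0.
have e : 2 ^+ n.+1 * t / T = 2 * (2 ^+ n * t / T) by rewrite exprS !mulrA.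
rewrite e in g1 g2; rewrite /dyadic_floor.
set i := dyadic_index n t in h1 h2 *; set j := dyadic_index n.+1 t in g1 g2 *.
have lo : (i.*2 <= j)%N.
  rewrite -ltnS -(ltr_nat R) -muln2 natrM mulrC; apply: le_lt_trans g2.
  by rewrite ler_pM2l.
have up : (j <= i.*2.+1)%N.
  rewrite -ltnS -(ltr_nat R); apply: le_lt_trans g1 _.
  by rewrite -doubleS -muln2 natrM mulrC ltr_pM2r.
have jle := dyadic_index_le n.+1 tT; rewrite -/j in jle.
have [->|ji] := eqVneq j i.*2.
  by rewrite dyadic_double subrr normr0 divr_ge0// exprn_ge0// ltW.
have {lo up ji} ji : j = i.*2.+1 by apply/eqP; rewrite eqn_leq up ltn_neqAle eq_sym ji lo.
rewrite -(dyadic_double n i) ji; apply: hy.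
by rewrite -ji.
Qed.

(** The geometric series of c / r^k over k > n has sum C1 / r^n. *)
Let C1 := c / (r - 1).

Let steps n m t : 0 <= t <= T ->
  `|a (n + m)%N t - a n t| <= C1 * ((r ^+ n)^-1 - (r ^+ (n + m))^-1).
Proof.
move=> tT; elim: m => [|m ih].
  by rewrite addn0 !subrr normr0 mulr0.
rewrite addnS -(subrK (a (n + m)%N t) (a (n + m).+1 t)) -addrA.
apply: le_trans (ler_normD _ _) _.
apply: le_trans (lerD (step (n + m) tT) ih) _.
rewrite le_eqVlt; apply/orP; left; apply/eqP; rewrite /C1 exprS; field.
by rewrite subr_eq0 !gt_eqF ?exprn_gt0.
Qed.

Let C10 : 0 <= C1. Proof. by rewrite /C1 divr_ge0// subr_ge0 ltW. Qed.

Let steps' n m t : 0 <= t <= T -> (n <= m)%N -> `|a m t - a n t| <= C1 / r ^+ n.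
Proof.
move=> tT nm; rewrite -(subnKC nm); apply: le_trans (steps _ _ tT) _.
by rewrite ler_wpM2l// gerBl invr_ge0 exprn_ge0// ltW.
Qed.

Let rn0 : (C1 / r ^+ n) @[n --> \oo] --> (0 : R).
Proof.
rewrite -(mulr0 C1); apply: cvgM; first exact: cvg_cst.
under eq_fun do rewrite -exprVn.
by apply: cvg_expr; rewrite ger0_norm ?invr_ge0 ?ltW// invf_lt1.
Qed.

Lemma dyadic_floor_cvg t : 0 <= t <= T -> cvg (a n t @[n --> \oo]).
Proof.
move=> tT; apply: cauchy_cvg; apply: cauchy_exP => e e0.
have /cvgrPdist_lt/(_ _ e0)[N _ hN] := rn0.
exists (a N t); exists N => // m /= Nm.
rewrite /ball/= distrC; apply: le_lt_trans (steps' tT Nm) _.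
have := hN N (leqnn N); rewrite /= sub0r normrN ger0_norm//.
by rewrite divr_ge0// exprn_ge0// ltW.
Qed.

Let L t := lim (a n t @[n --> \oo]).

Let L_dist n t : 0 <= t <= T -> `|L t - a n t| <= C1 / r ^+ n.
Proof.
move=> tT; have h : `|a m t - a n t| @[m --> \oo] --> `|L t - a n t|.
  by apply: cvg_norm; apply: cvgB; [exact: dyadic_floor_cvg | exact: cvg_cst].
apply: (cvgr_to_le h); exists n => // m /= nm.
exact: steps'.
Qed.

(** Points at distance at most one mesh have lower grid points that coincide or are neighbours. *)
Let near_step n s t : 0 <= s -> s < t -> t <= T -> t - s <= T / 2 ^+ n ->
  `|a n t - a n s| <= c / r ^+ n.
Proof.
move=> s0 st tT ts; have t0 : 0 <= t by rewrite (le_trans s0)// ltW.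
have /andP[h1 h2] := dyadic_indexP n s0; have /andP[g1 g2] := dyadic_indexP n t0.
have {}tT : 0 <= t <= T by rewrite t0.
have jle := dyadic_index_le n tT.
rewrite /dyadic_floor; move: h1 h2 g1 g2 jle.
set i := dyadic_index n s; set j := dyadic_index n t => h1 h2 g1 g2 jle.
have lo : (i <= j)%N.
  rewrite -ltnS -(ltr_nat R); apply: le_lt_trans h1 _; apply: le_lt_trans g2.
  by rewrite ler_pM2r ?invr_gt0// ler_pM2l// ltW.
have up : (j <= i.+1)%N.
  rewrite -ltnS -(ltr_nat R); apply: le_lt_trans g1 _.
  rewrite -natr1 ltr_pdivrMr//; move: h2; rewrite ltr_pdivrMr//.
  by move: ts; rewrite ler_pdivlMr//; lra.
have [->|ji] := eqVneq j i.
  by rewrite subrr normr0 divr_ge0// exprn_ge0// ltW.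
have {lo up} ji' : j = i.+1 by apply/eqP; rewrite eqn_leq up ltn_neqAle eq_sym ji lo.
by rewrite ji'; apply: hy; rewrite -ji'.
Qed.

(** [y] is controlled on the dyadic grid only, so the limit [L] along lower grid points replaces it.
    At the scale of [t - s] one grid step and two approximation errors add up to the constant
    [C2]. *)
Lemma dyadic_floor_hoelder : hoelder_continuous T kappa L.
Proof.
pose C2 := 2 * C1 + c.
have C20 : 0 <= C2 by rewrite addr_ge0// mulr_ge0.
suff h s t : 0 <= s -> s < t -> t <= T ->
    `|L t - L s| <= C2 * (2 / T) `^ kappa * `|t - s| `^ kappa.
  exists (C2 * (2 / T) `^ kappa) => s t /andP[s0 sT] /andP[t0 tT].
  have [st|ts|->] := ltgtP s t; first exact: h.
    by rewrite distrC [in leRHS]distrC; exact: h.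
  by rewrite subrr normr0 !mulr_ge0 ?powR_ge0.
move=> s0 st tT; have dl : 0 < t - s by rewrite subr_gt0.
have t0 : 0 <= t by rewrite (le_trans s0)// ltW.
have ex : exists n, T / 2 ^+ n.+1 < t - s.
  have cT : (T * (2^-1) ^+ n) @[n --> \oo] --> (0 : R).
    rewrite -(mulr0 T); apply: cvgM; first exact: cvg_cst.
    by apply: cvg_expr; rewrite ger0_norm ?invr_ge0// invf_lt1// ltr1n.
  have /cvgrPdist_lt/(_ _ dl)[N _ hN] := cT.
  exists N; have := hN N.+1 (leqnSn N); rewrite /= sub0r normrN ger0_norm ?exprVn//.
  by rewrite mulr_ge0// ?invr_ge0 ltW// invr_gt0.
(* Minimality gives the upper bound on [t - s]; for [n = 0] that bound is [T] itself. *)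
pose n := ex_minn ex.
have [hn1 hn2] : T / 2 ^+ n.+1 < t - s /\ t - s <= T / 2 ^+ n.
  rewrite /n; case: ex_minnP => [[|m]] h1 h2; split => //.
    by rewrite expr0 divr1; lra.
  by rewrite leNgt; apply/negP => /h2; rewrite ltnn.
have sT : 0 <= s <= T by rewrite s0 (le_trans (ltW st)).
have tT' : 0 <= t <= T by rewrite t0.
have -> : L t - L s = (L t - a n t) + (a n t - a n s) + (a n s - L s) by ring.
apply: (@le_trans _ _ (C2 / r ^+ n)).
  apply: le_trans (ler_normD _ _) _.
  apply: le_trans (lerD (ler_normD _ _) (lexx _)) _.
  rewrite [X in _ + X]distrC.
  have := L_dist n tT'; have := L_dist n sT; have := near_step s0 st tT hn2.
  by rewrite /C2 mulrDl; lra.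
(* It remains to raise 2^(-n) < (2 / T) (t - s) to the power [kappa]; this is where the factor with
   base 2 / T comes from. *)
rewrite -mulrA; apply: ler_wpM2l => //.
rewrite ger0_norm ?(ltW dl)// -powRM ?divr_ge0 ?(ltW dl) ?(ltW T0)//.
have -> : (r ^+ n)^-1 = (2 ^+ n)^-1 `^ kappa.
  rewrite -powR_mulrn ?powR_ge0// -powRrM -powRN.
  rewrite -powR_mulrn// -powRN -powRrM; congr (_ `^ _); ring.
apply: ge0_ler_powR; rewrite ?nnegrE.
- exact: ltW.
- by rewrite invr_ge0 ltW.
- by rewrite mulr_ge0 ?divr_ge0 ?(ltW dl) ?(ltW T0).
- move: hn1; rewrite exprS ltr_pdivrMr ?mulr_gt0// => h.
  have -> : 2 / T * (t - s) = ((t - s) * 2) / T by ring.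
  rewrite ler_pdivlMr// mulrC ler_pdivrMr//.
  by rewrite -mulrA; apply: ltW; exact: h.
Qed.

End dyadic_interpolation.

Lemma cvg_exprn (R : realType) (u : R^nat) (l : R) (p : nat) :
  u n @[n --> \oo] --> l -> u n ^+ p @[n --> \oo] --> l ^+ p.
Proof.
move=> ul; elim: p => [|p ih]; first exact: cvg_cst.
rewrite exprS (_ : (fun n => _) = fun n => u n * u n ^+ p); first exact: cvgM.
by apply/funext => n; rewrite exprS.
Qed.

(** * Almost sure bounds on dyadic increments and the modification *)

Section Kolmogorov_continuity.
Context d (Omega : measurableType d) (R : realType).
Variables (P : probability Omega R) (T k0 : R) (Y : R -> {RV P >-> R}).
Hypothesis T0 : 0 < T.
Hypothesis k00 : 0 < k0.
Hypothesis hY : forall kappa, 0 < kappa < k0 -> exists (p : nat) (C q : R),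
  [/\ (0 < p)%N, 1 + kappa * p%:R < q &
    forall s t, 0 <= s -> s < t -> t <= T ->
    (\int[P]_w ((`|Y t w - Y s w| ^+ p)%:E) <= (C * (t - s) `^ q)%:E)%E].

Let dy := dyadic T.

Let mY s t (p : nat) : measurable_fun setT (fun w => `|Y t w - Y s w| ^+ p).
Proof.
apply: measurable_funX; apply: measurableT_comp => //.
exact: measurable_funB.
Qed.

(* Summing the scaled p-th powers of all dyadic increments replaces the
   Borel-Cantelli argument: the sum has finite expectation. *)
Let scaled_sum kappa (p : nat) w := (\sum_(0 <= n <oo) \sum_(0 <= j < 2 ^ n)
  (((2 `^ kappa) ^+ n * `|Y (dy n j.+1) w - Y (dy n j) w|) ^+ p)%:E)%E.

Let m_term kappa (p n j : nat) : measurable_fun setT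
  (fun w => (((2 `^ kappa) ^+ n * `|Y (dy n j.+1) w - Y (dy n j) w|) ^+ p)%:E).
Proof.
apply/measurable_EFinP; apply: measurable_funX; apply: measurable_funM => //.
by apply: measurableT_comp => //; exact: measurable_funB.
Qed.

Let term_ge0 kappa (p n j : nat) w :
  (0 <= (((2 `^ kappa) ^+ n * `|Y (dy n j.+1) w - Y (dy n j) w|) ^+ p)%:E)%E.
Proof. by rewrite lee_fin exprn_ge0// mulr_ge0// exprn_ge0 ?powR_ge0. Qed.

Let m_scaled_sum kappa p : measurable_fun setT (scaled_sum kappa p).
Proof.
apply: ge0_emeasurable_sum => [n w _ _|n _]; first exact: sume_ge0.
by apply: emeasurable_sum => j; exact: m_term.
Qed.

(** Level [n] has 2^n increments, each with scaled moment at most C T^q 2^((kappa p - q) n). The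
    expectation is thus bounded by a geometric series of ratio [rho], which is below 1 exactly
    because 1 + kappa p < q. *)
Let scaled_sum_fin kappa (p : nat) (C q : R) : (0 < p)%N ->
  0 < kappa -> 1 + kappa * p%:R < q ->
  (forall s t, 0 <= s -> s < t -> t <= T ->
    (\int[P]_w ((`|Y t w - Y s w| ^+ p)%:E) <= (C * (t - s) `^ q)%:E)%E) ->
  {ae P, forall w, (scaled_sum kappa p w < +oo)%E}.
Proof.
move=> p0 ka0 hq h.
have C0 : 0 <= C.
  have := h 0 T (lexx 0) T0 (lexx T); rewrite subr0 => /(le_trans (integral_ge0 _ _)).
  move=> /(_ ltac:(by move=> w _; rewrite lee_fin exprn_ge0)).
  by rewrite lee_fin pmulr_lge0// powR_gt0.
pose rho : R := 2 `^ (1 + kappa * p%:R - q).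
have rho0 : 0 <= rho by exact: powR_ge0.
have rho1 : rho < 1.
  have l2 : 0 < ln 2 :> R by rewrite ln_gt0// ltr1n.
  by rewrite /rho /powR gt_eqF// expR_lt1 nmulr_rlt0 ?subr_lt0.
have Eterm n j : (j < 2 ^ n)%N ->
    (\int[P]_w (((2 `^ kappa) ^+ n * `|Y (dy n j.+1) w - Y (dy n j) w|) ^+ p)%:E <=
     (C * T `^ q * (2 `^ (kappa * p%:R - q)) ^+ n)%:E)%E.
  move=> jn.
  have e : dy n j.+1 - dy n j = T / 2 ^+ n.
    by rewrite /dy /dyadic -natr1; field; rewrite gt_eqF ?exprn_gt0.
  have dpos : 0 < T / 2 ^+ n by rewrite divr_gt0 ?exprn_gt0.
  have h1 : 0 <= dy n j by rewrite /dy /dyadic !mulr_ge0 ?invr_ge0 ?exprn_ge0// ltW.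
  have h2 : dy n j < dy n j.+1 by rewrite -subr_gt0 e.
  have h3 : dy n j.+1 <= T.
    rewrite /dy /dyadic -mulrA ger_pMr// ler_pdivrMr ?exprn_gt0// mul1r -natrX ler_nat.
    exact: jn.
  under eq_integral do rewrite exprMn EFinM.
  rewrite ge0_integralZl//=; last by apply/measurable_EFinP; exact: mY.
  apply: le_trans (lee_wpmul2l _ (h _ _ h1 h2 h3)) _.
    by rewrite lee_fin exprn_ge0// exprn_ge0 ?powR_ge0.
  rewrite e -EFinM lee_fin le_eqVlt; apply/orP; left; apply/eqP.
  rewrite powRM ?invr_ge0 ?exprn_ge0// ?(ltW T0)//.
  have -> : (2 ^+ n)^-1 `^ q = (2 `^ (- q)) ^+ n :> R.
    rewrite -powR_mulrn ?powR_ge0// -powRrM -powR_mulrn// -powRN -powRrM.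
    by congr (_ `^ _); ring.
  have -> : (2 `^ (kappa * p%:R - q)) ^+ n = (2 `^ kappa) ^+ n ^+ p * (2 `^ (- q)) ^+ n :> R.
    rewrite -exprM mulnC exprM -exprMn; congr (_ ^+ _).
    by rewrite powRD ?pnatr_eq0 ?implybT// powRrM powR_mulrn ?powR_ge0.
  by ring.
have Elevel n : (\int[P]_w (\sum_(0 <= j < 2 ^ n)
    (((2 `^ kappa) ^+ n * `|Y (dy n j.+1) w - Y (dy n j) w|) ^+ p)%:E) <=
    (C * T `^ q * rho ^+ n)%:E)%E.
  rewrite ge0_integral_sum//.
  apply: (@le_trans _ _ (\sum_(0 <= j < 2 ^ n)
     (C * T `^ q * (2 `^ (kappa * p%:R - q)) ^+ n)%:E)%E).
    rewrite big_nat_cond [leRHS]big_nat_cond.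
    by apply: lee_sum => j /andP[/andP[_ jn] _]; exact: Eterm.
  rewrite sumEFin lee_fin sumr_const_nat subn0 -[leLHS]mulr_natr natrX.
  rewrite le_eqVlt; apply/orP; left; apply/eqP.
  have -> : rho = 2 `^ (kappa * p%:R - q) * 2.
    rewrite /rho -addrA powRD ?pnatr_eq0 ?implybT// powRr1// mulrC//.
  by rewrite exprMn mulrA.
have Efin : (\int[P]_w (scaled_sum kappa p w) < +oo)%E.
  rewrite /scaled_sum integral_nneseries//; last first.
  - by move=> n w _; exact: sume_ge0.
  - by move=> n; apply: emeasurable_sum => j; exact: m_term.
  apply: (@le_lt_trans _ _ (C * T `^ q * (1 - rho)^-1)%:E); last exact: ltry.
  apply: lime_le.
    by apply: is_cvg_nneseries => n _ _; apply: integral_ge0 => w _; exact: sume_ge0.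
  apply: nearW => N.
  apply: (@le_trans _ _ (\sum_(0 <= n < N) (C * T `^ q * rho ^+ n)%:E)%E).
    by apply: lee_sum => n _; exact: Elevel.
  rewrite sumEFin lee_fin -mulr_sumr ler_wpM2l ?mulr_ge0 ?powR_ge0//.
  rewrite big_mkord -[leRHS]mul1r ler_pdivlMr ?subr_gt0// mulrC.
  have := subrX1 rho N; have := exprn_ge0 N rho0; lra.
have mS : measurable_fun setT (scaled_sum kappa p) by exact: m_scaled_sum.
have S0 w : (0 <= scaled_sum kappa p w)%E.
  by apply: nneseries_ge0 => n _ _; exact: sume_ge0.
have iS : P.-integrable setT (scaled_sum kappa p).
  apply/integrableP; split => //; apply: le_lt_trans Efin.
  by apply: ge0_le_integral => //; [exact: measurableT_comp|move=> w _; rewrite gee0_abs].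
have := integrable_ae measurableT iS.
apply: filterS => w /(_ I); rewrite fin_numElt => /andP[_]; exact.
Qed.

Lemma Kolmogorov_continuity : exists2 Y' : R -> {RV P >-> R}, modification T Y Y' &
  forall (w : Omega) kappa, 0 < kappa < k0 -> hoelder_continuous T kappa (fun t => Y' t w).
Proof.
(* A sequence of exponents approaching [k0]: countably many null sets then serve all [kappa] below
   [k0]. *)
pose kap i : R := k0 - k0 / i.+2%:R.
have kapP i : 0 < kap i < k0.
  rewrite /kap subr_gt0 ltrBlDr ltrDl divr_gt0// andbT.
  by rewrite ltr_pdivrMr// ltr_pMr// ltr1n.
have /choice[p hp] : forall i, exists p : nat, (0 < p)%N /\
    {ae P, forall w, (scaled_sum (kap i) p w < +oo)%E}.
  move=> i; have [p [C [q [p0 hq h]]]] := hY (kapP i).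
  exists p; split => //; apply: scaled_sum_fin hq h => //.
  by case/andP: (kapP i).
pose G := \bigcap_i [set w | (scaled_sum (kap i) (p i) w < +oo)%E].
have mG : measurable G.
  apply: bigcapT_measurable => i; rewrite -[X in measurable X]setTI.
  by apply: emeasurable_fun_infty_o => //; exact: m_scaled_sum.
have aeG : {ae P, forall w, G w}.
  have : {ae P, forall w, forall i, (scaled_sum (kap i) (p i) w < +oo)%E}.
    by apply/ae_foralln => i; case: (hp i).
  by apply: filterS => w h i _; exact: h.
have incr w i n j : G w -> (j < 2 ^ n)%N ->
    `|Y (dy n j.+1) w - Y (dy n j) w| <=
    (1 + fine (scaled_sum (kap i) (p i) w)) / (2 `^ kap i) ^+ n.
  move=> /(_ i I)/= Gw jn.
  have r0 : 0 < 2 `^ kap i ^+ n by rewrite exprn_gt0// powR_gt0.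
  rewrite ler_pdivlMr// mulrC; set x := _ * _.
  have x0 : 0 <= x by rewrite mulr_ge0// ltW.
  have S0 : (0 <= scaled_sum (kap i) (p i) w)%E.
    by apply: nneseries_ge0 => m _ _; exact: sume_ge0.
  (* The summand 1 covers small [x]; for larger [x] one has x <= x^p, so no root of the sum has to
     be taken. *)
  have [x1|x1] := leP x 1; first by rewrite (le_trans x1)// lerDl fine_ge0.
  apply: (@le_trans _ _ (x ^+ p i)); first by rewrite ler_eXnr ?(ltW x1)//; case: (hp i).
  apply: (@le_trans _ _ (fine (scaled_sum (kap i) (p i) w))); last by rewrite lerDr.
  rewrite -lee_fin fineK; last by rewrite ge0_fin_numE.
  apply: (@le_trans _ _ (\sum_(0 <= j < 2 ^ n) (((2 `^ kap i) ^+ n *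
     `|Y (dy n j.+1) w - Y (dy n j) w|) ^+ p i)%:E)%E).
    rewrite big_mkord (bigD1 (Ordinal jn))//= leeDl//.
    by apply: sume_ge0 => k _; exact: term_ge0.
  rewrite /scaled_sum.
  apply: le_trans (nneseries_lim_ge n.+1 _) => /=.
    rewrite big_nat_recr//= leeDr//.
    by apply: sume_ge0 => k _; exact: sume_ge0.
  by move=> k _ _; exact: sume_ge0.
(* Off the measurable set [G] all values are 0, so the limits exist and the Hoelder bounds hold for
   every [w], not just almost surely. *)
pose y n t w := \1_G w * Y (dyadic_floor T n t) w.
have kap0 i : 0 < kap i by case/andP: (kapP i).
have c0 i w : 0 <= 1 + fine (scaled_sum (kap i) (p i) w).
  rewrite addr_ge0// fine_ge0//.
  by apply: nneseries_ge0 => m _ _; exact: sume_ge0.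
have ycvg t w : 0 <= t <= T -> cvg (y n t w @[n --> \oo]).
  move=> tT; have [Gw|Gw] := pselect (G w); last first.
    rewrite /y; under eq_fun do rewrite indicE memNset// mul0r.
    exact: is_cvg_cst.
  rewrite /y; under eq_fun do rewrite indicE mem_set// mul1r.
  exact: (@dyadic_floor_cvg _ _ _ _ (fun u => Y u w) T0 (kap0 0%N) (c0 0%N w)
    (fun n j => @incr w 0%N n j Gw) t tT).
pose Y1 (t : R) w : R := if (0 <= t <= T) then lim (y n t w @[n --> \oo]) else 0.
have mY1 t : measurable_fun setT (Y1 t).
  have [tT|tT] := boolP (0 <= t <= T); last first.
    by rewrite (_ : Y1 t = cst 0)//; apply/funext => w; rewrite /Y1 (negbTE tT).
  rewrite (_ : Y1 t = fun w => lim (y n t w @[n --> \oo])); last first.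
    by apply/funext => w; rewrite /Y1 tT.
  apply: (measurable_fun_cvg (h := fun n w => y n t w)) => [n|w _]; last exact: ycvg.
  by apply: measurable_funM => //; exact: measurable_indic.
pose Y' t : {RV P >-> R} := mfun_Sub (mem_set (mY1 t)).
exists Y'.
  (* Along lower dyadic points the moment bound tends to 0, and Fatou's lemma makes the moment of
     [Y t - Y1 t] vanish. One admissible exponent is enough; [kap 0] is taken. *)
  move=> t tT; have [p0 [C [q [pp0 hq h]]]] := hY (kapP 0%N).
  have q0 : 0 < q.
    by apply: lt_trans hq; rewrite ltr_pwDl// mulr_ge0// ltW.
  have mf s : measurable_fun setT (fun w => `|Y t w - Y s w| ^+ p0) by exact: mY.
  have mf' : measurable_fun setT (fun w => `|Y t w - Y1 t w| ^+ p0).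
    apply: measurable_funX; apply: measurableT_comp => //.
    exact: measurable_funB.
  have cf : {ae P, forall w, setT w ->
      `|Y t w - Y (dyadic_floor T n t) w| ^+ p0 @[n --> \oo] --> `|Y t w - Y1 t w| ^+ p0}.
    apply: filterS aeG => w Gw _.
    apply: cvg_exprn; apply: cvg_norm; apply: cvgB; first exact: cvg_cst.
    rewrite /Y1 tT; have := ycvg t w tT.
    by rewrite /y; under eq_fun do rewrite indicE mem_set// mul1r.
  have bd n : (\int[P]_w (`|Y t w - Y (dyadic_floor T n t) w| ^+ p0)%:E <=
      (C * (t - dyadic_floor T n t) `^ q)%:E)%E.
    have /andP[t0 tT'] := tT.
    have /andP[h1 h2] := dyadic_floor_bounds T0 n t0.
    have /andP[h3 h4] := dyadic_floor_itv T0 n tT.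
    have [e|ne] := eqVneq (dyadic_floor T n t) t; last by apply: h => //; rewrite lt_neqAle ne.
    rewrite e subrr powR0 ?gt_eqF// mulr0 integral0_eq// => w _.
    by rewrite subrr normr0 expr0n gtn_eqF.
  have bl : (C * (t - dyadic_floor T n t) `^ q)%:E @[n --> \oo] --> 0%E.
    apply: cvg_EFin; first exact: nearW.
    rewrite -(mulr0 C); apply: cvgM; first exact: cvg_cst.
    have /andP[t0 _] := tT.
    have geo : (T `^ q * (2 `^ (- q)) ^+ n) @[n --> \oo] --> (0 : R).
      rewrite -(mulr0 (T `^ q)); apply: cvgM; first exact: cvg_cst.
      apply: cvg_expr; rewrite ger0_norm ?powR_ge0//.
      have l2 : 0 < ln 2 :> R by rewrite ln_gt0// ltr1n.
      by rewrite /powR gt_eqF// expR_lt1 nmulr_rlt0// oppr_lt0.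
    apply: (squeeze_cvgr _ (cvg_cst 0) geo); apply: nearW => n.
    rewrite powR_ge0/=; have /andP[h1 h2] := dyadic_floor_bounds T0 n t0.
    have -> : T `^ q * (2 `^ (- q)) ^+ n = (T / 2 ^+ n) `^ q.
      rewrite powRM ?(ltW T0) ?invr_ge0 ?exprn_ge0//; congr (_ * _).
      rewrite -powR_mulrn ?powR_ge0// -powRrM -powR_mulrn// -powRN -powRrM.
      by congr (_ `^ _); ring.
    apply: ge0_ler_powR; rewrite ?nnegrE ?subr_ge0 ?(ltW q0) ?divr_ge0 ?(ltW T0) ?exprn_ge0//.
    by rewrite lerBlDl ltW.
  have := fatou_le measurableT (fun n => mf _) mf' (fun n w _ => exprn_ge0 _ (normr_ge0 _)) cf bd bl.
  move=> i0; have {}i0 : (\int[P]_w `|(`|Y t w - Y1 t w| ^+ p0)%:E| = 0)%E.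
    apply/eqP; rewrite eq_le integral_ge0// andbT; apply: le_trans i0.
    by apply: ge0_le_integral => //; [by do 2 apply: measurableT_comp => //|exact/measurable_EFinP|move=> w _; rewrite gee0_abs].
  have /(ae_eq_integral_abs _ measurableT) := i0 => /(_ ltac:(exact/measurable_EFinP)).
  apply: filterS => w /(_ I)/= [] /eqP.
  by rewrite expf_eq0 pp0 normr_eq0 subr_eq0 => /eqP.
move=> w kappa /andP[ka0 kak].
have [Gw|Gw] := pselect (G w); last first.
  have e u : 0 <= u <= T -> Y1 u w = 0.
    rewrite /Y1 => ->; rewrite /y; under eq_fun do rewrite indicE memNset// mul0r.
    exact: lim_cst.
  by exists 0 => s t sT tT; rewrite mul0r /= !e// subrr normr0.
have e u : 0 <= u <= T -> Y1 u w = lim (Y (dyadic_floor T n u) w @[n --> \oo]).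
  by rewrite /Y1 => ->; rewrite /y; under eq_fun do rewrite indicE mem_set// mul1r.
(* The requirement is k0 / (k0 - kappa) <= i + 2. Lowering the exponent from [kap i] to [kappa]
   costs a power of [T]. *)
have [i ki] : exists i, kappa <= kap i.
  exists (Num.truncn (k0 / (k0 - kappa))).
  have := ltW (truncnS_gt (k0 / (k0 - kappa))); set m := Num.truncn _.
  rewrite ler_pdivrMr ?subr_gt0// => hm.
  rewrite /kap lerBrDl -lerBrDr ler_pdivrMr// mulrC.
  apply: le_trans hm _; apply: ler_wpM2r; last by rewrite ler_nat.
  by rewrite subr_ge0 ltW.
have [c hc] := @dyadic_floor_hoelder _ _ _ _ (fun u => Y u w) T0 (kap0 i) (c0 i w)
  (fun n j => @incr w i n j Gw).
exists (`|c| * T `^ (kap i - kappa)) => s t sT tT.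
rewrite /= !e//.
apply: le_trans (hc _ _ sT tT) _.
apply: (@le_trans _ _ (`|c| * `|t - s| `^ kap i)).
  by rewrite ler_wpM2r ?powR_ge0// ler_norm.
rewrite -mulrA ler_wpM2l//.
have -> : kap i = (kap i - kappa) + kappa by rewrite subrK.
rewrite powRD; last by rewrite subrK gt_eqF.
rewrite addrK ler_wpM2r ?powR_ge0// ge0_ler_powR ?nnegrE ?subr_ge0// ?(ltW T0)//.
by rewrite ler_norml; lra.
Qed.

End Kolmogorov_continuity.

(** * Setwise convergence of integrals *)

Section measure_limits.
Context d (T : measurableType d) (R : realType).
Variable mu : {measure set T -> \bar R}.

Lemma Rintegral_subset (A B : set T) (f : T -> R) : A `<=` B ->
  \int[mu]_(x in A) f x = \int[mu]_(x in B) (f x * \1_A x).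
Proof.
move=> AB; rewrite Rintegral_mkcond [RHS]Rintegral_mkcond.
congr (fine (integral _ _ _)); apply/funext => x /=; congr EFin.
rewrite !patchE indicE; have [xA|xA] := boolP (x \in A).
  by rewrite mulr1 ifT// inE; apply: AB; rewrite inE in xA.
by rewrite mulr0; case: ifP.
Qed.

Variables (B : set T) (phi_ : nat -> T -> R) (phi : T -> R).
Hypothesis mB : measurable B.
Hypothesis fB : (mu B < +oo)%E.
Hypothesis mphi_ : forall n, measurable_fun B (phi_ n).
Hypothesis phi_ge0 : forall n x, 0 <= phi_ n x.
Hypothesis phi_bd : forall n, exists M, forall x, B x -> phi_ n x <= M.
Hypothesis iphi : mu.-integrable B (EFin \o phi).
Hypothesis cphi : {ae mu, forall x, B x -> phi_ n x @[n --> \oo] --> phi x}.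
Hypothesis cA : forall A, measurable A -> A `<=` B ->
  cvg (\int[mu]_(x in A) phi_ n x @[n --> \oo]).

(** The sets [Fk] are the disjoint layers of this increasing sequence. A set [S] of integers names
    the Borel set [D S], so that integrals become set functions on [nat], as [gliding_hump]
    requires. *)
Let Ek (k : nat) : set T := \bigcap_n (B `&` [set x | phi_ n x <= k%:R]).
Let Fk := seqDU Ek.
Let D (S : set nat) := \bigcup_(k in S) Fk k.

Let mEk k : measurable (Ek k).
Proof.
apply: bigcapT_measurable => n.
rewrite (_ : [set x | _] = phi_ n @^-1` `]-oo, k%:R]).
  by apply: mphi_ => //; exact: measurable_itv.
by apply/seteqP; split => x /=; rewrite in_itv/=.
Qed.

Let mFk k : measurable (Fk k). Proof. exact: seqDU_measurable. Qed.

Let mD S : measurable (D S).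
Proof. by apply: bigcup_measurable => k _; exact: mFk. Qed.

Let Fk_le k n x : Fk k x -> B x /\ phi_ n x <= k%:R.
Proof. by move=> [h _]; exact: (h n I). Qed.

Let DB S : D S `<=` B.
Proof. by move=> x [k _ /(@Fk_le k 0%N)[]]. Qed.

Let Ddisj S S' : S `&` S' = set0 -> D S `&` D S' = set0.
Proof.
move=> SS; apply/seteqP; split => // x [[k Sk Fx] [l Sl Gx]].
have : k = l by apply: (@trivIset_seqDU _ Ek k l I I); exists x.
move=> kl; have : (S `&` S') l by rewrite kl in Sk.
by rewrite SS.
Qed.

(** A convergent sequence is bounded, so almost every point lies in some layer. *)
Let Dfull : mu.-negligible (B `\` D setT).
Proof.
apply: negligibleS cphi => x [Bx nD] /= /(_ Bx) cx; apply: nD.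
rewrite /D /Fk -seqDU_bigcup_eq.
have [M [_ hM]] := cvg_seq_bounded (cvgP _ cx).
exists (Num.truncn (M + 1)).+1 => // n _; split => //=.
apply: (@le_trans _ _ (M + 1)); last exact/ltW/truncnS_gt.
by apply: le_trans (ler_norm _) (hM (M + 1) _ n I); rewrite ltrDl.
Qed.

Let int_phi_ n A : measurable A -> A `<=` B -> mu.-integrable A (EFin \o phi_ n).
Proof.
move=> mA AB; apply: (integrableS mB) => //.
have [M hM] := phi_bd n.
apply: (bounded_integrable (M := M)) => // x Bx.
by rewrite ger0_norm ?hM.
Qed.

Let int_D_setU f S S' : mu.-integrable B (EFin \o f) -> S `&` S' = set0 ->
  \int[mu]_(x in D (S `|` S')) f x = \int[mu]_(x in D S) f x + \int[mu]_(x in D S') f x.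
Proof.
move=> fi SS; rewrite [D (S `|` S')]bigcup_setU.
rewrite Rintegral_setU//.
- by apply: mD.
- by apply: mD.
- apply: (integrableS mB) => //; first by apply: measurableU; exact: mD.
  by rewrite subUset; split; exact: DB.
- by apply/disj_setPS; rewrite Ddisj.
Qed.

Let indic_tail x : \1_(D [set k | (K <= k)%N]) x @[K --> \oo] --> (0 : R).
Proof.
have [[l _ Fx]|nD] := pselect (D setT x).
  apply: cvg_near_cst; exists l.+1 => // K /= lK.
  rewrite indicE memNset// => -[k /= Kk Gx].
  have : k = l by apply: (@trivIset_seqDU _ Ek k l I I); exists x.
  by move=> kl; move: Kk; rewrite kl leqNgt lK.
apply: cvg_near_cst; apply: nearW => K.
by rewrite indicE memNset// => -[k _ Gx]; apply: nD; exists k.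
Qed.

Let int_tail f : mu.-integrable B (EFin \o f) ->
  \int[mu]_(x in D [set k | (K <= k)%N]) f x @[K --> \oo] --> 0.
Proof.
move=> fi; under eq_fun do rewrite (Rintegral_subset _ (@DB _)).
have -> : 0 = \int[mu]_(x in B) (cst 0 x : R).
  by rewrite /Rintegral integral0.
have mf : measurable_fun B f by apply/measurable_EFinP; case/integrableP: fi.
apply: (dominated_cvg_Rintegral (g := fun x => `|f x|)) => //.
- by move=> n; apply: measurable_funM => //; exact: measurable_indic.
- apply: aeW => x _; rewrite -(mulr0 (f x)); apply: cvgM; first exact: cvg_cst.
  exact: indic_tail.
- exact: integrable_norm.
- by move=> n x _; rewrite normrM indicE; case: (_ \in _); rewrite ?normr1 ?mulr1// normr0 mulr0.
Qed.

Let int_full f : measurable_fun B f ->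
  \int[mu]_(x in D setT) f x = \int[mu]_(x in B) f x.
Proof.
move=> mf; rewrite (Rintegral_subset _ (@DB _)); congr fine.
apply: ae_eq_integral => //.
- by apply/measurable_EFinP; apply: measurable_funM => //; exact: measurable_indic.
- exact/measurable_EFinP.
apply: negligibleS Dfull => x /= /not_implyP[Bx] h; split => // Dx; apply: h.
by rewrite indicE mem_set// mulr1.
Qed.

(* The gliding hump yields countable additivity of the limit functional along
   the level sets of [sup_n phi_ n], on each of which convergence is bounded. *)
Lemma cvg_Rintegral_setwise :
  \int[mu]_(x in B) phi_ n x @[n --> \oo] --> \int[mu]_(x in B) phi x.
Proof.
have mphi : measurable_fun B phi by apply/measurable_EFinP; case/integrableP: iphi.
pose v n S := \int[mu]_(x in D S) phi_ n x.
pose w S := lim (v n S @[n --> \oo]).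
have vw S : v n S @[n --> \oo] --> w S by exact: (cA (mD S) (@DB S)).
have i_ n : mu.-integrable B (EFin \o phi_ n) by exact: int_phi_.
have tail := @gliding_hump _ v w.
have {tail} tail : w [set k | (K <= k)%N] @[K --> \oo] --> 0.
  apply: tail => //.
  - by move=> n A; apply: Rintegral_ge0.
  - by move=> n A A'; apply: int_D_setU.
  - by move=> n; apply: int_tail.
have head K : w [set k | (k < K)%N] = \int[mu]_(x in D [set k | (k < K)%N]) phi x.
  apply: (cvg_lim (@Rhausdorff R)).
  apply: (@bounded_cvg_Rintegral _ _ _ _ _ _ _ K%:R) => //.
  - apply: le_lt_trans fB; apply: le_measure; rewrite ?inE//.
  - by move=> n; apply: measurable_funS (mphi_ n) => //; exact: DB.
  - by apply: measurable_funS mphi => //; exact: DB.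
  - by apply: filterS cphi => x h /DB.
  - move=> n x [k /= kK Fx]; rewrite ger0_norm//.
    have [_ h] := Fk_le n Fx; rewrite (le_trans h)// ler_nat ltnW//.
have wsplit K : w setT = \int[mu]_(x in D [set k | (k < K)%N]) phi x + w [set k | (K <= k)%N].
  rewrite -head; have := cvgD (vw [set k | (k < K)%N]) (vw [set k | (K <= k)%N]).
  have e : setT = [set k | (k < K)%N] `|` [set k | (K <= k)%N].
    by apply/seteqP; split => // k _ /=; case: ltnP; [left|right].
  move=> h; rewrite {1}e; apply: (cvg_lim (@Rhausdorff R)).
  rewrite (_ : (fun n => _) = (fun n => v n [set k | (k < K)%N] + v n [set k | (K <= k)%N])).
    exact: h.
  apply/funext => n; rewrite /v int_D_setU//; apply/seteqP; split => // k /= [].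
  by rewrite ltnNge => /negP.
have e : w setT = \int[mu]_(x in B) phi x.
  rewrite -int_full//.
  have h K : \int[mu]_(x in D setT) phi x =
      \int[mu]_(x in D [set k | (k < K)%N]) phi x + \int[mu]_(x in D [set k | (K <= k)%N]) phi x.
    rewrite -int_D_setU//; last first.
      apply/seteqP; split => // k /= [].
      by rewrite ltnNge => /negP.
    congr (Rintegral _ (D _) _).
    by apply/seteqP; split => // k _ /=; case: ltnP; [left|right].
  (* For every [K] the two totals differ by the difference of their tails beyond [K], and both tails
     tend to 0. *)
  apply/eqP; rewrite -subr_eq0; apply/eqP.
  have h1 : (w [set k | (K <= k)%N] - \int[mu]_(x in D [set k | (K <= k)%N]) phi x)
     @[K --> \oo] --> 0 - 0 by apply: cvgB => //; exact: int_tail.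
  have h2 : (w [set k | (K <= k)%N] - \int[mu]_(x in D [set k | (K <= k)%N]) phi x)
     @[K --> \oo] --> w setT - \int[mu]_(x in D setT) phi x.
    apply: cvg_near_cst; apply: nearW => K.
    by rewrite (wsplit K) (h K); ring.
  rewrite -(subr0 0); exact: (cvg_unique (@Rhausdorff R) h2 h1).
rewrite -e; have := vw setT; rewrite (_ : v^~ setT = (fun n => \int[mu]_(x in B) phi_ n x))//.
by apply/funext => n; rewrite /v int_full.
Qed.

End measure_limits.

(** * Limits of cosine means and moment bounds *)

Section trigonometric_bounds.
Variable R : realType.

Lemma lipschitz1 (f df : R -> R) (x y : R) : (forall z, is_derive z (1 : R) f (df z)) ->
  (forall z, `|df z| <= 1) -> `|f x - f y| <= `|x - y|.
Proof.
move=> fd df1; wlog xy : x y / y < x.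
  move=> h; have [yx|xy|->] := ltgtP y x; first exact: h.
    by rewrite distrC [leRHS]distrC; exact: h.
  by rewrite !subrr.
have cf : {within `[y, x], continuous f}.
  apply: continuous_subspaceT => u.
  by apply/differentiable_continuous/derivable1_diffP; exact: (@ex_derive _ _ _ _ _ _ _ (fd u)).
have [c _ ->] := MVT xy (fun z _ => fd z) cf.
by rewrite normrM ler_piMl.
Qed.

Lemma norm_sin_le (x : R) : `|sin x| <= `|x|.
Proof.
have := @lipschitz1 (@sin R) (@cos R) x 0 (fun z => is_derive_sin z).
by rewrite sin0 !subr0; apply => z; exact: cos_max.
Qed.

Lemma norm_cosB_le (x y : R) : `|cos x - cos y| <= `|x - y|.
Proof.
apply: (@lipschitz1 (@cos R) (fun z => - sin z)) => z.
by rewrite normrN; exact: sin_max.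
Qed.

(** Squared chord length: it exhibits (2 - 2 cos (u x)) / u^2 as the square of a quotient that tends
    to [x] with [u]. *)
Lemma two_sub_cos (x : R) : 2 - 2 * cos x = (2 * sin (x / 2)) ^+ 2.
Proof.
have {1}-> : x = (x / 2) *+ 2 by rewrite -mulr_natr -mulrA mulVf ?mulr1// pnatr_eq0.
rewrite cos_mulr2n exprMn sin2cos2 -mulr_natr; ring.
Qed.

Lemma cos_ge_quadratic (x : R) : 1 - x ^+ 2 / 2 <= cos x.
Proof.
have := two_sub_cos x; rewrite exprMn => h.
have : sin (x / 2) ^+ 2 <= (x / 2) ^+ 2.
  by rewrite -real_normK ?num_real// -[leRHS]real_normK ?num_real// lerXn2r ?nnegrE// norm_sin_le.
move: h; rewrite expr_div_n; lra.
Qed.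

End trigonometric_bounds.

(** * Cosine means and convergence in probability *)

Section convergence_in_probability.
Context d (Omega : measurableType d) (R : realType) (P : probability Omega R).

Let m_ge (X Y : Omega -> R) e : measurable_fun setT X -> measurable_fun setT Y ->
  measurable [set w | e <= `|X w - Y w|].
Proof.
move=> mX mY.
have m : measurable_fun setT (fun w => `|X w - Y w|).
  by apply: measurableT_comp => //; exact: measurable_funB.
rewrite (_ : [set w | _] = (fun w => `|X w - Y w|) @^-1` `[e, +oo[).
  by rewrite -[X in measurable X]setTI; apply: m => //; exact: measurable_itv.
by apply/seteqP; split => w /=; rewrite in_itv/= andbT.
Qed.

Lemma cvg_in_probabilityB (X_ Y_ : nat -> Omega -> R) (X Y : Omega -> R) :
  (forall n, measurable_fun setT (X_ n)) -> (forall n, measurable_fun setT (Y_ n)) ->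
  measurable_fun setT X -> measurable_fun setT Y ->
  cvg_in_probability P X_ X -> cvg_in_probability P Y_ Y ->
  cvg_in_probability P (fun n w => X_ n w - Y_ n w) (fun w => X w - Y w).
Proof.
move=> mX_ mY_ mX mY cX cY e e0.
have e20 : 0 < e / 2 by rewrite divr_gt0.
have d00 : ((0 : \bar R) +? 0)%E by [].
have h : (P [set w | (e / 2 <= `|X_ n w - X w|)%R] +
      P [set w | (e / 2 <= `|Y_ n w - Y w|)%R])%E
    @[n --> \oo] --> (0 + 0)%E by apply: (cvgeD d00); [exact: cX|exact: cY].
rewrite adde0 in h; apply: (squeeze_cvge _ (cvg_cst 0%E) h); apply: nearW => n.
rewrite measure_ge0/=.
have mAB : measurable ([set w | e / 2 <= `|X_ n w - X w|] `|` [set w | e / 2 <= `|Y_ n w - Y w|]).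
  by apply: measurableU; exact: m_ge.
apply: (@le_trans _ _ (P ([set w | e / 2 <= `|X_ n w - X w|] `|` [set w | e / 2 <= `|Y_ n w - Y w|]))).
  apply: le_measure; rewrite ?inE//.
    by apply: m_ge; exact: measurable_funB.
  move=> w /= ew; have [h1|h1] := leP (e / 2) `|X_ n w - X w|; first by left.
  right; rewrite leNgt; apply/negP => h2; move: ew; rewrite leNgt => /negP; apply.
  rewrite [X in `|X|](_ : _ = (X_ n w - X w) - (Y_ n w - Y w)); last by ring.
  by apply: le_lt_trans (ler_normB _ _) _; rewrite [e]splitr ltrD.
by apply: measureU2; exact: m_ge.
Qed.

Lemma cvg_in_probability_cos (X_ : nat -> Omega -> R) (X : Omega -> R) (m : R) :
  (forall n, measurable_fun setT (X_ n)) -> measurable_fun setT X ->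
  cvg_in_probability P X_ X ->
  \int[P]_w cos (m * X_ n w) @[n --> \oo] --> \int[P]_w cos (m * X w).
Proof.
move=> mX_ mX cX; apply/cvgrPdist_le => e e0.
(* Where the variables are [dl]-close the cosines differ by at most [e / 2]. The exceptional set has
   probability at most [e / 4], and there they differ by at most 2. *)
pose dl := e / 2 / (`|m| + 1).
have m1 : 0 < `|m| + 1 by rewrite ltr_wpDl.
have dl0 : 0 < dl by rewrite !divr_gt0.
have /fine_cvgP[_ /cvgrPdist_le/(_ (e / 4))] := cX _ dl0.
move=> /(_ ltac:(by rewrite divr_gt0)); apply: filterS => n /=.
set A := [set w | _]; rewrite sub0r normrN ger0_norm ?fine_ge0// => hA.
have mA : measurable A by exact: m_ge.
have mc Y : measurable_fun setT Y -> measurable_fun setT (fun w : Omega => cos (m * Y w)).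
  by move=> mY; apply: measurableT_comp; [exact: continuous_measurable_fun (@continuous_cos R)|exact: measurable_funM].
have ic Y : measurable_fun setT Y -> P.-integrable setT (EFin \o (fun w : Omega => cos (m * Y w))).
  move=> mY; apply: (bounded_integrable (M := 1)) => //; [exact: Pfin|exact: mc|].
  by move=> w _; exact: cos_max.
have idx : P.-integrable setT (EFin \o (fun w : Omega => e / 2 + 2 * \1_A w)).
  apply: (bounded_integrable (M := e / 2 + 2)) => //; first exact: Pfin.
    by apply: measurable_funD => //; apply: measurable_funM => //; exact: measurable_indic.
  move=> w _; have e2 : 0 <= e / 2 by rewrite divr_ge0// ltW.
  rewrite indicE; case: (_ \in _); rewrite ?mulr1 ?mulr0 ?addr0 ger0_norm ?addr_ge0//.
  by rewrite lerDl.
rewrite -RintegralB//; [|exact: ic|exact: ic].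
apply: le_trans (le_normr_Rintegral _ _) _ => //.
  by rewrite (_ : EFin \o _ = (EFin \o (fun w => cos (m * X w))) \- (EFin \o (fun w => cos (m * X_ n w))))%E//; apply: integrableB => //; exact: ic.
apply: (@le_trans _ _ (\int[P]_w (e / 2 + 2 * \1_A w))).
  apply: le_Rintegral => //.
    apply: integrable_norm.
    by rewrite (_ : EFin \o _ = (EFin \o (fun w => cos (m * X w))) \- (EFin \o (fun w => cos (m * X_ n w))))%E//; apply: integrableB => //; exact: ic.
  move=> w _; rewrite indicE; have [wA|wA] := boolP (w \in A).
    rewrite mulr1; apply: (@le_trans _ _ (1 + 1)).
      by apply: le_trans (ler_normB _ _) _; rewrite lerD// cos_max.
    by rewrite -[leLHS]add0r lerD// divr_ge0// ltW.
  rewrite mulr0 addr0; apply: le_trans (norm_cosB_le _ _) _.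
  have /negP hw : ~ A w by move: wA; rewrite notin_setE.
  rewrite -mulrBr normrM distrC.
  move: hw; rewrite /A/= -ltNge => hw.
  apply: (@le_trans _ _ (`|m| * dl)); first by rewrite ler_wpM2l// ltW.
  rewrite /dl mulrA ler_pdivrMr// mulrC ler_wpM2l ?divr_ge0 ?(ltW e0)//.
  by rewrite lerDl.
rewrite RintegralD//; first last.
- apply: (bounded_integrable (M := 2)) => //; first exact: Pfin.
    by apply: measurable_funM => //; exact: measurable_indic.
  by move=> w _; rewrite indicE; case: (_ \in _); rewrite ?mulr1 ?mulr0 ger0_norm.
- by apply: (bounded_integrable (M := `|e / 2|)) => //; exact: Pfin.
rewrite Rintegral_cstP RintegralZl//; last first.
  apply: (bounded_integrable (M := 1)) => //; first exact: Pfin.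
  by move=> w _; rewrite indicE; case: (_ \in _); rewrite ger0_norm.
rewrite [X in 2 * X]/Rintegral integral_indic// setIT.
apply: (@le_trans _ _ (e / 2 + 2 * (e / 4))); last by lra.
by apply: lerD => //; rewrite ler_wpM2l.
Qed.

(** cos (m x) is at least 1 minus the smaller of 2 and (m x)^2 / 2. The truncation at 2 allows
    bounded convergence as [m] tends to 0 without any moment of [X]. *)
Lemma cos_mean_pos (X : {RV P >-> R}) : exists2 m0, 0 < m0 &
  forall m, 0 <= m <= m0 -> 0 < \int[P]_w cos (m * X w).
Proof.
pose q (n : nat) w := Num.min 2 ((n.+1%:R^-1 * X w) ^+ 2 / 2).
have mq n : measurable_fun setT (q n).
  apply: measurable_minr => //; apply: measurable_funM => //.
  by apply: measurable_funX; exact: measurable_funM.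
have q0 n w : 0 <= q n w <= 2.
  rewrite /q ge_min lexx andbT le_min; apply/andP; split => //.
  by rewrite divr_ge0 ?sqr_ge0.
have cq : \int[P]_w q n w @[n --> \oo] --> \int[P]_w (cst 0 w : R).
  apply: (@bounded_cvg_Rintegral _ _ _ _ _ _ _ 2) => //.
  - exact: Pfin.
  - apply: aeW => w _; apply: (squeeze_cvgr (f := cst 0) (h := fun n => (n.+1%:R^-1 * X w) ^+ 2 / 2)).
    + by apply: nearW => n; have /andP[-> _] := q0 n w; rewrite /q ge_min lexx orbT.
    + exact: cvg_cst.
    + rewrite -(mul0r 2^-1); apply: cvgM; last exact: cvg_cst.
      rewrite -[X in _ --> X](expr0n _ 2); apply: cvg_exprn.
      rewrite -(mul0r (X w)); apply: cvgM; last exact: cvg_cst.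
      exact: cvg_harmonic.
  - by move=> n w _; have /andP[? ?] := q0 n w; rewrite ger0_norm.
rewrite /Rintegral integral0/= in cq.
have h01 : 0 < 1 :> R by [].
have /cvgrPdist_lt/(_ _ h01)[N _ /(_ N (leqnn N))/=] := cq.
rewrite sub0r normrN => hN.
exists N.+1%:R^-1 => // m /andP[m0 mN].
have {}hN : \int[P]_w q N w < 1 by apply: le_lt_trans (ler_norm _) hN.
have iq : P.-integrable setT (EFin \o q N).
  apply: (bounded_integrable (M := 2)) => //; first exact: Pfin.
  by move=> w _; have /andP[? ?] := q0 N w; rewrite ger0_norm.
have i1 : P.-integrable setT (EFin \o (fun w : Omega => 1 : R)).
  by apply: (bounded_integrable (M := `|1|)) => //; exact: Pfin.
apply: (@lt_le_trans _ _ (\int[P]_w (1 - q N w))).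
  by rewrite RintegralB// Rintegral_cstP subr_gt0.
apply: le_Rintegral => //.
- apply: (bounded_integrable (M := 1)) => //; [exact: Pfin|exact: measurable_funB|].
  by move=> w _; have := q0 N w; rewrite ler_norml; lra.
- exact: integrable_cosM.
- move=> w _; rewrite lerBlDr -lerBlDl /q le_min; apply/andP; split.
    by have := cos_geN1 (m * X w); lra.
  have := cos_ge_quadratic (m * X w).
  have : (m * X w) ^+ 2 <= (N.+1%:R^-1 * X w) ^+ 2.
    by rewrite !exprMn ler_wpM2r ?sqr_ge0// lerXn2r ?nnegrE.
  move: (cos _) (_ ^+ 2) (_ ^+ 2) => x y z; lra.
Qed.

End convergence_in_probability.

Section cosine_mean_limit.
Context d (Omega : measurableType d) (R : realType) (P : probability Omega R).
Local Notation lam := (@lebesgue_measure R).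
Variables (B : set (measurableTypeR R)) (psi : R -> R) (c : R).
Variables (h_ : nat -> measurableTypeR R -> R) (h : measurableTypeR R -> R).
Variables (I : nat -> set R -> Omega -> R) (X : Omega -> R) (m : R).
Hypothesis mB : measurable B.
Hypothesis fB : (lam B < +oo)%E.
Hypothesis cpsi : continuous psi.
Hypothesis psi0 : forall x, 0 <= psi x.
Hypothesis c0 : 0 <= c.
Hypothesis psi2 : forall x, psi x <= c * x ^+ 2.
Hypothesis mh_ : forall n, measurable_fun setT (h_ n).
Hypothesis bh_ : forall n, exists M, forall x, `|h_ n x| <= M.
Hypothesis mh : measurable_fun B h.
Hypothesis ch : {ae lam, forall u, B u -> h_ n u @[n --> \oo] --> h u}.
Hypothesis ih : lam.-integrable B (fun u => (h u ^+ 2)%:E).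
Hypothesis mI : forall n A, measurable_fun setT (I n A).
Hypothesis hI : forall n (A : set R) m, measurable A -> A `<=` B ->
  \int[P]_w cos (m * I n A w) = expR (- \int[lam]_(u in A) psi (m * h_ n u)).
Hypothesis cI : forall A : set R, measurable A -> A `<=` B ->
  exists XA : {RV P >-> R}, cvg_in_probability P (fun n => I n A) XA.
Hypothesis mX : measurable_fun setT X.
Hypothesis cX : cvg_in_probability P (fun n => I n B) X.
Hypothesis hm : 0 < \int[P]_w cos (m * X w).

Let mpsi : measurable_fun setT psi.
Proof. exact: continuous_measurable_fun. Qed.

Lemma cos_mean_limit : \int[P]_w cos (m * X w) = expR (- \int[lam]_(u in B) psi (m * h u)).
Proof.
have mphi n : measurable_fun B (fun u => psi (m * h_ n u)).
  apply: (measurableT_comp mpsi); apply: measurable_funM => //.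
  exact: measurable_funTS.
have mphi0 : measurable_fun B (fun u => psi (m * h u)).
  by apply: (measurableT_comp mpsi); exact: measurable_funM.
have bphi n : exists M, forall u, B u -> psi (m * h_ n u) <= M.
  have [M hM] := bh_ n; exists (c * (`|m| * M) ^+ 2) => u _.
  apply: le_trans (psi2 _) _; rewrite ler_wpM2l// -real_normK ?num_real// normrM.
  by rewrite lerXn2r ?nnegrE ?mulr_ge0// ?ler_wpM2l// (le_trans _ (hM u)).
have iphi n A : measurable A -> A `<=` B ->
    lam.-integrable A (EFin \o (fun u => psi (m * h_ n u))).
  move=> mA AB; have [M hM] := bphi n.
  apply: (integrableS mB mA AB); apply: (bounded_integrable (M := M)) => // u Bu.
  by rewrite ger0_norm// hM.
have iphi0 : lam.-integrable B (EFin \o (fun u => psi (m * h u))).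
  apply: (@le_integrable _ _ _ _ _ mB _ (fun u => (c * m ^+ 2)%:E * (h u ^+ 2)%:E)%E).
  - exact/measurable_EFinP.
  - move=> u _; rewrite -EFinM !abse_EFin lee_fin (ger0_norm (psi0 _)).
    by apply: le_trans (psi2 _) _; rewrite exprMn mulrA ler_norm.
  - exact: integrableZl.
have cphi : {ae lam, forall u, B u -> psi (m * h_ n u) @[n --> \oo] --> psi (m * h u)}.
  apply: filterS ch => u hu Bu.
  apply: (@continuous_cvg _ _ _ _ _ _ psi); first exact: cpsi.
  by apply: cvgM; [exact: cvg_cst|exact: hu].
have cosB := cvg_in_probability_cos (m := m) (fun n => mI n B) mX cX.
have cA (A : set R) : measurable A -> A `<=` B ->
    cvg (\int[lam]_(u in A) psi (m * h_ n u) @[n --> \oo]).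
  move=> mA AB; have [XA cXA] := cI mA AB.
  have cosA := cvg_in_probability_cos (m := m) (fun n => mI n A) (@measurable_funPT _ _ _ _ XA) cXA.
  (* As [psi] is nonnegative, integrating over the smaller set [A] gives the larger cosine mean. So
     its limit is positive along with that for [B], and the logarithm is continuous there. *)
  have pos : 0 < \int[P]_w cos (m * XA w).
    apply: lt_le_trans hm _; apply: ler_cvg_to cosB cosA _; apply: nearW => n.
    rewrite hI// hI// ler_expR lerN2.
    rewrite (@Rintegral_subset _ (measurableTypeR R) R lam A B _ AB); apply: le_Rintegral => //.
    + have [M hM] := bphi n; apply: (bounded_integrable (M := M)) => //.
        by apply: measurable_funM => //; exact: measurable_indic.
      move=> u Bu; rewrite ger0_norm ?mulr_ge0 ?indicE//.
      by apply: le_trans (hM u Bu); rewrite ler_piMr//; case: (_ \in _).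
    + exact: iphi.
    + by move=> u _; rewrite indicE ler_piMr//; case: (_ \in _).
  apply/cvg_ex; exists (- ln (\int[P]_w cos (m * XA w))).
  have -> : (fun n => \int[lam]_(u in A) psi (m * h_ n u)) =
      (fun n => - ln (\int[P]_w cos (m * I n A w))).
    by apply/funext => n; rewrite hI// expRK opprK.
  apply: cvgN; apply: (@continuous_cvg _ _ _ _ _ _ (@ln R)) => //.
  exact: continuous_ln.
have lim := @cvg_Rintegral_setwise _ _ _ lam B _ _ mB fB mphi (fun n u => psi0 _)
  bphi iphi0 cphi cA.
have lim2 : \int[P]_w cos (m * I n B w) @[n --> \oo] -->
    expR (- \int[lam]_(u in B) psi (m * h u)).
  under eq_fun do rewrite hI//.
  apply: (@continuous_cvg _ _ _ _ _ _ (@expR R)); first exact: continuous_expR.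
  exact: cvgN.
exact: (cvg_unique (@Rhausdorff R) cosB lim2).
Qed.

End cosine_mean_limit.

(** * Moments from cosine means near 0 *)

Section moment_bounds.
Context d (Omega : measurableType d) (R : realType) (P : probability Omega R).

(** By the mean value theorem sin t - t = (cos xi - cos 0) t, and cosine is 1-Lipschitz. The
    quadratic rate is enough for [cvg_sin_quotient]. *)
Lemma norm_sinB_le (t : R) : `|sin t - t| <= t ^+ 2.
Proof.
wlog t0 : t / 0 < t.
  move=> h; have [t0|t0|->] := ltgtP t 0; last by rewrite sin0 subrr normr0 sqr_ge0.
    have := h (- t); rewrite oppr_gt0 => /(_ t0).
    by rewrite sinN -opprD normrN sqrrN.
  exact: h.
have cs : {within `[0, t], continuous (@sin R)}.
  by apply: continuous_subspaceT => u; exact: continuous_sin.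
have [xi] := MVT t0 (fun z _ => is_derive_sin z) cs.
rewrite in_itv/= => /andP[xi0 xit]; rewrite sin0 !subr0 => ->.
have -> : cos xi * t - t = (cos xi - cos 0) * t by rewrite cos0; ring.
rewrite normrM expr2 (ger0_norm (ltW t0)); apply: ler_wpM2r; first exact: ltW.
by apply: le_trans (norm_cosB_le _ _) _; rewrite subr0 ger0_norm ltW.
Qed.

Lemma cvg_sin_quotient (u : R^nat) (x : R) : (forall n, 0 < u n) ->
  u n @[n --> \oo] --> 0 -> 2 * sin (u n * x / 2) / u n @[n --> \oo] --> x.
Proof.
move=> u0 cu.
have lim : u n * x ^+ 2 @[n --> \oo] --> (0 : R).
  by rewrite -(mul0r (x ^+ 2)); apply: cvgM => //; exact: cvg_cst.
apply/cvgrPdist_le => e e0; have /cvgrPdist_le/(_ _ e0) := lim.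
apply: filterS => n; have un := u0 n.
have q0 : 0 <= u n * x ^+ 2 by apply: mulr_ge0; [exact: ltW|exact: sqr_ge0].
rewrite sub0r normrN (ger0_norm q0).
apply: le_trans; rewrite distrC.
have -> : 2 * sin (u n * x / 2) / u n - x = 2 / u n * (sin (u n * x / 2) - u n * x / 2).
  by field; rewrite gt_eqF.
rewrite normrM ger0_norm ?divr_ge0 ?(ltW un)//.
apply: le_trans (ler_wpM2l _ (norm_sinB_le _)) _; first by rewrite divr_ge0 ?(ltW un).
have -> : 2 / u n * (u n * x / 2) ^+ 2 = u n * x ^+ 2 / 2.
  by field; rewrite gt_eqF.
by rewrite ler_pdivrMr// ler_peMr// ler1n.
Qed.

(** A bounded substitute for [x]: it is at most |x| in absolute value, tends to [x] with [u], and
    its even powers are trigonometric polynomials. *)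
Let sinq (u : R) (x : R) := 2 * sin (u * x / 2) / u.

Let m_sinq u (X : Omega -> R) k : measurable_fun setT X ->
  measurable_fun setT (fun w => sinq u (X w) ^+ k).
Proof.
move=> mX; apply: measurable_funX; do 2 apply: measurable_funM => //.
apply: (measurableT_comp (f := @sin R)).
  by apply: continuous_measurable_fun; exact: continuous_sin.
by do 2 apply: measurable_funM => //.
Qed.

Let sinq2 (u x : R) : u != 0 -> sinq u x ^+ 2 = (2 - 2 * cos (u * x)) / u ^+ 2.
Proof. by move=> u0; rewrite /sinq two_sub_cos expr_div_n. Qed.

Let fatou_sinq (X : Omega -> R) (u : R^nat) k (K : \bar R) : measurable_fun setT X ->
  (forall n, 0 < u n) -> u n @[n --> \oo] --> 0 ->
  (forall n, \int[P]_w (sinq (u n) (X w) ^+ k.*2)%:E <= K)%E ->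
  (\int[P]_w (X w ^+ k.*2)%:E <= K)%E.
Proof.
move=> mX u0 cu hK.
apply: (fatou_le (f_ := fun n w => sinq (u n) (X w) ^+ k.*2) (u := fun _ => K)) => //.
- by move=> n; exact: m_sinq.
- exact: measurable_funX.
- by move=> n w _; rewrite -mul2n exprM exprn_ge0// sqr_ge0.
- by apply: aeW => w _; apply: cvg_exprn; exact: cvg_sin_quotient.
- exact: cvg_cst.
Qed.

Lemma second_moment_le (X : Omega -> R) (m0 K : R) : measurable_fun setT X -> 0 < m0 ->
  (forall m, 0 < m <= m0 -> 1 - K * m ^+ 2 <= \int[P]_w cos (m * X w)) ->
  (\int[P]_w (X w ^+ 2)%:E <= (2 * K)%:E)%E.
Proof.
move=> mX m00 hK; pose u n := m0 * n.+1%:R^-1.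
have u0 n : 0 < u n by rewrite mulr_gt0.
apply: (@fatou_sinq X u 1%N) => //.
  rewrite -(mulr0 m0); apply: cvgM; [exact: cvg_cst|exact: cvg_harmonic].
move=> n; have un := u0 n.
have iw : P.-integrable setT (EFin \o (fun w => sinq (u n) (X w) ^+ 2)).
  apply: (bounded_integrable (M := 4 / u n ^+ 2)) => //; [exact: Pfin|exact: m_sinq|].
  move=> w _; rewrite sinq2 ?gt_eqF// normrM (@ger0_norm _ (_^-1)) ?invr_ge0 ?sqr_ge0//.
  rewrite ler_wpM2r ?invr_ge0 ?sqr_ge0//.
  have := norm_cos_le1 (u n * X w); rewrite !ler_norml; lra.
rewrite -(fineK (integrable_fin_num measurableT iw)) lee_fin.
rewrite -[leLHS]/(\int[P]_w (sinq (u n) (X w) ^+ 2)).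
under eq_Rintegral do rewrite sinq2 ?gt_eqF// mulrC mulrBr.
have i1 : P.-integrable setT (EFin \o (fun w : Omega => (u n ^+ 2)^-1 * 2)).
  by apply: (bounded_integrable (M := `|(u n ^+ 2)^-1 * 2|)) => //; exact: Pfin.
under eq_Rintegral do rewrite (mulrA _ 2).
have ic := integrable_cosM P (u n) mX.
rewrite RintegralB//; last first.
  exact: (integrableZl measurableT ((u n ^+ 2)^-1 * 2) ic).
rewrite Rintegral_cstP RintegralZl//.
have := hK (u n); rewrite un/= => /(_ _).
have -> : u n <= m0.
  by rewrite /u ger_pMr// invf_le1// ler1n.
move=> /(_ isT) h; set v := (u n ^+ 2)^-1 * 2.
have v0 : 0 < v by rewrite mulr_gt0// invr_gt0 exprn_gt0.
apply: (@le_trans _ _ (v * (K * u n ^+ 2))).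
  change (v - v * \int[P]_w cos (u n * X w) <= v * (K * u n ^+ 2)).
  by have := ler_wpM2l (ltW v0) h; rewrite mulrBr mulr1; lra.
by rewrite /v le_eqVlt; apply/orP; left; apply/eqP; field; rewrite gt_eqF.
Qed.

(* [(2 - 2 cos (u x)) ^ k] is a trigonometric polynomial, so its mean is
   determined by the means of the cosines of frequencies at most [k u]. *)
Let trig_mean (X Y : Omega -> R) (m0 u : R) : measurable_fun setT X ->
  measurable_fun setT Y -> 0 <= u ->
  (forall m, 0 <= m <= m0 -> \int[P]_w cos (m * X w) = \int[P]_w cos (m * Y w)) ->
  forall k a, `|a| + k%:R * u <= m0 ->
  \int[P]_w ((2 - 2 * cos (u * X w)) ^+ k * cos (a * X w)) =
  \int[P]_w ((2 - 2 * cos (u * Y w)) ^+ k * cos (a * Y w)).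
Proof.
move=> mX mY u0 hXY; elim=> [|k ih] a ha.
  under eq_Rintegral do rewrite expr0 mul1r.
  under [RHS]eq_Rintegral do rewrite expr0 mul1r.
  rewrite mul0r addr0 in ha.
  have [a0|a0] := leP 0 a; first by apply: hXY; rewrite a0 (le_trans (ler_norm _)).
  have e (V : Omega -> R) : \int[P]_w cos (a * V w) = \int[P]_w cos (- a * V w).
    by apply: eq_Rintegral => w _; rewrite mulNr cosN.
  rewrite (e X) (e Y); apply: hXY; rewrite oppr_ge0 ltW//=.
  by rewrite (le_trans _ ha)// -normrN ler_norm.
pose F (V : Omega -> R) b w := (2 - 2 * cos (u * V w)) ^+ k * cos (b * V w).
have iF V b : measurable_fun setT V -> P.-integrable setT (EFin \o F V b).
  move=> mV; apply: (bounded_integrable (M := 4 ^+ k)) => //; first exact: Pfin.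
    apply: measurable_funM; last exact: measurable_cosM.
    apply: measurable_funX; apply: measurable_funB => //; apply: measurable_funM => //.
    exact: measurable_cosM.
  move=> w _; rewrite /F normrM -[leRHS]mulr1; apply: ler_pM => //; last exact: norm_cos_le1.
  rewrite normrX lerXn2r ?nnegrE//.
  by have := norm_cos_le1 (u * V w); rewrite !ler_norml; lra.
(* Product-to-sum: 2 cos (u x) cos (a x) = cos ((a + u) x) + cos ((a - u) x). Each factor shifts the
   frequency by at most [u], hence the budget |a| + k u <= m0. *)
have e V : measurable_fun setT V ->
    \int[P]_w ((2 - 2 * cos (u * V w)) ^+ k.+1 * cos (a * V w)) =
    2 * \int[P]_w F V a w - (\int[P]_w F V (a + u) w + \int[P]_w F V (a - u) w).
  move=> mV; rewrite -RintegralD//; [|exact: iF|exact: iF].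
  rewrite -RintegralZl//; last exact: iF.
  rewrite -RintegralB//; first last.
  - by apply: (integrableD measurableT (iF V (a + u) mV) (iF V (a - u) mV)).
  - exact: (integrableZl measurableT 2 (iF V a mV)).
  apply: eq_Rintegral => w _; rewrite /F (mulrDl a) (mulrBl _ a) cosD cosB exprS; ring.
have u1 : `|a + u| + k%:R * u <= m0.
  by have := ler_normD a u; move: ha; rewrite (ger0_norm u0) -natr1 mulrDl mul1r; lra.
have u2 : `|a - u| + k%:R * u <= m0.
  by have := ler_normB a u; move: ha; rewrite (ger0_norm u0) -natr1 mulrDl mul1r; lra.
have u3 : `|a| + k%:R * u <= m0.
  by apply: le_trans ha; rewrite lerD2l ler_wpM2r// ler_nat.
by rewrite (e X mX) (e Y mY) /F (ih _ u1) (ih _ u2) (ih _ u3).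
Qed.

(** The truncated moments built from [sinq] coincide for [X] and [Y]; those of [Y] are below its
    true moment, and Fatou's lemma removes the truncation for [X]. *)
Lemma even_moment_le (X Y : Omega -> R) (m0 : R) (k : nat) : measurable_fun setT X ->
  measurable_fun setT Y -> 0 < m0 ->
  (forall m, 0 <= m <= m0 -> \int[P]_w cos (m * X w) = \int[P]_w cos (m * Y w)) ->
  (\int[P]_w (X w ^+ k.*2)%:E <= \int[P]_w (Y w ^+ k.*2)%:E)%E.
Proof.
move=> mX mY m00 hXY; pose u n := m0 / k.+1%:R * n.+1%:R^-1.
have u0 n : 0 < u n by rewrite mulr_gt0// divr_gt0.
apply: (@fatou_sinq X u k) => //.
  rewrite -(mulr0 (m0 / k.+1%:R)); apply: cvgM; [exact: cvg_cst|exact: cvg_harmonic].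
move=> n; have un := u0 n.
have ku : `|0 : R| + k%:R * u n <= m0.
  rewrite normr0 add0r /u; apply: (@le_trans _ _ (k%:R * (m0 / k.+1%:R))).
    by rewrite ler_wpM2l// ler_piMr ?divr_ge0 ?(ltW m00)// invf_le1// ler1n.
  by rewrite mulrA ler_pdivrMr// mulrC ler_wpM2l ?(ltW m00)// ler_nat.
have bq x : `|sinq (u n) x ^+ k.*2| <= (4 / u n ^+ 2) ^+ k.
  rewrite -mul2n exprM normrX lerXn2r ?nnegrE ?divr_ge0 ?sqr_ge0//.
  rewrite sinq2 ?gt_eqF// normrM (@ger0_norm _ (_^-1)) ?invr_ge0 ?sqr_ge0//.
  rewrite ler_wpM2r ?invr_ge0 ?sqr_ge0//.
  have := norm_cos_le1 (u n * x); rewrite !ler_norml; lra.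
have iq V : measurable_fun setT V -> P.-integrable setT (EFin \o (fun w => sinq (u n) (V w) ^+ k.*2)).
  move=> mV; apply: (bounded_integrable (M := (4 / u n ^+ 2) ^+ k)) => //; first exact: Pfin.
  exact: m_sinq.
have e V : \int[P]_w (sinq (u n) (V w) ^+ k.*2) =
    \int[P]_w ((u n ^+ 2) ^- k * ((2 - 2 * cos (u n * V w)) ^+ k * cos (0 * V w))).
  apply: eq_Rintegral => w _; rewrite mul0r cos0 mulr1 -mul2n exprM sinq2 ?gt_eqF//.
  by rewrite expr_div_n mulrC.
have iT V : measurable_fun setT V -> P.-integrable setT
    (EFin \o (fun w => (2 - 2 * cos (u n * V w)) ^+ k * cos (0 * V w))).
  move=> mV; apply: (bounded_integrable (M := 4 ^+ k)) => //; first exact: Pfin.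
    apply: measurable_funM; last exact: measurable_cosM.
    apply: measurable_funX; apply: measurable_funB => //; apply: measurable_funM => //.
    exact: measurable_cosM.
  move=> w _; rewrite mul0r cos0 mulr1.
  rewrite normrX lerXn2r ?nnegrE//.
  by have := norm_cos_le1 (u n * V w); rewrite !ler_norml; lra.
rewrite -(fineK (integrable_fin_num measurableT (iq X mX))).
rewrite [X in (X%:E <= _)%E](_ : _ = \int[P]_w (sinq (u n) (Y w) ^+ k.*2)); last first.
  rewrite -[LHS]/(\int[P]_w (sinq (u n) (X w) ^+ k.*2)) !e RintegralZl//; last exact: iT.
  rewrite RintegralZl//; last exact: iT.
  by congr (_ * _); exact: (trig_mean mX mY (ltW un) hXY ku).
rewrite /Rintegral fineK; last exact: (integrable_fin_num measurableT (iq Y mY)).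
apply: ge0_le_integral => //.
- by move=> w _; rewrite lee_fin -mul2n exprM exprn_ge0// sqr_ge0.
- by apply/measurable_EFinP; exact: m_sinq.
- by apply/measurable_EFinP; exact: measurable_funX.
- move=> w _; rewrite lee_fin -mul2n !exprM lerXn2r ?nnegrE ?sqr_ge0//.
  rewrite -real_normK ?num_real// -[leRHS]real_normK ?num_real// lerXn2r ?nnegrE//.
  rewrite /sinq normrM normrM (@ger0_norm _ 2)// (@ger0_norm _ (_^-1)) ?invr_ge0 ?(ltW un)//.
  rewrite ler_pdivrMr//.
  apply: le_trans (ler_wpM2l _ (norm_sin_le _)) _ => //.
  rewrite normrM normrM (ger0_norm (ltW un)) (@ger0_norm _ 2^-1) ?invr_ge0//.
  by rewrite le_eqVlt; apply/orP; left; apply/eqP; field.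
Qed.

End moment_bounds.

(** * The characteristic exponent *)

Section normal_law.
Variable R : realType.
Local Notation mu := (@lebesgue_measure R).

Lemma integral_normal_prob (s M : R) (f : measurableTypeR R -> R) :
  measurable_fun setT f -> (forall x, 0 <= f x <= M) ->
  (\int[normal_prob 0 s]_x (f x)%:E = \int[mu]_x (f x * normal_pdf 0 s x)%:E)%E.
Proof.
move=> mf f0M; have dom := @normal_prob_dominates R 0 s.
have fi : (normal_prob 0 s).-integrable setT (EFin \o f).
  apply: (bounded_integrable (M := M)) => //; first exact: Pfin.
  by move=> x _; have /andP[? ?] := f0M x; rewrite ger0_norm.
rewrite -(Radon_Nikodym_change_of_variables dom)//=.
under [RHS]eq_integral do rewrite EFinM.
have mpdf := @measurable_normal_pdf R 0 s.
apply: ae_eq_integral => //.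
- apply: emeasurable_funM; first exact/measurable_EFinP.
  by apply: (measurable_int mu); apply: Radon_Nikodym_integrable; exact: dom.
- by apply: emeasurable_funM; exact/measurable_EFinP.
- apply: ae_eqe_mul2l => /=.
  rewrite Radon_NikodymE//=.
  case: cid => /= h [_ h2 h3].
  apply: integral_ae_eq => //=; first exact/measurable_EFinP.
  by move=> E _ mE; rewrite -h3.
Qed.

(** The substitution x = s y. This scaling is the property of the normal law from which
    [Brownian_exponent] derives a quadratic exponent. *)
Lemma Rintegral_normal_cos (s m : R) : 0 < s ->
  \int[normal_prob 0 s]_x cos (m * x) = \int[normal_prob 0 1]_x cos (m * s * x).
Proof.
move=> s0.
(* Substitution is applied to nonnegative integrands, so 1 is added to the cosine and cancelled
   afterwards. *)
have e (t r : R) : \int[normal_prob 0 t]_x (1 + cos (r * x)) = 1 + \int[normal_prob 0 t]_x cos (r * x).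
  rewrite RintegralD//.
  - by rewrite Rintegral_cstP.
  - by apply: (bounded_integrable (M := `|1|)) => //; exact: Pfin.
  - exact: (integrable_cosM (normal_prob 0 t) r (@measurable_id _ _ setT)).
suff : \int[normal_prob 0 s]_x (1 + cos (m * x)) =
    \int[normal_prob 0 1]_x (1 + cos (m * s * x)) by rewrite !e => /addrI.
suff E : (\int[normal_prob 0 s]_x (1 + cos (m * x))%:E =
    \int[normal_prob 0 1]_x (1 + cos (m * s * x))%:E)%E by exact: (congr1 fine E).
have c02 (x : R) : 0 <= 1 + cos x <= 2.
  by have := cos_geN1 x; have := cos_le1 x; lra.
have mc r : measurable_fun setT (fun x : measurableTypeR R => 1 + cos (r * x)).
  apply: measurable_funD => //.
  exact: (measurable_cosM r (@measurable_id _ _ setT)).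
rewrite [LHS](@integral_normal_prob s 2 _ (mc m) (fun x => c02 _)).
rewrite [RHS](@integral_normal_prob 1 2 _ (mc (m * s)) (fun x => c02 _)).
pose F : R -> R := fun y => s * y.
have F' : (F^`())%classic = cst s.
  by apply/funext => y; rewrite /F derive1E deriveM// derive_cst derive_id scaler0 addr0 scaler1.
rewrite (@increasing_ge0_integration_by_substitutionT _ F
  (fun x => (1 + cos (m * x)) * normal_pdf 0 s x)).
- apply: eq_integral => y _; congr EFin; rewrite F'.
  change ((1 + cos (m * (s * y))) * normal_pdf 0 s (s * y) * s =
    (1 + cos (m * s * y)) * normal_pdf 0 1 y).
  rewrite (mulrA m) -mulrA; congr (_ * _).
  rewrite !normal_pdfE ?oner_eq0 ?gt_eqF// /normal_peak /normal_fun.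
  have -> : - (s * y - 0) ^+ 2 / (s ^+ 2 *+ 2) = - (y - 0) ^+ 2 / (1 ^+ 2 *+ 2).
    by rewrite !subr0; field; rewrite gt_eqF.
  rewrite mulrAC; congr (_ * _).
  rewrite expr1n mul1r -mulr_natr -mulrA sqrtrM ?sqr_ge0// sqrtr_sqr (ger0_norm (ltW s0)).
  by rewrite mulr_natr invfM mulrAC mulVf ?mul1r// gt_eqF.
- by move=> x y xy; rewrite /F ltr_pM2l.
- by rewrite F' => x; exact: cvg_cst.
- by rewrite F'; exact: is_cvg_cst.
- by rewrite F'; exact: is_cvg_cst.
- by move=> x; apply: derivableM.
- by apply: gt0_cvgMrNy => //; exact: cvg_id.
- by apply: gt0_cvgMry => //; exact: cvg_id.
- move=> x; apply: cvgM; last by apply: continuous_normal_pdf; rewrite gt_eqF.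
  apply: cvgD; first exact: cvg_cst.
  apply: (@continuous_cvg _ _ _ _ _ _ (@cos R)); first exact: continuous_cos.
  by apply: cvgM; [exact: cvg_cst|exact: cvg_id].
- by move=> x; rewrite mulr_ge0 ?normal_pdf_ge0//; have /andP[] := c02 (m * x).
Qed.

Lemma expn_expRN_le (k : nat) (y : R) : 0 <= y -> y ^+ k * expR (- y) <= k`!%:R.
Proof.
move=> y0; rewrite expRN ler_pdivrMr ?expR_gt0// mulrC -ler_pdivrMr ?ltr0n ?fact_gt0//.
case: k => [|k]; first by rewrite expr0 fact0 divr1 -[leLHS]expR0 ler_expR.
by apply: le_trans (expR_ge1Dxn k y0); rewrite lerDr.
Qed.

(** Splitting x^2 / (2 s^2) as 3 x^2 / (8 s^2) + x^2 / (8 s^2) lets the first part absorb the power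
    of [x]; the second is the Gaussian with deviation [2 * s], whose density has integral 1. *)
Lemma normal_even_moment_fin (s : R) (k : nat) : 0 < s ->
  (\int[normal_prob 0 s]_x (x ^+ k.*2)%:E < +oo)%E.
Proof.
move=> s0; have s20 : 0 < 2 * s by rewrite mulr_gt0.
pose D := (8 * s ^+ 2 / 3) ^+ k * k`!%:R * (normal_peak s / normal_peak (2 * s)).
have pks : 0 < normal_peak s by apply: normal_peak_gt0; rewrite gt_eqF.
have pk2s : 0 < normal_peak (2 * s) by apply: normal_peak_gt0; rewrite gt_eqF.
have s2 : 0 <= 8 * s ^+ 2 / 3 by rewrite divr_ge0// pmulr_rge0// sqr_ge0.
have xge0 (x : R) : 0 <= x ^+ k.*2 by rewrite -mul2n exprM exprn_ge0// sqr_ge0.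
have bd (x : R) : x ^+ k.*2 * normal_pdf 0 s x <= D * normal_pdf 0 (2 * s) x.
  pose y := 3 * x ^+ 2 / (8 * s ^+ 2).
  have y0 : 0 <= y by rewrite /y divr_ge0// pmulr_rge0// ?sqr_ge0.
  have ex : x ^+ k.*2 = (8 * s ^+ 2 / 3) ^+ k * y ^+ k.
    rewrite -mul2n exprM -exprMn; congr (_ ^+ _); rewrite /y.
    by field; rewrite gt_eqF.
  rewrite !normal_pdfE ?gt_eqF// /D /normal_fun subr0.
  have -> : - x ^+ 2 / (s ^+ 2 *+ 2) = - y + (- x ^+ 2 / ((2 * s) ^+ 2 *+ 2)).
    by rewrite /y; field; rewrite gt_eqF.
  rewrite expRD ex.
  set E := expR (- x ^+ 2 / _); set A := (8 * s ^+ 2 / 3) ^+ k.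
  have -> : A * k`!%:R * (normal_peak s / normal_peak (2 * s)) * (normal_peak (2 * s) * E) =
      (A * normal_peak s * E) * k`!%:R by field; rewrite gt_eqF.
  have -> : A * y ^+ k * (normal_peak s * (expR (- y) * E)) =
      (A * normal_peak s * E) * (y ^+ k * expR (- y)) by ring.
  apply: ler_wpM2l; last exact: expn_expRN_le.
  by rewrite !mulr_ge0 ?expR_ge0 ?(ltW pks)// exprn_ge0.
have D0 : 0 <= D.
  by rewrite /D !mulr_ge0 ?invr_ge0 ?(ltW pks) ?(ltW pk2s)// exprn_ge0.
apply: (@le_lt_trans _ _ D%:E); last exact: ltry.
(* [integral_normal_prob] treats bounded functions, so the power is truncated at [n]. *)
pose q (n : nat) (x : measurableTypeR R) : R := Num.min (x ^+ k.*2) n%:R.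
have mq n : measurable_fun setT (q n).
  by apply: measurable_minr => //; exact: measurable_funX.
apply: (@fatou_le _ _ _ (normal_prob 0 s) setT q _ (fun _ => D%:E)) => //.
- by move=> n x _; rewrite /q le_min xge0/=.
- apply: aeW => x _; apply: cvg_near_cst.
  exists (Num.truncn (x ^+ k.*2)).+1 => // n /= hn; rewrite /q min_l//.
  by apply: (le_trans (ltW (truncnS_gt _))); rewrite ler_nat.
- move=> n; rewrite (@integral_normal_prob s n%:R) => [||x]; first last.
  + by rewrite /q le_min xge0/= ge_min lexx orbT ler0n.
  + exact: mq.
  apply: (@le_trans _ _ (\int[mu]_x (D * normal_pdf 0 (2 * s) x)%:E)%E).
    apply: ge0_le_integral => //.
    * by move=> x _; rewrite lee_fin mulr_ge0 ?normal_pdf_ge0// /q le_min xge0/= ler0n.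
    * apply/measurable_EFinP; apply: measurable_funM; first exact: mq.
      exact: measurable_normal_pdf.
    * by apply/measurable_EFinP; apply: measurable_funM => //; exact: measurable_normal_pdf.
    * move=> x _; rewrite lee_fin; apply: le_trans (bd x).
      by apply: ler_wpM2r; [exact: normal_pdf_ge0|rewrite /q ge_min lexx].
  under eq_integral do rewrite EFinM.
  rewrite ge0_integralZl//; first last.
  + by move=> x _; rewrite lee_fin normal_pdf_ge0.
  + by apply/measurable_EFinP; exact: measurable_normal_pdf.
  by rewrite integral_normal_pdf mule1.
- exact: cvg_cst.
Qed.

End normal_law.

Section symmetric_measures.
Variables (R : realType) (nu : {measure set R -> \bar R}).
Hypothesis hsym : symmetric_measure nu.

Let m_opp : measurable_fun setT (fun x : R => - x).
Proof. exact: oppr_measurable. Qed.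

Lemma ge0_integral_symmetric (f : R -> \bar R) : measurable_fun setT f ->
  (forall x, 0 <= f x)%E -> (\int[nu]_x f x = \int[nu]_x f (- x)%R)%E.
Proof.
move=> mf f0; have := @ge0_integral_pushforward _ _ _ _ R _ m_opp nu setT f measurableT mf
  (fun x _ => f0 x).
rewrite preimage_setT => <-; apply: eq_measure_integral => A mA _.
exact/esym/hsym.
Qed.

(** Reflection exchanges the positive and negative parts. If their common integral is infinite,
    [fine] sends [+oo - +oo] to 0, so the conclusion covers that case too. *)
Lemma Rintegral_odd (f : R -> R) : measurable_fun setT f ->
  (forall x, f (- x) = - f x) -> \int[nu]_x f x = 0.
Proof.
move=> mf fN; rewrite /Rintegral integralE.
have mE : measurable_fun setT (EFin \o f) by exact/measurable_EFinP.
rewrite (@ge0_integral_symmetric (funepos _))//; last exact: measurable_funepos.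
have -> : (\int[nu]_x (EFin \o f)^\+ (- x)%R = \int[nu]_x (EFin \o f)^\- x)%E.
  by apply: eq_integral => x _; rewrite !unlock /= fN.
set A := integral _ _ _.
have A0 : (0 <= A)%E by apply: integral_ge0.
case: A A0 => [r| |]//= _; by rewrite subrr.
Qed.

End symmetric_measures.

(** * The real exponent of a symmetric Levy process *)

Section Levy_law.
Context d (Omega : measurableType d) (R : realType) (P : probability Omega R).
Variables (a : R) (nu : {measure set R -> \bar R}) (Z : R -> {RV P >-> R}).
Hypothesis hsym : symmetric_measure nu.
Hypothesis hZchar : has_triplet Z a nu.

Definition real_exponent (m : R) := a * m ^+ 2 / 2 - \int[nu]_x (cos (m * x) - 1).
Local Notation psi := real_exponent.

Let measurable_levy_tau : measurable_fun setT (@levy_tau R).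
Proof.
have mn : measurable_fun setT (fun x : R => `|x|) by exact: measurableT_comp.
apply: measurable_fun_ifT => //; first exact: measurable_fun_ler.
apply: measurable_funM => //.
rewrite (_ : (fun x : R => _) = (fun x => `|x| `^ (-1))).
  exact: (measurableT_comp (measurable_powR (-1)) mn).
by apply/funext => x; rewrite powR_inv1.
Qed.

Let complex_simp := (mul0r, mulr0, mul1r, subrr, add0r, addr0, subr0, oppr0, expR0, mulr1).

(** The imaginary part of the integrand is sin (m x) - m tau(x), which is odd because [levy_tau]
    is. *)
Let exponentE m : levy_exponent a nu m = (- psi m)%:C%C.
Proof.
rewrite /levy_exponent /cintegral.
have -> : \int[nu]_x complex.Re (cexp ('i * (m * x)%:C)%C - 1 - ('i * (m * levy_tau x)%:C)%C)
   = \int[nu]_x (cos (m * x) - 1).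
  by apply: eq_Rintegral => x _; rewrite /cexp /= !complex_simp.
have -> : \int[nu]_x complex.Im (cexp ('i * (m * x)%:C)%C - 1 - ('i * (m * levy_tau x)%:C)%C)
   = 0.
  transitivity (\int[nu]_x (sin (m * x) - m * levy_tau x)).
    by apply: eq_Rintegral => x _; rewrite /cexp /= !complex_simp.
  apply: (Rintegral_odd hsym).
  - apply: measurable_funB; last exact: measurable_funM.
    exact: (measurable_sinM m (@measurable_id _ _ setT)).
  - move=> x; rewrite mulrN sinN /levy_tau normrN.
    by case: ifP => _; rewrite ?mulNr; ring.
by rewrite /real_exponent opprD opprK; apply/eqP; rewrite eq_complex /= !complex_simp !eqxx.
Qed.

Lemma triplet_cos_sin m t : 0 <= t ->
  \int[P]_w cos (m * Z t w) = expR (- (t * psi m)) /\ \int[P]_w sin (m * Z t w) = 0.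
Proof.
move=> t0; have := hZchar m t0; rewrite exponentE /char_fun /cintegral.
have -> : \int[P]_w complex.Re (cexp ('i * (m * Z t w)%:C)%C) = \int[P]_w cos (m * Z t w).
  by apply: eq_Rintegral => w _; rewrite /cexp /= !complex_simp.
have -> : \int[P]_w complex.Im (cexp ('i * (m * Z t w)%:C)%C) = \int[P]_w sin (m * Z t w).
  by apply: eq_Rintegral => w _; rewrite /cexp /= !complex_simp.
move/eqP; rewrite eq_complex /cexp /= !complex_simp cos0 sin0 !complex_simp.
by move=> /andP[/eqP -> /eqP ->]; rewrite mulrN.
Qed.

Let triplet_cos1 m : \int[P]_w cos (m * Z 1 w) = expR (- psi m).
Proof. by have [-> _] := triplet_cos_sin m ler01; rewrite mul1r. Qed.

Lemma real_exponent_ge0 m : 0 <= psi m.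
Proof.
have : \int[P]_w cos (m * Z 1 w) <= \int[P]_w (cst 1 w).
  apply: le_Rintegral => //; first exact: integrable_cosM.
    by apply: (bounded_integrable (M := `|1|)) => //; exact: Pfin.
  by move=> w _; exact: cos_le1.
by rewrite triplet_cos1 Rintegral_cstP -[leRHS]expR0 ler_expR oppr_le0.
Qed.

(** [psi] is minus the logarithm of the cosine mean at time 1, which is positive and continuous in
    [m] by bounded convergence. This bypasses estimates of the integral against [nu]. *)
Lemma continuous_real_exponent : continuous psi.
Proof.
have -> : psi = (fun m => - ln (\int[P]_w cos (m * Z 1 w))).
  by apply/funext => m; rewrite triplet_cos1 expRK opprK.
have cJ (m : R) : \int[P]_w cos (x * Z 1 w) @[x --> m] --> \int[P]_w cos (m * Z 1 w).
  apply/(@cvg_nbhsP _ R^o) => u um.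
  apply: (@bounded_cvg_Rintegral _ _ _ _ _ _ _ 1) => //.
  - exact: Pfin.
  - by move=> n; exact: measurable_cosM.
  - exact: measurable_cosM.
  - apply: aeW => w _; apply: (@continuous_cvg _ _ _ _ _ _ (@cos R)).
      exact: continuous_cos.
    by apply: cvgM => //; exact: cvg_cst.
  - by move=> n w _; exact: norm_cos_le1.
move=> m; apply: cvgN; apply: (@continuous_cvg _ _ _ _ _ _ (@ln R)); last exact: cJ.
by apply: continuous_ln; rewrite triplet_cos1 expR_gt0.
Qed.

Lemma real_exponent_le m : (\int[nu]_x (x ^+ 2)%:E < +oo)%E ->
  psi m <= (a + \int[nu]_x (x ^+ 2)) / 2 * m ^+ 2.
Proof.
move=> hx2.
have ix2 : nu.-integrable setT (fun x : R => (m ^+ 2 / 2 * x ^+ 2)%:E).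
  under eq_fun do rewrite EFinM.
  apply: integrableZl => //; apply/integrableP; split.
    by apply/measurable_EFinP; exact: measurable_funX.
  by under eq_integral do rewrite gee0_abs ?lee_fin ?sqr_ge0//.
have ix : nu.-integrable setT (fun x : R => (x ^+ 2)%:E).
  apply/integrableP; split.
    by apply/measurable_EFinP; exact: measurable_funX.
  by under eq_integral do rewrite gee0_abs ?lee_fin ?sqr_ge0//.
have bd x : `|cos (m * x) - 1| <= m ^+ 2 / 2 * x ^+ 2.
  have := cos_le1 (m * x); have := cos_ge_quadratic (m * x).
  rewrite exprMn ler_norml; lra.
have ic : nu.-integrable setT (EFin \o (fun x : R => cos (m * x) - 1)).
  apply: (@le_integrable _ _ _ nu _ measurableT _ _ _ _ ix2) => //.
    apply/measurable_EFinP; apply: measurable_funB => //.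
    exact: (measurable_cosM m (@measurable_id _ _ setT)).
  move=> x _; rewrite !abse_EFin lee_fin; apply: le_trans (bd x) _; exact: ler_norm.
have : `|\int[nu]_x (cos (m * x) - 1)| <= m ^+ 2 / 2 * \int[nu]_x (x ^+ 2).
  rewrite -RintegralZl//; apply: le_trans (le_normr_Rintegral measurableT ic) _.
  apply: le_Rintegral => //; first exact: integrable_norm.
rewrite /real_exponent ler_norml => /andP[h _]; move: h; lra.
Qed.

Section Brownian.
Hypothesis hB : brownian_motion Z.

Lemma Brownian_law : exists2 sigma : R, 0 < sigma &
  forall t (f : measurableTypeR R -> R), 0 < t -> measurable_fun setT f -> (forall x, 0 <= f x) ->
  (\int[P]_w (f (Z t w))%:E = \int[normal_prob 0 (sigma * Num.sqrt t)]_x (f x)%:E)%E.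
Proof.
case: hB => Z0 _ [sigma sg hN] _; exists sigma => // t f t0 mf f0.
pose V : Omega -> measurableTypeR R := fun w => Z t w - Z 0 w.
have mV : measurable_fun setT V by exact: measurable_funB.
have mZ : measurable_fun setT (Z t : Omega -> measurableTypeR R).
  exact: (@measurable_funPT _ _ _ _ (Z t)).
transitivity (\int[P]_w (f (V w))%:E)%E.
  apply: ae_eq_integral => //.
  - by apply/measurable_EFinP; exact: (measurableT_comp mf mZ).
  - by apply/measurable_EFinP; exact: (measurableT_comp mf mV).
  - by apply: filterS Z0 => w Zw _; rewrite /V Zw subr0.
have mEf : measurable_fun setT (EFin \o f : measurableTypeR R -> \bar R) by exact/measurable_EFinP.
have := @ge0_integral_pushforward _ _ _ _ R V mV P setT (EFin \o f) measurableT mEf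
  (fun x _ => f0 x).
rewrite preimage_setT => <-; apply: eq_measure_integral => A mA _.
have := hN 0 t (lexx 0) t0 A mA; rewrite subr0; exact.
Qed.

(** By scaling, m Z_1 and Z at time m^2 have the same cosine mean. The former gives exp (- psi m),
    the latter exp (- m^2 psi 1). *)
Lemma Brownian_exponent m : psi m = psi 1 * m ^+ 2.
Proof.
have [sigma sg law] := Brownian_law.
have e t r : 0 < t -> \int[P]_w cos (r * Z t w) =
    \int[normal_prob 0 1]_x cos (r * (sigma * Num.sqrt t) * x).
  move=> t0; rewrite -Rintegral_normal_cos; last by rewrite mulr_gt0// sqrtr_gt0.
  have e1 (d' : measure_display) (T : measurableType d') (Q : probability T R) (X : T -> R) :
      measurable_fun setT X ->
      \int[Q]_x (1 + cos (r * X x)) = 1 + \int[Q]_x cos (r * X x).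
    move=> mX; rewrite RintegralD//.
    - by rewrite Rintegral_cstP.
    - by apply: (bounded_integrable (M := `|1|)) => //; exact: Pfin.
    - exact: integrable_cosM.
  suff : \int[P]_w (1 + cos (r * Z t w)) =
      \int[normal_prob 0 (sigma * Num.sqrt t)]_x (1 + cos (r * x)).
    have E2 : \int[normal_prob 0 (sigma * Num.sqrt t)]_x (1 + cos (r * x)) =
        1 + \int[normal_prob 0 (sigma * Num.sqrt t)]_x cos (r * x) :=
      e1 _ (measurableTypeR R) _ _ (@measurable_id _ _ setT).
    by rewrite e1// E2 => /addrI.
  have E := law t (fun x => 1 + cos (r * x)) t0.
  apply: (congr1 fine); apply: E.
  - apply: measurable_funD => //; exact: (measurable_cosM r (@measurable_id _ _ setT)).
  - by move=> x; have := cos_geN1 (r * x); lra.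
have [->|m0] := eqVneq m 0.
  have := triplet_cos1 0; under eq_Rintegral do rewrite mul0r cos0.
  rewrite Rintegral_cstP -[LHS]expR0 => /expR_inj; lra.
have m2 : 0 < m ^+ 2 by rewrite exprn_even_gt0.
have [h1 _] := triplet_cos_sin 1 (ltW m2).
have := triplet_cos1 m; rewrite e// sqrtr1 mulr1.
rewrite e// in h1; rewrite sqrtr_sqr mul1r in h1.
have -> : \int[normal_prob 0 1]_x cos (m * sigma * x) = \int[normal_prob 0 1]_x cos (sigma * `|m| * x).
  apply: eq_Rintegral => x _; have [m1|m1] := leP 0 m; first by rewrite ger0_norm// (mulrC m).
  by rewrite ltr0_norm// mulrN mulNr cosN (mulrC m).
by rewrite h1 => /expR_inj; lra.
Qed.

Lemma Brownian_even_moment_fin (k : nat) : (\int[P]_w (Z 1 w ^+ k.*2)%:E < +oo)%E.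
Proof.
have [sigma sg law] := Brownian_law.
rewrite (law 1 (fun x => x ^+ k.*2))//.
- by apply: normal_even_moment_fin; rewrite sqrtr1 mulr1.
- by move=> x; rewrite -mul2n exprM exprn_ge0// sqr_ge0.
Qed.

End Brownian.

End Levy_law.

(** * The Molchan-Golosov kernel *)

Section power_inequalities.
Variable R : realType.
Implicit Types x y b g r : R.

Lemma gt0_ler_npowR b x y : b <= 0 -> 0 < x -> x <= y -> y `^ b <= x `^ b.
Proof.
move=> b0 x0 xy; rewrite -[b]opprK !(powRN _ (- b)).
by rewrite lef_pV2 ?posrE ?powR_gt0// ?(lt_le_trans x0)// ge0_ler_powR ?nnegrE ?oppr_ge0//;
  rewrite ltW// (lt_le_trans x0).
Qed.

(** Writing z^b = z z^(b - 1), the second factor is nonincreasing, so it can only grow when x + y is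
    replaced by [x] or [y]. Negative [b] is included. *)
Lemma powR_subadd b x y : b <= 1 -> 0 < x -> 0 < y ->
  (x + y) `^ b <= x `^ b + y `^ b.
Proof.
move=> b1 x0 y0; have xy0 : 0 < x + y by rewrite addr_gt0.
have e z : 0 < z -> z `^ b = z * z `^ (b - 1).
  by move=> z0; rewrite -{2}[z]powRr1 ?ltW// -powRD ?(gt_eqF z0) ?implybT// addrC subrK.
rewrite !e// mulrDl lerD// ler_pM2l// gt0_ler_npowR ?subr_le0//.
  by rewrite lerDl ltW.
by rewrite lerDr ltW.
Qed.

Let powR1E b : 1 `^ b = 1 :> R. Proof. by rewrite powR1. Qed.

Lemma powR_ge1 b x : 0 <= b -> 1 <= x -> 1 <= x `^ b.
Proof. by move=> b0 x1; rewrite -[leLHS](powR1E b) ge0_ler_powR ?nnegrE// (le_trans _ x1). Qed.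

Lemma onep_powR_sub1_le b g r : 0 <= b <= 1 -> b <= g <= 1 -> 0 < r ->
  0 <= (1 + r) `^ b - 1 <= r `^ g.
Proof.
move=> /andP[b0 b1] /andP[bg g1] r0; apply/andP; split.
  by rewrite subr_ge0 powR_ge1// lerDl ltW.
rewrite lerBlDl; have [r1|r1] := leP r 1.
  apply: (@le_trans _ _ (1 + r)); first by rewrite ler1_powR// lerDl ltW.
  by rewrite lerD2l ger1_powR// r0.
apply: le_trans (powR_subadd b1 ltr01 r0) _.
by rewrite powR1E lerD2l ler_powR// ltW.
Qed.

Lemma sub1_onep_powR_le b g r : -1 <= b <= 0 -> 0 <= g <= 1 -> 0 < r ->
  0 <= 1 - (1 + r) `^ b <= r `^ g.
Proof.
move=> /andP[b1 b0] /andP[g0 g1] r0.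
have r1 : 1 <= 1 + r by rewrite lerDl ltW.
have r10 : 0 < 1 + r by rewrite (lt_le_trans _ r1).
apply/andP; split.
  by rewrite subr_ge0 -[leRHS](powR1E b) gt0_ler_npowR.
have : (1 + r)^-1 <= (1 + r) `^ b.
  by rewrite -powR_inv1 ?(ltW r10)// ler_powR.
have : 1 - (1 + r)^-1 <= r `^ g; last by lra.
have -> : 1 - (1 + r)^-1 = r / (1 + r) by field; rewrite gt_eqF.
have [rl1|rl1] := leP r 1.
  apply: (@le_trans _ _ r); last by rewrite ger1_powR// r0.
  by rewrite ler_pdivrMr// ler_peMr// ltW.
apply: (@le_trans _ _ 1); last by rewrite powR_ge1// ltW.
by rewrite ler_pdivrMr// mul1r lerDr.
Qed.

Let scale b g x y : 0 < x -> 0 < y ->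
  (x + y) `^ b - x `^ b = x `^ b * ((1 + y / x) `^ b - 1) /\
  x `^ b * (y / x) `^ g = y `^ g * x `^ (b - g).
Proof.
move=> x0 y0; split.
  rewrite mulrBr mulr1 -powRM ?ltW// ?addr_gt0 ?divr_gt0//.
  by rewrite mulrDr mulr1 mulrCA divff ?gt_eqF// mulr1.
rewrite powRM ?invr_ge0 ?ltW// mulrCA; congr (_ * _).
by rewrite -powR_inv1 ?(ltW x0)// -powRrM mulN1r -powRD ?(gt_eqF x0) ?implybT// addrC.
Qed.

(** By homogeneity this is a statement about r = y / x. The parameter [g] trades smallness in the
    step [y] against a singularity in [x]; it will be [H - e]. *)
Lemma powR_increment_le b g x y : 0 <= b <= 1 -> b <= g <= 1 -> 0 < x -> 0 < y ->
  0 <= (x + y) `^ b - x `^ b <= y `^ g * x `^ (b - g).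
Proof.
move=> hb hg x0 y0; have [-> <-] := scale b g x0 y0.
have /andP[h1 h2] := onep_powR_sub1_le hb hg (divr_gt0 y0 x0).
by rewrite mulr_ge0 ?powR_ge0//= ler_wpM2l ?powR_ge0.
Qed.

Lemma powR_decrement_le b g x y : -1 <= b <= 0 -> 0 <= g <= 1 -> 0 < x -> 0 < y ->
  0 <= x `^ b - (x + y) `^ b <= y `^ g * x `^ (b - g).
Proof.
move=> hb hg x0 y0; rewrite -(opprB ((x + y) `^ b)); have [-> <-] := scale b g x0 y0.
have /andP[h1 h2] := sub1_onep_powR_le hb hg (divr_gt0 y0 x0).
rewrite -mulrN opprB.
by rewrite mulr_ge0 ?powR_ge0//= ler_wpM2l ?powR_ge0.
Qed.

Lemma sqr_powR b x : 0 < x -> (x `^ b) ^+ 2 = x `^ (2 * b).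
Proof.
by move=> x0; rewrite expr2 -powRD ?(gt_eqF x0) ?implybT//; congr (_ `^ _); ring.
Qed.

(** Replacing both bases by the smaller one increases a product of nonpositive powers. A product of
    singularities at two endpoints thus becomes a sum that can be integrated termwise. *)
Lemma mixed_powR_le b g x y : b <= 0 -> g <= 0 -> 0 < x -> 0 < y ->
  x `^ b * y `^ g <= x `^ (b + g) + y `^ (b + g).
Proof.
move=> b0 g0 x0 y0; have [xy|yx] := leP x y.
  apply: (@le_trans _ _ (x `^ (b + g))); last by rewrite lerDl powR_ge0.
  by rewrite powRD ?(gt_eqF x0) ?implybT// ler_wpM2l ?powR_ge0// gt0_ler_npowR.
apply: (@le_trans _ _ (y `^ (b + g))); last by rewrite lerDr powR_ge0.
by rewrite powRD ?(gt_eqF y0) ?implybT// ler_wpM2r ?powR_ge0// gt0_ler_npowR// ltW.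
Qed.

End power_inequalities.

(** * Integrals of powers with an endpoint singularity *)

Section power_integrals.
Variable R : realType.
Implicit Types x y b c u : R.
Notation mu := (@lebesgue_measure R).

Let is_derive_shift0 b c u : c < u ->
  is_derive u (1 : R) (fun v : R => (v - c) `^ b : R) (b * (u - c) `^ (b - 1)).
Proof.
move=> cu; have uc0 : 0 < u - c by rewrite subr_gt0.
have h1 := is_derive1_powR b uc0.
have h2 := is_deriveB (is_derive_id u (1 : R)) (is_derive_cst c u (1 : R)).
rewrite subr0 in h2.
have := is_derive1_comp (f := fun z : R => z `^ b) (g := fun v : R => v - c) h1 h2.
by rewrite mulr1.
Qed.

Let is_derive_refl0 b c u : u < c ->
  is_derive u (1 : R) (fun v : R => (c - v) `^ b : R) (- (b * (c - u) `^ (b - 1))).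
Proof.
move=> uc; have uc0 : 0 < c - u by rewrite subr_gt0.
have h1 := is_derive1_powR b uc0.
have h2 := is_deriveB (is_derive_cst c u (1 : R)) (is_derive_id u (1 : R)).
rewrite sub0r in h2.
have := is_derive1_comp (f := fun z : R => z `^ b) (g := fun v : R => c - v) h1 h2.
by rewrite mulrN1.
Qed.

Let is_derive_shift b c u : c < u -> is_derive u (1 : R)
  (fun v : R => (b + 1)^-1 * (v - c) `^ (b + 1) : R)
  ((b + 1)^-1 * ((b + 1) * (u - c) `^ b)).
Proof.
move=> cu; have := is_deriveZ (b + 1)^-1 (is_derive_shift0 (b + 1) cu).
by rewrite /GRing.scale/= addrK.
Qed.

Let is_derive_refl b c u : u < c -> is_derive u (1 : R)
  (fun v : R => - (b + 1)^-1 * (c - v) `^ (b + 1) : R)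
  ((b + 1)^-1 * ((b + 1) * (c - u) `^ b)).
Proof.
move=> cu; have := is_deriveZ (- (b + 1)^-1) (is_derive_refl0 (b + 1) cu).
by rewrite /GRing.scale/= addrK mulrNN.
Qed.

Lemma continuous_powR_shift b c u : c < u ->
  {for u, continuous (fun v : R => (v - c) `^ b : R)}.
Proof.
move=> cu; apply/differentiable_continuous/derivable1_diffP.
exact: (@ex_derive _ _ _ _ _ _ _ (is_derive_shift0 b cu)).
Qed.

Lemma continuous_powR_refl b c u : u < c ->
  {for u, continuous (fun v : R => (c - v) `^ b : R)}.
Proof.
move=> cu; apply/differentiable_continuous/derivable1_diffP.
exact: (@ex_derive _ _ _ _ _ _ _ (is_derive_refl0 b cu)).
Qed.

Let FTC2 (f F : R -> R) x y : x < y ->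
  (forall u, x <= u <= y -> {for u, continuous f}) ->
  (forall u, x <= u <= y -> is_derive u 1 F (f u)) ->
  (\int[mu]_(u in `[x, y]) (f u)%:E = (F y - F x)%:E)%E.
Proof.
move=> xy cf dF.
have cF u : x <= u <= y -> {for u, continuous F}.
  move=> /dF h; apply/differentiable_continuous/derivable1_diffP.
  exact: ex_derive.
rewrite (continuous_FTC2 xy (F := F)) ?EFinB//.
- apply: continuous_in_subspaceT => u; rewrite inE/= in_itv/=.
  exact: cf.
- split.
  + move=> u; rewrite in_itv/= => /andP[xu uy].
    by apply: (@ex_derive _ _ _ _ _ _ _ (dF u _)); rewrite !ltW.
  + by apply: cvg_at_right_filter; apply: cF; rewrite lexx ltW.
  + by apply: cvg_at_left_filter; apply: cF; rewrite lexx ltW.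
- move=> u; rewrite in_itv/= => /andP[xu uy].
  rewrite derive1E; have h : x <= u <= y by rewrite !ltW.
  exact: (@derive_val _ _ _ _ _ _ _ (dF u h)).
Qed.

Lemma integral_powR_shift b c x y : b + 1 != 0 -> c < x -> x < y ->
  (\int[mu]_(u in `[x, y]) ((u - c) `^ b)%:E =
   ((b + 1)^-1 * ((y - c) `^ (b + 1) - (x - c) `^ (b + 1)))%:E)%E.
Proof.
move=> b1 cx xy.
have h1 u : x <= u <= y -> {for u, continuous (fun v : R => (v - c) `^ b : R)}.
  by move=> /andP[xu _]; apply: continuous_powR_shift; exact: lt_le_trans xu.
have h2 u : x <= u <= y -> is_derive u (1 : R)
    (fun v : R => (b + 1)^-1 * (v - c) `^ (b + 1) : R) ((u - c) `^ b).
  move=> /andP[xu _]; have := @is_derive_shift b c u (lt_le_trans cx xu).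
  by rewrite mulrA mulVf// mul1r.
by rewrite (FTC2 xy h1 h2) mulrBr.
Qed.

Lemma integral_powR_refl b c x y : b + 1 != 0 -> y < c -> x < y ->
  (\int[mu]_(u in `[x, y]) ((c - u) `^ b)%:E =
   ((b + 1)^-1 * ((c - x) `^ (b + 1) - (c - y) `^ (b + 1)))%:E)%E.
Proof.
move=> b1 yc xy.
have h1 u : x <= u <= y -> {for u, continuous (fun v : R => (c - v) `^ b : R)}.
  by move=> /andP[_ uy]; apply: continuous_powR_refl; exact: le_lt_trans yc.
have h2 u : x <= u <= y -> is_derive u (1 : R)
    (fun v : R => - (b + 1)^-1 * (c - v) `^ (b + 1) : R) ((c - u) `^ b).
  move=> /andP[_ uy]; have := @is_derive_refl b c u (le_lt_trans uy yc).
  by rewrite mulrA mulVf// mul1r.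
by rewrite (FTC2 xy h1 h2); congr _%:E; rewrite !mulNr opprK mulrBr addrC.
Qed.

Lemma measurable_powR_shift b c (D : set R) : measurable_fun D (fun u => (u - c) `^ b).
Proof.
apply: measurable_funTS.
by apply: (measurableT_comp (measurable_powR _)); exact: measurable_funB.
Qed.

Lemma measurable_powR_refl b c (D : set R) : measurable_fun D (fun u => (c - u) `^ b).
Proof.
apply: measurable_funTS.
by apply: (measurableT_comp (measurable_powR _)); exact: measurable_funB.
Qed.

(** For negative [b] the integral is improper at [x]. The primitive is evaluated away from [x], and
    Fatou's lemma passes to the limit; an upper bound is all that is used later. *)
Lemma integral_powR_shift_le b x y : -1 < b -> x < y ->
  (\int[mu]_(u in `[x, y]) ((u - x) `^ b)%:E <=
   ((b + 1)^-1 * (y - x) `^ (b + 1))%:E)%E.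
Proof.
move=> b1 xy; have b10 : 0 < b + 1 by rewrite -ltrBlDr sub0r.
have yx0 : 0 < y - x by rewrite subr_gt0.
(* The shift by 2 keeps [r n] strictly below [y] even for [n = 0]. *)
pose r n := x + (y - x) / n.+2%:R.
have xr n : x < r n by rewrite ltrDl divr_gt0.
have ry n : r n < y.
  by rewrite -ltrBrDl ltr_pdivrMr// ltr_pMr// ltr1n.
rewrite -integral_itv_obnd_cbnd; last first.
  by apply/measurable_EFinP; exact: measurable_powR_shift.
apply: (@fatou_le _ _ R mu `]x, y]%classic
  (fun n u => (u - x) `^ b * \1_(`[r n, y]%classic : set R) u)
  (fun u => (u - x) `^ b) (fun=> ((b + 1)^-1 * (y - x) `^ (b + 1))%:E)).
- by [].
- move=> n; apply: measurable_funM; first exact: measurable_powR_shift.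
  exact: measurable_indic.
- exact: measurable_powR_shift.
- by move=> n u _; rewrite mulr_ge0 ?powR_ge0.
- apply: aeW => u /=; rewrite in_itv/= => /andP[xu uy].
  apply: cvg_near_cst; have ux0 : 0 < u - x by rewrite subr_gt0.
  have [N _ hN] := @near_infty_natSinv_lt _ (PosNum (divr_gt0 ux0 yx0)).
  exists N => // n /= Nn; rewrite indicE mem_set ?mulr1//=.
  rewrite in_itv/= uy andbT /r -lerBrDl.
  have := hN n Nn; rewrite /= ltr_pdivlMr// mulrC => /ltW; apply: le_trans.
  by rewrite ler_pM2l// lef_pV2 ?posrE// ler_nat.
- move=> n; rewrite [leLHS](_ : _ = \int[mu]_(u in `[r n, y]) ((u - x) `^ b)%:E)%E.
    rewrite integral_powR_shift ?gt_eqF// lee_fin ler_pM2l ?invr_gt0//.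
    by rewrite lerBlDr lerDl powR_ge0.
  have e : `]x, y]%classic `&` `[r n, y]%classic = `[r n, y]%classic.
    apply/setIidPr => u /=; rewrite !in_itv/= => /andP[ru ->].
    by rewrite andbT (lt_le_trans (xr n)).
  rewrite -[in RHS]e integral_mkcondr; apply: eq_integral => u _.
  by rewrite patchE indicE; case: ifPn => _; rewrite ?mulr1 ?mulr0.
- exact: cvg_cst.
Qed.

Lemma integral_powR_refl_le b x y : -1 < b -> x < y ->
  (\int[mu]_(u in `[x, y]) ((y - u) `^ b)%:E <=
   ((b + 1)^-1 * (y - x) `^ (b + 1))%:E)%E.
Proof.
move=> b1 xy; have b10 : 0 < b + 1 by rewrite -ltrBlDr sub0r.
have yx0 : 0 < y - x by rewrite subr_gt0.
pose r n := y - (y - x) / n.+2%:R.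
have ry n : r n < y by rewrite gtrBl divr_gt0.
have xr n : x < r n.
  by rewrite ltrBrDr -ltrBrDl ltr_pdivrMr// ltr_pMr// ltr1n.
rewrite -integral_itv_bndo_bndc; last first.
  by apply/measurable_EFinP; exact: measurable_powR_refl.
apply: (@fatou_le _ _ R mu `[x, y[%classic
  (fun n u => (y - u) `^ b * \1_(`[x, r n]%classic : set R) u)
  (fun u => (y - u) `^ b) (fun=> ((b + 1)^-1 * (y - x) `^ (b + 1))%:E)).
- by [].
- move=> n; apply: measurable_funM; first exact: measurable_powR_refl.
  exact: measurable_indic.
- exact: measurable_powR_refl.
- by move=> n u _; rewrite mulr_ge0 ?powR_ge0.
- apply: aeW => u /=; rewrite in_itv/= => /andP[xu uy].
  apply: cvg_near_cst; have ux0 : 0 < y - u by rewrite subr_gt0.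
  have [N _ hN] := @near_infty_natSinv_lt _ (PosNum (divr_gt0 ux0 yx0)).
  exists N => // n /= Nn; rewrite indicE mem_set ?mulr1//=.
  rewrite in_itv/= xu /r lerBrDr -lerBrDl.
  have := hN n Nn; rewrite /= ltr_pdivlMr// mulrC => /ltW; apply: le_trans.
  by rewrite ler_pM2l// lef_pV2 ?posrE// ler_nat.
- move=> n; rewrite [leLHS](_ : _ = \int[mu]_(u in `[x, r n]) ((y - u) `^ b)%:E)%E.
    rewrite integral_powR_refl ?gt_eqF// lee_fin ler_pM2l ?invr_gt0//.
    by rewrite lerBlDr lerDl powR_ge0.
  have e : `[x, y[%classic `&` `[x, r n]%classic = `[x, r n]%classic.
    apply/setIidPr => u /=; rewrite !in_itv/= => /andP[-> ru].
    by rewrite (le_lt_trans ru).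
  rewrite -[in RHS]e integral_mkcondr; apply: eq_integral => u _.
  by rewrite patchE indicE; case: ifPn => _; rewrite ?mulr1 ?mulr0.
- exact: cvg_cst.
Qed.

End power_integrals.

(** * Pointwise and mean-square bounds on the kernel *)

Section Molchan_Golosov.
Variables (R : realType) (H : R).
Hypothesis hH : 0 < H < 1.
Notation mu := (@lebesgue_measure R).
Local Notation al := (H - 2^-1).
Local Notation inner s t u :=
  (\int[mu]_(v in `[s, t]) (v `^ (H - 3/2) * (v - u) `^ al)).

Let H0 : 0 < H. Proof. by case/andP: hH. Qed.
Let H1 : H < 1. Proof. by case/andP: hH. Qed.

Let mf u (D : set R) : measurable_fun D (fun v : R => v `^ (H - 3/2) * (v - u) `^ al).
Proof.
apply: measurable_funM; last exact: measurable_powR_shift.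
by apply: measurable_funTS; exact: measurable_powR.
Qed.

Let addp (x a b : R) : 0 < x -> x `^ (a + b) = x `^ a * x `^ b.
Proof. by move=> x0; rewrite powRD// (gt_eqF x0) implybT. Qed.

Let integrable_inner u t : 0 < u -> u < t ->
  mu.-integrable `[u, t] (EFin \o (fun v : R => v `^ (H - 3/2) * (v - u) `^ al)).
Proof.
move=> u0 ut; apply/integrableP; split; first by apply/measurable_EFinP; exact: mf.
apply: (@le_lt_trans _ _ (\int[mu]_(v in `[u, t]) ((u `^ (H - 3/2))%:E * ((v - u) `^ al)%:E))%E).
  apply: ge0_le_integral => //=.
  - by apply/measurable_EFinP; apply: measurableT_comp => //; exact: mf.
  - by apply: measurable_funeM; apply/measurable_EFinP; exact: measurable_powR_shift.
  - move=> v; rewrite in_itv/= => /andP[uv vt].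
    rewrite -EFinM lee_fin ger0_norm ?mulr_ge0 ?powR_ge0// ler_wpM2r ?powR_ge0//.
    by apply: gt0_ler_npowR => //; have := H1; lra.
rewrite ge0_integralZl//=.
- apply: lte_mul_pinfty; rewrite ?lee_fin ?powR_ge0//.
  apply: le_lt_trans (ltry _); apply: integral_powR_shift_le => //.
  by have := H0; lra.
- by apply/measurable_EFinP; exact: measurable_powR_shift.
- by move=> v _; rewrite lee_fin powR_ge0.
- by rewrite lee_fin powR_ge0.
Qed.

Let inner_split u s t : 0 < u -> u < s -> s < t ->
  inner u t u = inner u s u + inner s t u.
Proof.
move=> u0 us st; have ut := lt_trans us st.
have i := integrable_inner u0 ut.
have := @Rintegral_itvB R (fun v : R => v `^ (H - 3/2) * (v - u) `^ al)
  (BLeft u) (BRight t) s i.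
rewrite !bnd_simp => /(_ (ltW us) (ltW st)) h.
have i' : mu.-integrable `]s, t] (EFin \o (fun v : R => v `^ (H - 3/2) * (v - u) `^ al)).
  apply: integrableS i => // v /=; rewrite !in_itv/= => /andP[sv ->].
  by rewrite andbT (le_trans (ltW us))// ltW.
by move: h (Rintegral_itv_obnd_cbnd i'); lra.
Qed.

(** The factor [al] makes up for the reversed monotonicity of negative powers, so [inner_bounds]
    needs no case distinction on [H]. *)
Let alp_mono x y : 0 < x -> x <= y -> al * x `^ al <= al * y `^ al.
Proof.
move=> x0 xy; have [a0|a0] := leP 0 al.
  by rewrite ler_wpM2l// ge0_ler_powR// ?nnegrE ltW// (lt_le_trans x0).
by rewrite ler_nM2l// gt0_ler_npowR// ltW.
Qed.

(* [al * v `^ (H - 3/2)] is the derivative of [v `^ al] and [(v - u) `^ al] is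
   monotone in [v]. *)
Let inner_bounds u s t : al != 0 -> 0 < u -> u < s -> s < t ->
  (s - u) `^ al * (t `^ al - s `^ al) <= al * inner s t u <=
  (t - u) `^ al * (t `^ al - s `^ al).
Proof.
move=> a0 u0 us st; have s0 := lt_trans u0 us; have t0 := lt_trans s0 st.
have HE : H - 3/2 + 1 = al by lra.
have mst : measurable (`[s, t]%classic : set (measurableTypeR R)) by exact: measurable_itv.
have lamst : (mu `[s, t] < +oo)%E by rewrite lebesgue_measure_itv/= lte_fin st -EFinB ltry.
have iq : mu.-integrable `[s, t] (EFin \o (fun v : R => v `^ (H - 3/2))).
  apply: (@bounded_integrable _ _ _ _ _ _ (s `^ (H - 3/2))) => //.
    by apply: measurable_funTS; exact: measurable_powR.
  move=> v; rewrite /= in_itv/= => /andP[sv vt]; rewrite ger0_norm ?powR_ge0//.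
  by apply: gt0_ler_npowR => //; have := H1; lra.
have J : \int[mu]_(v in `[s, t]) (v `^ (H - 3/2)) = (t `^ al - s `^ al) / al.
  rewrite /Rintegral.
  under eq_integral do rewrite -[X in X `^ _]subr0.
  by rewrite integral_powR_shift ?HE// !subr0/= mulrC.
have i : mu.-integrable `[s, t] (EFin \o (fun v : R => v `^ (H - 3/2) * (v - u) `^ al)).
  apply: integrableS (integrable_inner u0 (lt_trans us st)) => //.
  by move=> v /=; rewrite !in_itv/= => /andP[sv ->]; rewrite andbT (le_trans (ltW us)).
have ia : mu.-integrable `[s, t]
    (EFin \o (fun v : R => al * (v `^ (H - 3/2) * (v - u) `^ al))).
  by have := integrableZl mst al i.
have ik k : mu.-integrable `[s, t] (EFin \o (fun v : R => k * v `^ (H - 3/2))).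
  by have := integrableZl mst k iq.
have Jk k : (k * (t `^ al - s `^ al)) = \int[mu]_(v in `[s, t]) (al * k * v `^ (H - 3/2)).
  by rewrite RintegralZl// J (mulrC al) -mulrA (mulrCA al) divff// mulr1.
rewrite -RintegralZl// !Jk; apply/andP; split; apply: le_Rintegral => // v;
  rewrite /= in_itv/= => /andP[sv vt].
- have h : v `^ (H - 3/2) * (al * (s - u) `^ al) <= v `^ (H - 3/2) * (al * (v - u) `^ al).
    by rewrite ler_wpM2l ?powR_ge0// alp_mono ?subr_gt0// lerB.
  by rewrite mulrC; apply: le_trans h _; rewrite mulrCA.
- have h : v `^ (H - 3/2) * (al * (v - u) `^ al) <= v `^ (H - 3/2) * (al * (t - u) `^ al).
    by rewrite ler_wpM2l ?powR_ge0// alp_mono ?lerB// subr_gt0 (lt_le_trans us).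
  by rewrite [leRHS]mulrC; apply: le_trans _ h; rewrite mulrCA.
Qed.

Let inner_ge0 s t u : 0 <= inner s t u.
Proof. by apply: Rintegral_ge0 => v _; rewrite mulr_ge0 ?powR_ge0. Qed.

Let inner_le u t k b : al != 0 -> u < t -> -1 < b -> 0 <= k ->
  (forall v, u < v -> v <= t -> v `^ (H - 3/2) * (v - u) `^ al <= k * (v - u) `^ b) ->
  inner u t u <= k * ((b + 1)^-1 * (t - u) `^ (b + 1)).
Proof.
move=> a0 ut b1 k0 h.
have e : (\int[mu]_(v in `[u, t]) (v `^ (H - 3/2) * (v - u) `^ al)%:E <=
    (k * ((b + 1)^-1 * (t - u) `^ (b + 1)))%:E)%E.
  apply: (@le_trans _ _ (\int[mu]_(v in `[u, t]) (k%:E * ((v - u) `^ b)%:E))%E).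
    apply: ge0_le_integral => //=.
    - by move=> v _; rewrite lee_fin mulr_ge0 ?powR_ge0.
    - by apply/measurable_EFinP; exact: mf.
    - by apply: measurable_funeM; apply/measurable_EFinP; exact: measurable_powR_shift.
    (* At [v = u] the base is 0, and [powR] returns 0 there because [al] is nonzero. *)
    - move=> v; rewrite in_itv/= => /andP[]; rewrite le_eqVlt => /predU1P[<-|uv] vt.
        by rewrite -EFinM lee_fin subrr powR0// mulr0 mulr_ge0 ?powR_ge0.
      by rewrite -EFinM lee_fin h.
  rewrite ge0_integralZl//=.
  - by rewrite EFinM lee_wpmul2l ?lee_fin// integral_powR_shift_le.
  - by apply/measurable_EFinP; exact: measurable_powR_shift.
  - by move=> v _; rewrite lee_fin powR_ge0.
rewrite /Rintegral -lee_fin fineK// ge0_fin_numE ?(le_lt_trans e) ?ltry//.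
by apply: integral_ge0 => v _; rewrite lee_fin mulr_ge0 ?powR_ge0.
Qed.

Local Notation C := (MG_const H).

Let kernelE t u : MG_kernel H t u =
  C * (u `^ (- al) * (t `^ al * (t - u) `^ al - al * inner u t u)).
Proof.
have e1 : H - 1/2 = al by lra.
have e2 : 1/2 - H = - al by lra.
by rewrite /MG_kernel e1 e2 mulrA.
Qed.

(** The inner integrals up to [s] cancel in the difference. Inserting either side of [inner_bounds]
    for the rest leaves only the increment of (v - u)^al, with coefficient s^al or t^al. *)
Let kernel_increment u s t : al != 0 -> 0 < u -> u < s -> s < t ->
  exists A, [/\ MG_kernel H t u - MG_kernel H s u = C * (u `^ (- al) * A),
    s `^ al * ((t - u) `^ al - (s - u) `^ al) <= A &
    A <= t `^ al * ((t - u) `^ al - (s - u) `^ al)].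
Proof.
move=> a0 u0 us st; have /andP[h1 h2] := inner_bounds a0 u0 us st.
exists (t `^ al * (t - u) `^ al - s `^ al * (s - u) `^ al - al * inner s t u); split.
- by rewrite !kernelE (inner_split u0 us st); ring.
- by lra.
- by lra.
Qed.

Let powN_le1 u s : al < 0 -> 0 < u -> u <= s -> u `^ (- al) * s `^ al <= 1.
Proof.
move=> a0 u0 us; have s0 := lt_le_trans u0 us.
rewrite powRN mulrC ler_pdivrMr ?powR_gt0// [leRHS]mul1r.
by rewrite gt0_ler_npowR// ltW.
Qed.

(** The conditions on [e] make [H - e] admissible in the power inequalities: e <= 1/2 serves the
    exponent [al], and e <= 1 - H the exponent [al + al]. Squaring leaves 2 e - 1 > -1 at both ends
    of [0, s]. *)
Lemma MG_kernel_increment_sqr (e : R) : 0 < e -> e < H -> e <= 1 - H -> e <= 1/2 ->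
  exists2 c : R, 0 <= c & forall u s t, 0 < u -> u < s -> s < t ->
  (MG_kernel H t u - MG_kernel H s u) ^+ 2 <=
  c * ((t - s) `^ (2 * (H - e)) * ((s - u) `^ (2 * e - 1) + u `^ (2 * e - 1))).
Proof.
(* The 4 stands for two factors 2: one from (p + q)^2 <= 2 (p^2 + q^2), the other from the second
   copy of the singularity at [s] that [mixed_powR_le] produces. *)
move=> e0 eH e1 e2; exists (4 * C ^+ 2); first by rewrite mulr_ge0 ?sqr_ge0.
move=> u s t u0 us st; have s0 := lt_trans u0 us; have t0 := lt_trans s0 st.
have x0 : 0 < s - u by rewrite subr_gt0.
have y0 : 0 < t - s by rewrite subr_gt0.
have [a0|a0] := eqVneq al 0.
  rewrite !kernelE a0 oppr0 !powRr0 !mul0r !subr0 subrr expr0n/=.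
  by rewrite mulr_ge0 ?mulr_ge0 ?sqr_ge0 ?powR_ge0// addr_ge0 ?powR_ge0.
have [A [-> A1 A2]] := kernel_increment a0 u0 us st.
have Ete : t - u = (s - u) + (t - s) by ring.
suff [B [hB1 hB2]] : exists B : R, `|u `^ (- al) * A| <= B /\
   B ^+ 2 <= 4 * ((t - s) `^ (2 * (H - e)) * ((s - u) `^ (2 * e - 1) + u `^ (2 * e - 1))).
  rewrite exprMn (mulrC 4) -[leRHS]mulrA; apply: ler_wpM2l; first exact: sqr_ge0.
  apply: le_trans hB2; rewrite -real_normK ?num_real// ler_sqr ?nnegrE//.
  exact: le_trans hB1.
have [apos|aneg] := ltP 0 al; last first.
  (* For negative [al] the bracket [A] is nonpositive, so its lower bound controls it, and u^(- al)
     s^al <= 1 removes the outer powers. *)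
  have {}aneg : al < 0 by rewrite lt_neqAle a0.
  have := @powR_decrement_le _ al (H - e) _ _ _ _ x0 y0; rewrite -Ete.
  move=> /(_ ltac:(apply/andP; split; have := H0; lra) ltac:(apply/andP; split; have := H1; lra)) /andP[d0 d1].
  exists ((t - s) `^ (H - e) * (s - u) `^ (al - (H - e))); split.
    apply: (@le_trans _ _ (u `^ (- al) * s `^ al * ((s - u) `^ al - (t - u) `^ al))).
      rewrite normrM ger0_norm ?powR_ge0// -mulrA ler_wpM2l ?powR_ge0//.
      rewrite ler_norml; apply/andP; split; first by rewrite -mulrN opprB.
      apply: le_trans A2 _; apply: (@le_trans _ _ 0).
        by rewrite mulr_ge0_le0 ?powR_ge0// -opprB oppr_le0.
      by rewrite mulr_ge0 ?powR_ge0.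
    apply: le_trans _ d1; rewrite ler_piMl//.
    by rewrite powN_le1// ltW.
  rewrite exprMn !sqr_powR//.
  have -> : 2 * (al - (H - e)) = 2 * e - 1 by lra.
  rewrite mulrCA ler_wpM2l ?powR_ge0//.
  have := powR_ge0 (s - u) (2 * e - 1); have := powR_ge0 u (2 * e - 1); lra.
(* For positive [al] one splits t^al <= u^al + (t - u)^al. The first term cancels the outer power of
   [u]; the second is absorbed in an increment of exponent [al + al]. *)
have := @powR_increment_le _ al (H - e) _ _ _ _ x0 y0; rewrite -Ete.
move=> /(_ ltac:(apply/andP; split; have := H1; lra) ltac:(apply/andP; split; have := H1; lra)) /andP[d0 d1].
have := @powR_increment_le _ (al + al) (H - e) _ _ _ _ x0 y0; rewrite -Ete.
move=> /(_ ltac:(apply/andP; split; have := H1; lra) ltac:(apply/andP; split; have := H1; lra)) /andP[_ d2].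
have tu0 : 0 < t - u by rewrite subr_gt0 (lt_trans us).
exists ((t - s) `^ (H - e) * ((s - u) `^ (al - (H - e)) +
   u `^ (- al) * (s - u) `^ (al + al - (H - e)))); split.
  rewrite ger0_norm; last first.
    by rewrite mulr_ge0 ?powR_ge0// (le_trans _ A1)// mulr_ge0 ?powR_ge0.
  apply: (@le_trans _ _ (u `^ (- al) * ((u `^ al + (t - u) `^ al) * ((t - u) `^ al - (s - u) `^ al)))).
    rewrite ler_wpM2l ?powR_ge0//; apply: le_trans A2 _; rewrite ler_wpM2r//.
    rewrite -{1}[t](subrK u) addrC; apply: powR_subadd => //.
    by have := H1; lra.
  rewrite mulrDl [leLHS]mulrDr [leRHS]mulrDr; apply: lerD.
    by rewrite mulrA -addp// addNr powRr0 mul1r.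
  rewrite [leRHS]mulrCA; rewrite ler_wpM2l ?powR_ge0//.
  apply: le_trans d2; rewrite !(@addp _ al al)// mulrBr lerB//.
  by rewrite ler_wpM2r ?powR_ge0// -subr_ge0.
rewrite exprMn sqr_powR// [leRHS]mulrCA ler_wpM2l ?powR_ge0//.
apply: (@le_trans _ _ (2 * ((s - u) `^ (al - (H - e)) ^+ 2 + (u `^ (- al) * (s - u) `^ (al + al - (H - e))) ^+ 2))).
  set p := (s - u) `^ (al - _); set q := u `^ _ * _.
  have := sqr_ge0 (p - q); rewrite sqrrB sqrrD; lra.
rewrite exprMn !sqr_powR//.
have -> : 2 * (al - (H - e)) = 2 * e - 1 by lra.
have := @mixed_powR_le _ (2 * - al) (2 * (al + al - (H - e))) u (s - u).
have -> : 2 * - al + 2 * (al + al - (H - e)) = 2 * e - 1 by lra.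
move=> /(_ ltac:(lra) ltac:(lra) u0 x0).
have := powR_ge0 (s - u) (2 * e - 1); have := powR_ge0 u (2 * e - 1); lra.
Qed.


(** For the part of the increment beyond [s]. The relations between the exponents say that both
    terms integrate over [s, t] to multiples of (t - s)^(2 H); powers of [u] become powers of
    [u - s] because [s] is nonnegative. *)
Lemma MG_kernel_sqr_le : exists c b1 b2 e2 : R, [/\ 0 <= c, -1 < b1, -1 < b2,
  (b1 + 1 = 2 * H) /\ (e2 + (b2 + 1) = 2 * H) &
  forall s u t, 0 <= s -> s < u -> u < t ->
  MG_kernel H t u ^+ 2 <= c * ((t - u) `^ b1 + (t - s) `^ e2 * (u - s) `^ b2)].
Proof.
have C0 : 0 <= C by exact: powR_ge0.
have half (x : R) : x != 0 -> x * (x + x)^-1 = 2^-1.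
  by move=> x0; rewrite -[x + x]mulr2n -[_ *+ 2]mulr_natr invfM mulrA divff// mul1r.
have sqr2 (p q : R) : (p + q) ^+ 2 <= 2 * (p ^+ 2 + q ^+ 2).
  by have := sqr_ge0 (p - q); rewrite sqrrB sqrrD; lra.
have sqle (p q : R) : `|p| <= q -> p ^+ 2 <= q ^+ 2.
  move=> pq; rewrite -real_normK ?num_real// ler_sqr ?nnegrE//.
  exact: le_trans pq.
have CF (x z : R) : x ^+ 2 <= 2 * z -> (C * x) ^+ 2 <= 2 * C ^+ 2 * z.
  move=> h; rewrite exprMn [leRHS](_ : _ = C ^+ 2 * (2 * z)); last by ring.
  by apply: ler_wpM2l => //; exact: sqr_ge0.
have [a0|a0] := eqVneq al 0.
  exists (C ^+ 2), 0, 0, 0; split; [exact: sqr_ge0 | lra | lra | split; lra |].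
  move=> s u t _ _ _; rewrite kernelE a0 oppr0 !powRr0 !mul0r subr0 !mulr1.
  by have := sqr_ge0 C; lra.
have [apos|aneg] := ltP 0 al.
- exists (2 * C ^+ 2), (2 * al), (2 * - al), (4 * al); split.
  + by rewrite mulr_ge0 ?sqr_ge0.
  + by lra.
  + by have := H1; lra.
  + by split; lra.
  move=> s u t s0 su ut; have u0 := le_lt_trans s0 su; have t0 := lt_trans u0 ut.
  have tu0 : 0 < t - u by rewrite subr_gt0.
  (* This makes the kernel nonnegative, so the inner integral may be dropped from the upper
     bound. *)
  have I1 : al * inner u t u <= t `^ al * (t - u) `^ al.
    have h : inner u t u <= 1 * ((al + al - 1 + 1)^-1 * (t - u) `^ (al + al - 1 + 1)).
      apply: inner_le => //; first by lra.
      move=> v uv vt; rewrite mul1r; have vu0 : 0 < v - u by rewrite subr_gt0.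
      have -> : al + al - 1 = (H - 3/2) + al by lra.
      rewrite (@addp _ (H - 3/2))// ler_wpM2r ?powR_ge0//.
      by apply: gt0_ler_npowR => //; [have := H1; lra | lra].
    apply: (@le_trans _ _ (2^-1 * (t - u) `^ (al + al))).
      move: h; rewrite subrK mul1r => h.
      apply: le_trans (ler_wpM2l (ltW apos) h) _.
      by rewrite mulrA half// ler_wpM2r ?powR_ge0.
    rewrite (@addp _ al al)// mulrA ler_wpM2r ?powR_ge0//.
    apply: (@le_trans _ _ ((t - u) `^ al)); first by have := powR_ge0 (t - u) al; lra.
    by rewrite ge0_ler_powR ?nnegrE//; lra.
  have B1 : `|MG_kernel H t u| <= C * ((t - u) `^ al + u `^ (- al) * (t - u) `^ (2 * al)).
    rewrite kernelE; have Iu : 0 <= al * inner u t u by rewrite mulr_ge0 ?inner_ge0// ltW.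
    rewrite ger0_norm; last by rewrite mulr_ge0// mulr_ge0 ?powR_ge0// subr_ge0.
    apply: ler_wpM2l => //.
    apply: (@le_trans _ _ (u `^ (- al) * ((u `^ al + (t - u) `^ al) * (t - u) `^ al))).
      rewrite ler_wpM2l ?powR_ge0//.
      apply: (@le_trans _ _ (t `^ al * (t - u) `^ al)); first by lra.
      rewrite ler_wpM2r ?powR_ge0// -{1}[t](subrK u) addrC.
      by apply: powR_subadd => //; have := H1; lra.
    rewrite mulrDl [leLHS]mulrDr mulrA -addp// addNr powRr0 mul1r -addp//.
    by have -> : al + al = 2 * al by ring.
  apply: le_trans (sqle _ _ B1) _.
  apply: CF; apply: le_trans (sqr2 _ _) _.
  rewrite exprMn !sqr_powR//; apply: ler_wpM2l => //; apply: lerD => //.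
  rewrite mulrC; apply: ler_pM; rewrite ?powR_ge0//.
    have -> : 2 * (2 * al) = 4 * al by ring.
    by rewrite ge0_ler_powR ?nnegrE//; lra.
  by apply: gt0_ler_npowR; lra.
have {}aneg : al < 0 by rewrite lt_neqAle a0.
(* Part of the power of [v] is moved to [v - u], leaving (v - u)^(eta - 1) and u^(al - eta).
   Integrability needs eta > 0 for the first and eta < H for the square of the second; the midpoint
   is chosen. *)
pose eta := H / 2.
have eta0 : 0 < eta by rewrite divr_gt0.
have etaH : 2 * eta = H by rewrite /eta mulrC divfK.
exists (2 * C ^+ 2 * (1 + (al / eta) ^+ 2)), (2 * al), (2 * (al - eta)), (2 * eta); split.
+ by rewrite mulr_ge0 ?mulr_ge0 ?sqr_ge0// addr_ge0 ?sqr_ge0.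
+ by have := H0; lra.
+ by have := H0; lra.
+ by split; lra.
move=> s u t s0 su ut; have u0 := le_lt_trans s0 su; have t0 := lt_trans u0 ut.
have tu0 : 0 < t - u by rewrite subr_gt0.
have I1 : u `^ (- al) * inner u t u <= u `^ (al - eta) * (eta^-1 * (t - u) `^ eta).
  have h : inner u t u <= (u `^ al * u `^ (al - eta)) *
      ((eta - 1 + 1)^-1 * (t - u) `^ (eta - 1 + 1)).
    apply: inner_le => //; first by lra.
      by rewrite mulr_ge0 ?powR_ge0.
    move=> v uv vt; have vu0 : 0 < v - u by rewrite subr_gt0.
    have v0 := lt_trans u0 uv.
    have -> : eta - 1 = (eta - al - 1) + al by ring.
    rewrite (@addp _ (eta - al - 1))// mulrA ler_wpM2r ?powR_ge0//.
    have -> : H - 3/2 = al + ((al - eta) + (eta - al - 1)) by lra.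
    rewrite (@addp _ al)// (@addp _ (al - eta))// -mulrA.
    apply: ler_pM; rewrite ?powR_ge0// ?mulr_ge0 ?powR_ge0//.
      by apply: gt0_ler_npowR => //; exact: ltW.
    by apply: ler_pM; rewrite ?powR_ge0//; apply: gt0_ler_npowR; have := H0; have := H1; lra.
  move: h; rewrite subrK => h.
  apply: le_trans (ler_wpM2l (powR_ge0 u (- al)) h) _.
  by rewrite !mulrA -addp// addNr powRr0 mul1r.
have B1 : `|MG_kernel H t u| <=
    C * ((t - u) `^ al + (- al / eta) * (u `^ (al - eta) * (t - u) `^ eta)).
  rewrite kernelE mulrBr mulrCA (mulrCA _ al) -(mulNr al).
  have J1 : 0 <= - al * (u `^ (- al) * inner u t u).
    by rewrite mulr_ge0 ?mulr_ge0 ?powR_ge0 ?inner_ge0//; lra.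
  have J2 : 0 <= t `^ al * (u `^ (- al) * (t - u) `^ al) by rewrite !mulr_ge0 ?powR_ge0.
  rewrite ger0_norm; last by rewrite mulr_ge0// addr_ge0.
  apply: ler_wpM2l => //; apply: lerD.
    rewrite mulrCA mulrA ler_piMl ?powR_ge0//.
    by apply: powN_le1 => //; exact: ltW.
  rewrite -[leRHS]mulrA; apply: ler_wpM2l; first by lra.
  by apply: le_trans I1 _; rewrite mulrCA.
apply: le_trans (sqle _ _ B1) _.
rewrite -[leRHS]mulrA; apply: CF.
apply: le_trans (sqr2 _ _) _; apply: ler_wpM2l => //.
rewrite (_ : (- al / eta * _) ^+ 2 = (al / eta) ^+ 2 *
  (u `^ (al - eta) ^+ 2 * (t - u) `^ eta ^+ 2)); last by ring.
rewrite !sqr_powR//.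
set q := (al / eta) ^+ 2; have q0 : 0 <= q by exact: sqr_ge0.
have h1 : u `^ (2 * (al - eta)) * (t - u) `^ (2 * eta) <=
    (t - s) `^ (2 * eta) * (u - s) `^ (2 * (al - eta)).
  rewrite mulrC; apply: ler_pM; rewrite ?powR_ge0//.
    by rewrite ge0_ler_powR ?nnegrE//; lra.
  by apply: gt0_ler_npowR; lra.
have h2 := powR_ge0 (t - u) (2 * al).
have h3 : 0 <= (t - s) `^ (2 * eta) * (u - s) `^ (2 * (al - eta)).
  by rewrite mulr_ge0 ?powR_ge0.
have h4 := ler_wpM2l q0 h1; have h5 := mulr_ge0 q0 h2.
move: h2 h3 h4 h5; move: (_ `^ _) => a; move: (_ * _ `^ _) => b; move: (_ * _ `^ _) => b'.
by move: q q0 => {}q _ *; lra.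
Qed.


(** The interval is cut at [s]. Measurability of the increment is an argument, supplied later by
    [RR_integral], since the kernel contains an inner integral depending on [u]. *)
Lemma MG_kernel_increment_L2 (T eps : R) : 0 < eps -> eps < H -> 0 < T ->
  exists C0 : R, forall s t : R, 0 <= s -> s < t -> t <= T ->
  measurable_fun (`[0, t]%classic : set R)
    (fun u : R => MG_kernel H t u - MG_kernel H s u * \1_(`[0, s]%classic : set R) u : R) ->
  (\int[mu]_(u in `[0%R, t])
     ((MG_kernel H t u - MG_kernel H s u * \1_(`[0%R, s]%classic : set R) u) ^+ 2)%:E
   <= (C0 * (t - s) `^ (2 * (H - eps)))%:E)%E.
Proof.
move=> eps0 epsH T0.
(* [eps] may exceed what [MG_kernel_increment_sqr] admits. A smaller loss is used instead, and the
   factor [p] restores the exponent on the bounded interval. *)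
pose e := Num.min eps (Num.min (1 - H) 2^-1).
have e0 : 0 < e by rewrite !lt_min eps0 subr_gt0 H1 invr_gt0 ltr0n.
have eeps : e <= eps by rewrite ge_min lexx.
have e1 : e <= 1 - H by rewrite !ge_min lexx/= orbT.
have e2 : e <= 1/2 by rewrite mul1r !ge_min lexx !orbT.
have eH : e < H by exact: le_lt_trans epsH.
have [c c0 hc] := MG_kernel_increment_sqr e0 eH e1 e2.
have [k [b1 [b2 [f2 [k0 hb1 hb2 [hb1H hb2H] hk]]]]] := MG_kernel_sqr_le.
pose K1 := c * (2 * ((2 * e)^-1 * T `^ (2 * e))).
pose K2 := k * ((b1 + 1)^-1 + (b2 + 1)^-1).
pose p := T `^ (2 * (eps - e)); pose q := T `^ (2 * eps).
exists (K1 * p + K2 * q) => s t s0 st tT; set h : R -> R := fun u => _ - _ => mh.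
have t0 : 0 < t := le_lt_trans s0 st.
have ts0 : 0 < t - s by rewrite subr_gt0.
have tsT : t - s <= T by lra.
have tsp : (t - s) `^ (2 * (H - e)) <= p * (t - s) `^ (2 * (H - eps)).
  have -> : 2 * (H - e) = 2 * (eps - e) + 2 * (H - eps) by ring.
  by rewrite addp// ler_wpM2r ?powR_ge0// ge0_ler_powR ?nnegrE//; lra.
have tsq : (t - s) `^ (2 * H) <= q * (t - s) `^ (2 * (H - eps)).
  have -> : 2 * H = 2 * eps + 2 * (H - eps) by ring.
  by rewrite addp// ler_wpM2r ?powR_ge0// ge0_ler_powR ?nnegrE//; lra.
have mhE (D : set R) : measurable D -> D `<=` `[0, t] ->
    measurable_fun D (fun u => ((h u) ^+ 2)%:E).
  move=> mD Dt; apply/measurable_EFinP; apply: measurable_funX.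
  exact: measurable_funS mh.
have i1 : (\int[mu]_(u in `[0%R, s]) ((h u) ^+ 2)%:E <=
    (K1 * (t - s) `^ (2 * (H - e)))%:E)%E.
  have [->|sn0] := eqVneq s 0.
    rewrite set_itv1 integral_set1 lee_fin mulr_ge0 ?powR_ge0//.
    by rewrite /K1 !mulr_ge0 ?powR_ge0// invr_ge0 mulr_ge0// ltW.
  have {}s0 : 0 < s by rewrite lt_neqAle eq_sym sn0.
  (* Both endpoints are discarded as null sets, since the pointwise bound holds for 0 < u < s
     only. *)
  rewrite -integral_itv_bndo_bndc; last first.
    apply: mhE => // u /=; rewrite !in_itv/= => /andP[-> us].
    by rewrite /= (le_trans (ltW us))// ltW.
  rewrite -integral_itv_obnd_cbnd; last first.
    apply: mhE => // u /=; rewrite !in_itv/= => /andP[/ltW -> us].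
    by rewrite /= (le_trans (ltW us))// ltW.
  pose g u := c * (t - s) `^ (2 * (H - e)) * (s - u) `^ (2 * e - 1) +
    c * (t - s) `^ (2 * (H - e)) * (u - 0) `^ (2 * e - 1).
  have c'0 : 0 <= c * (t - s) `^ (2 * (H - e)) by rewrite mulr_ge0 ?powR_ge0.
  have mg1 (D : set R) : measurable_fun D (fun u => c * (t - s) `^ (2 * (H - e)) * (s - u) `^ (2 * e - 1)).
    by apply: measurable_funM => //; exact: measurable_powR_refl.
  have mg2 (D : set R) : measurable_fun D (fun u => c * (t - s) `^ (2 * (H - e)) * (u - 0) `^ (2 * e - 1)).
    by apply: measurable_funM => //; exact: measurable_powR_shift.
  have mg (D : set R) : measurable_fun D g by apply: measurable_funD; [exact: mg1|exact: mg2].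
  apply: (@le_trans _ _ (\int[mu]_(u in `]0%R, s[) (g u)%:E)%E).
    apply: ge0_le_integral => //.
    - by move=> u _; rewrite lee_fin sqr_ge0.
    - apply: mhE => // u /=; rewrite !in_itv/= => /andP[/ltW -> us].
      by rewrite /= (le_trans (ltW us))// ltW.
    - by apply/measurable_EFinP; exact: mg.
    - move=> u /=; rewrite in_itv/= => /andP[u0 us]; rewrite lee_fin /h indicE mem_set; last first.
        by rewrite /= in_itv/= !ltW.
      rewrite mulr1; apply: le_trans (hc u s t u0 us st) _.
      by rewrite /g subr0 -mulrDr mulrA.
  apply: (@le_trans _ _ (\int[mu]_(u in `[0%R, s]) (g u)%:E)%E).
    apply: ge0_subset_integral => //.
    - by apply/measurable_EFinP; exact: mg.
    - by move=> u _; rewrite lee_fin addr_ge0// mulr_ge0 ?powR_ge0.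
    - by move=> u /=; rewrite !in_itv/= => /andP[/ltW -> /ltW ->].
  under eq_integral do rewrite EFinD.
  rewrite ge0_integralD//=; first last.
  - by apply/measurable_EFinP; exact: mg2.
  - by move=> u _; rewrite lee_fin mulr_ge0 ?powR_ge0.
  - by apply/measurable_EFinP; exact: mg1.
  - by move=> u _; rewrite lee_fin mulr_ge0 ?powR_ge0.
  under eq_integral do rewrite EFinM.
  under [X in (_ + X)%E]eq_integral do rewrite EFinM.
  rewrite !ge0_integralZl//=; first last.
  - by move=> u _; rewrite lee_fin powR_ge0.
  - by apply/measurable_EFinP; exact: measurable_powR_refl.
  - by move=> u _; rewrite lee_fin powR_ge0.
  - by apply/measurable_EFinP; exact: measurable_powR_shift.
  have e21 : -1 < 2 * e - 1 by lra.
  have J1 := integral_powR_refl_le e21 s0; have J2 := integral_powR_shift_le e21 s0.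
  rewrite !subrK subr0 in J1 J2.
  have ce : (0 <= (c * (t - s) `^ (2 * (H - e)))%:E)%E by rewrite lee_fin.
  apply: le_trans (leeD (lee_wpmul2l ce J1) (lee_wpmul2l ce J2)) _.
  rewrite -EFinM -EFinD lee_fin /K1.
  have sT : s `^ (2 * e) <= T `^ (2 * e) by rewrite ge0_ler_powR ?nnegrE//; lra.
  have i0 : 0 <= (2 * e)^-1 by rewrite invr_ge0 mulr_ge0// ltW.
  rewrite -mulrDr -mulr2n -[X in _ <= X]mulrA [X in _ <= _ * X]mulrC [X in _ <= X]mulrA.
  by apply: ler_wpM2l => //; move: (ler_wpM2l i0 sT); lra.
have i2 : (\int[mu]_(u in `]s, t]) ((h u) ^+ 2)%:E <= (K2 * (t - s) `^ (2 * H))%:E)%E.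
  rewrite -integral_itv_bndo_bndc; last first.
    apply: mhE => // u /=; rewrite !in_itv/= => /andP[su ut].
    by rewrite (le_trans s0 (ltW su))/= ltW.
  pose g u := k * (t - u) `^ b1 + k * (t - s) `^ f2 * (u - s) `^ b2.
  have c'0 : 0 <= k * (t - s) `^ f2 by rewrite mulr_ge0 ?powR_ge0.
  have mg1 (D : set R) : measurable_fun D (fun u => k * (t - u) `^ b1).
    by apply: measurable_funM => //; exact: measurable_powR_refl.
  have mg2 (D : set R) : measurable_fun D (fun u => k * (t - s) `^ f2 * (u - s) `^ b2).
    by apply: measurable_funM => //; exact: measurable_powR_shift.
  have mg (D : set R) : measurable_fun D g by apply: measurable_funD; [exact: mg1|exact: mg2].
  apply: (@le_trans _ _ (\int[mu]_(u in `]s, t[) (g u)%:E)%E).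
    apply: ge0_le_integral => //.
    - by move=> u _; rewrite lee_fin sqr_ge0.
    - apply: mhE => // u /=; rewrite !in_itv/= => /andP[su ut].
      by rewrite (le_trans s0 (ltW su))/= ltW.
    - by apply/measurable_EFinP; exact: mg.
    - move=> u /=; rewrite in_itv/= => /andP[su ut]; rewrite lee_fin /h indicE memNset; last first.
        by rewrite /= in_itv/= => /andP[_]; rewrite leNgt su.
      rewrite mulr0 subr0; apply: le_trans (hk s u t s0 su ut) _.
      by rewrite /g mulrDr mulrA.
  apply: (@le_trans _ _ (\int[mu]_(u in `[s, t]) (g u)%:E)%E).
    apply: ge0_subset_integral => //.
    - by apply/measurable_EFinP; exact: mg.
    - by move=> u _; rewrite lee_fin addr_ge0// mulr_ge0 ?powR_ge0.
    - by move=> u /=; rewrite !in_itv/= => /andP[/ltW -> /ltW ->].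
  under eq_integral do rewrite EFinD.
  rewrite ge0_integralD//=; first last.
  - by apply/measurable_EFinP; exact: mg2.
  - by move=> u _; rewrite lee_fin mulr_ge0 ?powR_ge0.
  - by apply/measurable_EFinP; exact: mg1.
  - by move=> u _; rewrite lee_fin mulr_ge0 ?powR_ge0.
  under eq_integral do rewrite EFinM.
  under [X in (_ + X)%E]eq_integral do rewrite EFinM.
  rewrite !ge0_integralZl//=; first last.
  - by move=> u _; rewrite lee_fin powR_ge0.
  - by apply/measurable_EFinP; exact: measurable_powR_refl.
  - by move=> u _; rewrite lee_fin powR_ge0.
  - by apply/measurable_EFinP; exact: measurable_powR_shift.
  have J1 := integral_powR_refl_le hb1 st; have J2 := integral_powR_shift_le hb2 st.
  have ke : (0 <= k%:E)%E by rewrite lee_fin.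
  have ce : (0 <= (k * (t - s) `^ f2)%:E)%E by rewrite lee_fin.
  apply: le_trans (leeD (lee_wpmul2l ke J1) (lee_wpmul2l ce J2)) _.
  rewrite -EFinM -EFinD lee_fin /K2 hb1H.
  have -> : (t - s) `^ (2 * H) = (t - s) `^ f2 * (t - s) `^ (b2 + 1) by rewrite -addp// hb2H.
  by rewrite le_eqVlt; apply/orP; left; apply/eqP; ring.
have -> : `[0, t]%classic = `[0, s]%classic `|` `]s, t]%classic :> set R.
  apply/seteqP; split => u /=; rewrite !in_itv/=.
    move=> /andP[u0 ut]; have [us|us] := leP u s; [left|right]; first by rewrite u0.
    by rewrite ut.
  by move=> [/andP[u0 us]|/andP[su ut]]; apply/andP; split; lra.
rewrite ge0_integral_setU//=; first last.
- rewrite disj_set2E; apply/eqP; rewrite -subset0 => u [] /=; rewrite !in_itv/=.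
  by move=> /andP[_ us] /andP[su _]; move: su; rewrite ltNge us.
- by move=> u _; rewrite lee_fin sqr_ge0.
- apply: mhE; first exact: measurableU.
  move=> u [] /=; rewrite !in_itv/= => /andP[].
    by move=> -> us; rewrite /= (le_trans us)// ltW.
  by move=> su ->; rewrite (le_trans s0)// ltW.
apply: le_trans (leeD i1 i2) _; rewrite -EFinD lee_fin.
have K10 : 0 <= K1 by rewrite /K1 !mulr_ge0 ?powR_ge0// invr_ge0 mulr_ge0// ltW.
have K20 : 0 <= K2 by rewrite /K2 mulr_ge0// addr_ge0// invr_ge0; lra.
have h1 := ler_wpM2l K10 tsp; have h2 := ler_wpM2l K20 tsq.
by rewrite [leRHS]mulrDl -[X in _ <= X + _]mulrA -[X in _ <= _ + X]mulrA; exact: lerD.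
Qed.

End Molchan_Golosov.

(** * Increments of the Volterra process *)

Section Volterra_increments.
Import HBSimple.
Context d (Omega : measurableType d) (R : realType) (P : probability Omega R).
Local Notation lam := (@lebesgue_measure R).
Variables (T : R) (Z : R -> {RV P >-> R}) (M : set R -> {RV P >-> R}).
Variables (K : R -> R -> R) (Y : R -> {RV P >-> R}) (psi : R -> R) (c : R).
Hypothesis hM : levy_random_measure T Z M.
Hypothesis T0 : 0 < T.
Hypothesis hcos : forall m t, 0 <= t <= T ->
  \int[P]_w cos (m * Z t w) = expR (- (t * psi m)).
Hypothesis hsin : forall m t, 0 <= t <= T -> \int[P]_w sin (m * Z t w) = 0.
Hypothesis cpsi : continuous psi.
Hypothesis psi0 : forall x, 0 <= psi x.
Hypothesis c0 : 0 <= c.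
Hypothesis psi2 : forall x, psi x <= c * x ^+ 2.
Hypothesis hY : forall t, 0 <= t <= T -> RR_integral M `[0, t]%classic (K t) (Y t).
Variables s t : R.
Hypotheses (s0 : 0 <= s) (st : s < t) (tT : t <= T).

Definition increment_kernel (u : measurableTypeR R) : R :=
  K t u - K s u * \1_(`[0, s]%classic : set R) u.
Local Notation h := increment_kernel.

Let ms : measurable (`[0, s]%classic : set (measurableTypeR R)).
Proof. exact: measurable_itv. Qed.
Let mt : measurable (`[0, t]%classic : set (measurableTypeR R)).
Proof. exact: measurable_itv. Qed.
Let sI : 0 <= s <= T. Proof. by rewrite s0 (le_trans (ltW st)). Qed.
Let tI : 0 <= t <= T. Proof. by rewrite (le_trans s0 (ltW st)). Qed.
Let stsub : `[0, s]%classic `<=` (`[0, t]%classic : set R).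
Proof. by move=> u /=; rewrite !in_itv/= => /andP[-> us]; rewrite (le_trans us)// ltW. Qed.
Let tsub : `[0, t]%classic `<=` (`[0, T]%classic : set R).
Proof. by move=> u /=; rewrite !in_itv/= => /andP[-> us]; rewrite (le_trans us). Qed.

Lemma measurable_increment_kernel :
  measurable_fun (`[0, t]%classic : set (measurableTypeR R)) h.
Proof.
have [mKt _] := hY tI; have [mKs _] := hY sI.
apply: measurable_funB => //.
rewrite (_ : (fun u => _) = (K s \_ (`[0, s]%classic))); last first.
  apply/funext => u; rewrite patchE indicE; case: ifPn => us; first by rewrite mulr1.
  by rewrite mulr0.
by apply: measurable_funTS; apply/(measurable_restrictT _ ms).
Qed.

Hypothesis ih : lam.-integrable (`[0, t]%classic : set (measurableTypeR R))
  (fun u => (h u ^+ 2)%:E).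

Lemma Volterra_increment_cos_mean (m : R) : 0 < \int[P]_w cos (m * (Y t w - Y s w)) ->
  \int[P]_w cos (m * (Y t w - Y s w)) =
  expR (- \int[lam]_(u in (`[0, t]%classic : set (measurableTypeR R))) psi (m * h u)).
Proof.
have [_ [f_ [cf cfA cfX]]] := hY tI; have [_ [g_ [cg cgA cgX]]] := hY sI.
have mpsi : measurable_fun setT psi by exact: continuous_measurable_fun.
(* [h_] approximates the increment kernel, while [I] keeps the two given integrals apart so that
   their convergence over every Borel set applies. They agree almost surely by linearity and
   restriction. *)
pose h_ n : {sfun measurableTypeR R >-> R} := f_ n - g_ n * indic_sfun _ ms.
pose I n (A : set R) w := elementary_integral M A (f_ n) w -
  elementary_integral M (A `&` `[0, s]%classic) (g_ n) w.
have mI n A : measurable_fun setT (I n A).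
  by apply: measurable_funB; exact: measurable_elementary_integral.
move=> pos; apply: (@cos_mean_limit _ _ _ P _ psi c (fun n => h_ n) h I _ m) => //.
- rewrite lebesgue_measure_itv/=; case: ifP => _ //; exact: ltry.
- move=> n; have [B [_ hB]] := simple_bounded (h_ n).
  by exists (B + 1) => x; apply: (hB (B + 1) _ x Logic.I); rewrite ltrDl.
- exact: measurable_increment_kernel.
- have cf' : {ae lam, forall u : measurableTypeR R, (`[0, t]%classic : set R) u ->
      f_ n u @[n --> \oo] --> K t u} := cf.
  apply: filterS2 cf' cg => u cfu cgu ut; rewrite /h_ /h.
  change (f_ n u - g_ n u * \1_(`[0, s]%classic : set R) u @[n --> \oo] -->
    K t u - K s u * \1_(`[0, s]%classic : set R) u).
  apply: cvgB; first exact: cfu.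
  have [us|us] := pselect ((`[0, s]%classic : set R) u).
    by apply: cvgM; [exact: cgu|exact: cvg_cst].
  rewrite indicE memNset// mulr0; under eq_fun do rewrite mulr0; exact: cvg_cst.
- move=> n A r mA AB.
  rewrite -(elementary_integral_exponent hM T0 mpsi hcos hsin)//; last first.
    exact: subset_trans AB tsub.
  have AT : A `<=` `[0, T] by exact: subset_trans AB tsub.
  apply: ae_eq_Rintegral.
  + exact: measurable_cosM.
  + by apply: measurable_cosM; exact: measurable_elementary_integral.
  have h1 := elementary_integralB hM (f_ n) (g_ n * indic_sfun _ ms) mA AT.
  have h2 := elementary_integral_restrict hM (g_ n) ms mA AT.
  by apply: filterS2 h1 h2 => w -> ->.
- move=> A mA AB; have [XA cXA] := cfA A mA AB.
  have [XB cXB] := cgA (A `&` `[0, s]%classic) (measurableI _ _ mA ms) (@subIsetr _ _ _).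
  have mX : measurable_fun setT (fun w => XA w - XB w) by exact: measurable_funB.
  exists (mfun_Sub (mem_set mX)).
  by apply: cvg_in_probabilityB => // n; exact: measurable_elementary_integral.
- exact: measurable_funB.
- rewrite /I setIidr//.
  by apply: cvg_in_probabilityB => // n; exact: measurable_elementary_integral.
Qed.

Let V := \int[lam]_(u in (`[0, t]%classic : set (measurableTypeR R))) (h u ^+ 2).

Let mX : measurable_fun setT (fun w => Y t w - Y s w).
Proof. exact: measurable_funB. Qed.

Let pos : exists2 m0, 0 < m0 & forall m, 0 <= m <= m0 -> 0 < \int[P]_w cos (m * (Y t w - Y s w)).
Proof. exact: (cos_mean_pos (mfun_Sub (mem_set mX))). Qed.

Lemma Volterra_increment_second_moment :
  (\int[P]_w ((Y t w - Y s w) ^+ 2)%:E <= (2 * (c * V))%:E)%E.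
Proof.
have [m0 m00 hm0] := pos; apply: (second_moment_le mX m00) => m /andP[m1 m2].
rewrite Volterra_increment_cos_mean; last by apply: hm0; rewrite m2 ltW.
(* exp (- x) >= 1 - x turns the bound on the exponent into the quadratic one required by
   [second_moment_le], with constant [c * V]. *)
apply: le_trans (expR_ge1Dx _); rewrite lerD2l lerN2.
have ib : lam.-integrable (`[0, t]%classic : set (measurableTypeR R))
    (EFin \o (fun u => c * m ^+ 2 * h u ^+ 2)).
  exact: (integrableZl mt (c * m ^+ 2) ih).
have le u : psi (m * h u) <= c * m ^+ 2 * h u ^+ 2.
  by apply: le_trans (psi2 _) _; rewrite exprMn mulrA.
have mh : measurable_fun (`[0, t]%classic : set (measurableTypeR R)) (fun u => psi (m * h u)).
  apply: (measurableT_comp (continuous_measurable_fun cpsi)); apply: measurable_funM => //.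
  exact: measurable_increment_kernel.
have -> : c * V * m ^+ 2 = \int[lam]_(u in (`[0, t]%classic : set (measurableTypeR R)))
    (c * m ^+ 2 * h u ^+ 2) by rewrite RintegralZl// mulrAC.
apply: le_Rintegral => //.
apply: (@le_integrable _ _ _ lam _ mt _ _ _ _ ib); first exact/measurable_EFinP.
by move=> u _; rewrite !abse_EFin lee_fin (ger0_norm (psi0 _)) (le_trans (le u))// ler_norm.
Qed.

(** With a quadratic exponent, the increment has for small [m] the cosine means of
    [Num.sqrt V * Z 1], so [even_moment_le] compares the two. *)
Lemma Volterra_increment_even_moment (kappa : R) (k : nat) :
  (forall m, psi m = kappa * m ^+ 2) ->
  (forall m, \int[P]_w cos (m * Z 1 w) = expR (- psi m)) ->
  (\int[P]_w ((Y t w - Y s w) ^+ k.*2)%:E <= (V ^+ k)%:E * \int[P]_w (Z 1 w ^+ k.*2)%:E)%E.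
Proof.
move=> hpsi hZ1; have [m0 m00 hm0] := pos.
have V0 : 0 <= V by apply: Rintegral_ge0 => u _; exact: sqr_ge0.
have mW : measurable_fun setT (fun w => Num.sqrt V * Z 1 w) by exact: measurable_funM.
apply: (le_trans (even_moment_le k mX mW m00 _)).
  move=> m hm; rewrite Volterra_increment_cos_mean; last exact: hm0.
  under [RHS]eq_Rintegral do rewrite mulrA.
  rewrite hZ1 hpsi; congr (expR (- _)).
  under eq_Rintegral do rewrite hpsi exprMn mulrA.
  rewrite RintegralZl//.
  by rewrite [in RHS]exprMn sqr_sqrtr// -[LHS]mulrA.
under eq_integral do rewrite exprMn -mul2n exprM sqr_sqrtr// mul2n EFinM.
rewrite ge0_integralZl//.
- by apply/measurable_EFinP; exact: measurable_funX.
- by move=> w _; rewrite lee_fin -mul2n exprM exprn_ge0// sqr_ge0.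
- by rewrite lee_fin exprn_ge0.
Qed.

End Volterra_increments.

(** * Moments and paths of the fractional process *)

Section fractional_Levy_process.
Context d (Omega : measurableType d) (R : realType) (P : probability Omega R).
Local Notation lam := (@lebesgue_measure R).
Variables (T H a : R) (nu : {measure set R -> \bar R}) (Z Y : R -> {RV P >-> R}).
Hypotheses (T0 : 0 < T) (hH : 0 < H < 1) (ha : 0 <= a).
Hypotheses (hsym : symmetric_measure nu) (hZchar : has_triplet Z a nu).
Hypothesis hY : volterra_process T Z (MG_kernel H) Y.
Local Notation psi := (real_exponent a nu).

Let hcos m t : 0 <= t <= T -> \int[P]_w cos (m * Z t w) = expR (- (t * psi m)).
Proof. by move=> /andP[t0 _]; have [] := triplet_cos_sin hsym hZchar m t0. Qed.

Let hsin m t : 0 <= t <= T -> \int[P]_w sin (m * Z t w) = 0.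
Proof. by move=> /andP[t0 _]; have [] := triplet_cos_sin hsym hZchar m t0. Qed.

Let kernel_increment (eps : R) : 0 < eps < H -> exists2 C0, 0 < C0 &
  forall s t : R, 0 <= s -> s < t -> t <= T ->
  lam.-integrable (`[0, t]%classic : set (measurableTypeR R))
    (fun u => (increment_kernel (MG_kernel H) s t u ^+ 2)%:E) /\
  \int[lam]_(u in (`[0, t]%classic : set (measurableTypeR R)))
    (increment_kernel (MG_kernel H) s t u ^+ 2) <= C0 * (t - s) `^ (2 * (H - eps)).
Proof.
move=> /andP[eps0 epsH]; have [M hM RR] := hY.
have [C0 hC0] := MG_kernel_increment_L2 hH eps0 epsH T0.
(* The mean-square lemma leaves the sign of its constant open; a positive one is needed to normalise
   increments later. *)
exists (`|C0| + 1); first by rewrite ltr_wpDl.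
move=> s t s0 st tT.
have mk := measurable_increment_kernel RR s0 st tT.
have bd := hC0 s t s0 st tT mk.
have ik : lam.-integrable (`[0, t]%classic : set (measurableTypeR R))
    (fun u => (increment_kernel (MG_kernel H) s t u ^+ 2)%:E).
  apply/integrableP; split.
    by apply/measurable_EFinP; exact: measurable_funX.
  under eq_integral do rewrite gee0_abs ?lee_fin ?sqr_ge0//.
  by apply: le_lt_trans bd _; exact: ltry.
split => //; rewrite -lee_fin /Rintegral fineK; last first.
  by apply: integrable_fin_num ik; exact: measurable_itv.
apply: le_trans bd _; rewrite lee_fin ler_wpM2r ?powR_ge0//.
by rewrite (le_trans (ler_norm _))// lerDl.
Qed.

Lemma second_moment_increment (eps : R) : 0 < eps < H ->
  (\int[nu]_x (x ^+ 2)%:E < +oo)%E ->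
  exists C : R, forall s t : R, 0 <= s -> s < t -> t <= T ->
  (\int[P]_w (`|Y t w - Y s w| ^+ 2)%:E <= (C * (t - s) `^ (2 * (H - eps)))%:E)%E.
Proof.
move=> heps hx2; have [C0 C00 hC0] := kernel_increment heps; have [M hM RR] := hY.
pose c := (a + \int[nu]_x (x ^+ 2)) / 2.
have c0 : 0 <= c.
  by rewrite divr_ge0// addr_ge0// Rintegral_ge0// => x _; exact: sqr_ge0.
exists (2 * (c * C0)) => s t s0 st tT; have [ik bd] := hC0 s t s0 st tT.
under eq_integral do rewrite real_normK ?num_real//.
have le := Volterra_increment_second_moment (psi := psi) hM T0 hcos hsin
  (continuous_real_exponent hsym hZchar) (real_exponent_ge0 hsym hZchar) c0
  (fun m => real_exponent_le a m hx2) RR s0 st tT ik.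
apply: le_trans le _.
rewrite lee_fin -[leRHS]mulrA -(mulrA c); apply: ler_wpM2l => //.
exact: ler_wpM2l.
Qed.

Hypothesis hB : brownian_motion Z.

Let kappa := psi 1.

Let even_moment_bound (eps : R) : 0 < eps < H -> exists2 C : R, 0 < C &
  forall s t : R, 0 <= s -> s < t -> t <= T -> forall k : nat,
  (\int[P]_w ((Y t w - Y s w) ^+ k.*2)%:E <=
   ((C * (t - s) `^ (2 * (H - eps))) ^+ k)%:E * \int[P]_w (Z 1 w ^+ k.*2)%:E)%E.
Proof.
move=> heps; have [C0 C00 hC0] := kernel_increment heps; have [M hM RR] := hY.
exists C0 => // s t s0 st tT k; have [ik bd] := hC0 s t s0 st tT.
have quad := Brownian_exponent hsym hZchar hB.
have psi2 x : psi x <= psi 1 * x ^+ 2 by rewrite -quad.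
have cos1 m : \int[P]_w cos (m * Z 1 w) = expR (- psi m).
  by have [-> _] := triplet_cos_sin hsym hZchar m ler01; rewrite mul1r.
have le := Volterra_increment_even_moment (psi := psi) hM T0 hcos hsin
  (continuous_real_exponent hsym hZchar) (real_exponent_ge0 hsym hZchar)
  (real_exponent_ge0 hsym hZchar 1) psi2 RR s0 st tT ik k quad cos1.
apply: le_trans le _.
apply: lee_wpmul2r.
  by apply: integral_ge0 => w _; rewrite lee_fin -mul2n exprM exprn_ge0// sqr_ge0.
rewrite lee_fin lerXn2r ?nnegrE ?mulr_ge0 ?powR_ge0 ?(ltW C00)//.
by apply: Rintegral_ge0 => u _; exact: sqr_ge0.
Qed.

(** Even moments suffice for real [p]: with 2 k >= p one has y^p <= 1 + y^(2 k) for nonnegative y.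
    Applied to the increment divided by [Num.sqrt V], both terms have bounded mean, and the scale
    reappears as V^(p/2). *)
Lemma Brownian_moment_increment (eps p : R) : 0 < eps < H -> 2 <= p ->
  exists C : R, forall s t : R, 0 <= s -> s < t -> t <= T ->
  (\int[P]_w (`|Y t w - Y s w| `^ p)%:E <= (C * (t - s) `^ (p * (H - eps)))%:E)%E.
Proof.
move=> heps p2; have [C C0 hC] := even_moment_bound heps.
pose k := (Num.truncn p).+1.
have pk : p <= k.*2%:R.
  by apply: (le_trans (ltW (truncnS_gt p))); rewrite ler_nat -addnn leq_addr.
have p0 : 0 < p by rewrite (lt_le_trans _ p2).
pose m2 := fine (\int[P]_w (Z 1 w ^+ k.*2)%:E).
have fm2 : (\int[P]_w (Z 1 w ^+ k.*2)%:E = m2%:E)%E.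
  rewrite fineK// ge0_fin_numE; first exact: (Brownian_even_moment_fin hB).
  by apply: integral_ge0 => w _; rewrite lee_fin -mul2n exprM exprn_ge0// sqr_ge0.
exists (C `^ (p / 2) * (1 + m2)) => s t s0 st tT.
pose V := C * (t - s) `^ (2 * (H - eps)).
have V0 : 0 < V by rewrite mulr_gt0// powR_gt0// subr_gt0.
have bd := hC s t s0 st tT k; rewrite fm2 -/V -EFinM in bd.
have mX : measurable_fun setT (fun w => Y t w - Y s w) by exact: measurable_funB.
have ev (x : R) : 0 <= x ^+ k.*2 by rewrite -mul2n exprM exprn_ge0// sqr_ge0.
pose W := V `^ (p / 2).
have W0 : 0 <= W by exact: powR_ge0.
have pw x : `|x| `^ p <= W * (1 + V ^- k * x ^+ k.*2).
  have -> : V ^- k * x ^+ k.*2 = (`|x| / Num.sqrt V) ^+ k.*2.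
    rewrite expr_div_n -!mul2n !exprM sqr_sqrtr ?(ltW V0)// real_normK ?num_real//.
    by rewrite mulrC.
  have sV : 0 < Num.sqrt V by rewrite sqrtr_gt0.
  have -> : `|x| `^ p = W * (`|x| / Num.sqrt V) `^ p.
    have -> : W = Num.sqrt V `^ p.
      by rewrite /W -powR12_sqrt ?(ltW V0)// -powRrM [in LHS]mulrC.
    rewrite -powRM ?divr_ge0 ?(ltW sV)// mulrC divfK//.
    by rewrite gt_eqF.
  apply: ler_wpM2l => //; set y := `|x| / _.
  have y0 : 0 <= y by rewrite divr_ge0// ltW.
  rewrite -powR_mulrn//; have [y1|y1] := leP y 1.
    apply: (@le_trans _ _ 1); last by rewrite lerDl powR_ge0.
    by have := ge0_ler_powR (ltW p0) y0 ler01 y1; rewrite powR1.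
  apply: (@le_trans _ _ (y `^ k.*2%:R)); last by rewrite lerDr.
  by rewrite ler_powR// ltW.
apply: (@le_trans _ _ (\int[P]_w (W * (1 + V ^- k * (Y t w - Y s w) ^+ k.*2))%:E)%E).
  apply: ge0_le_integral => //.
  - apply/measurable_EFinP; apply: (measurableT_comp (measurable_powR p)).
    exact: measurableT_comp.
  - apply/measurable_EFinP; apply: measurable_funM => //; apply: measurable_funD => //.
    by apply: measurable_funM => //; exact: measurable_funX.
  - by move=> w _; rewrite lee_fin.
under eq_integral do rewrite EFinM EFinD EFinM.
have iV : 0 <= V ^- k by rewrite invr_ge0 exprn_ge0// ltW.
have mE : measurable_fun setT (fun w => ((Y t w - Y s w) ^+ k.*2)%:E).
  by apply/measurable_EFinP; exact: measurable_funX.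
rewrite ge0_integralZl//; first last.
- by move=> w _; rewrite -EFinM -EFinD lee_fin addr_ge0// mulr_ge0.
- by apply: emeasurable_funD => //; apply: emeasurable_funM.
rewrite ge0_integralD//; first last.
- by apply: emeasurable_funM.
- by move=> w _; rewrite -EFinM lee_fin mulr_ge0.
have -> : (\int[P]_(w in setT) (1 : \bar R) = 1)%E.
  by rewrite integral_cst// mul1e; exact: probability_setT.
rewrite ge0_integralZl//; last by move=> w _; rewrite lee_fin.
apply: (@le_trans _ _ (W%:E * (1 + (V ^- k)%:E * (V ^+ k * m2)%:E))%E).
  apply: lee_wpmul2l; first by rewrite lee_fin.
  by apply: leeD2l; apply: lee_wpmul2l => //; rewrite lee_fin.
rewrite -(EFinM (V ^- k)) -(EFinD 1) -(EFinM W) lee_fin mulrA mulVf ?mul1r; last first.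
  by rewrite expf_neq0// gt_eqF.
rewrite /W /V powRM ?(ltW C0) ?powR_ge0// -powRrM.
rewrite (_ : 2 * (H - eps) * (p / 2) = p * (H - eps)); last by field.
by rewrite mulrAC.
Qed.

Lemma second_moment_Hoelder : (\int[nu]_x (x ^+ 2)%:E < +oo)%E -> 2^-1 < H ->
  exists2 Y' : R -> {RV P >-> R}, modification T Y Y' &
    forall (w : Omega) (kap : R), 0 < kap < H - 2^-1 ->
      hoelder_continuous T kap (fun t => Y' t w).
Proof.
move=> hx2 H2; apply: (Kolmogorov_continuity T0); first by rewrite subr_gt0.
(* With this [eps], 2 (H - eps) = H + 1/2 + kap, which exceeds 1 + 2 kap precisely when kap < H -
   1/2. *)
move=> kap /andP[k0 kH]; pose eps := (H - 2^-1 - kap) / 2.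
have heps : 0 < eps < H by rewrite /eps; apply/andP; split; lra.
have [C hC] := second_moment_increment heps hx2.
exists 2%N, C, (2 * (H - eps)); split => //.
by rewrite /eps; lra.
Qed.

Lemma Brownian_Hoelder : exists2 Y' : R -> {RV P >-> R}, modification T Y Y' &
  forall (w : Omega) (kap : R), 0 < kap < H -> hoelder_continuous T kap (fun t => Y' t w).
Proof.
have /andP[H0 _] := hH; apply: (Kolmogorov_continuity T0) => // kap /andP[k0 kH].
pose eps := (H - kap) / 2.
have heps : 0 < eps < H by rewrite /eps; apply/andP; split; lra.
have Hk : 0 < H - kap by rewrite subr_gt0.
(* For the moment of order 2 k the exponent is k (H + kap); it exceeds 1 + 2 k kap as soon as k (H -
   kap) > 1. *)
pose k := (Num.truncn (H - kap)^-1).+1.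
have kk : 1 < k%:R * (H - kap).
  by rewrite -ltr_pdivrMr// mul1r; exact: truncnS_gt.
have p2 : 2 <= k.*2%:R :> R by rewrite ler_nat -[2%N]/(1.*2) leq_double.
have [C hC] := Brownian_moment_increment heps p2.
exists k.*2, C, (k.*2%:R * (H - eps)); split => //.
  by rewrite /eps -muln2 natrM; lra.
move=> s t s0 st tT; apply: le_trans (hC s t s0 st tT).
by under eq_integral do rewrite -powR_mulrn//.
Qed.

End fractional_Levy_process.

Theorem proposition1 (R : realType) (T H eps : R)
    (hT : 0 < T) (hH : 0 < H < 1) (heps : 0 < eps < H)
    (d : measure_display) (Omega : measurableType d) (P : probability Omega R)
    (a : R) (nu : {measure set R -> \bar R}) (Z Y : R -> {RV P >-> R})
    (ha : 0 <= a) (hnu : levy_measure nu) (hsym : symmetric_measure nu)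
    (hZ : levy_process Z) (hZchar : has_triplet Z a nu)
    (hY : volterra_process T Z (MG_kernel H) Y) :
  ((0 < \int[nu]_x (x ^+ 2)%:E < +oo)%E ->
    (exists C : R, forall s t : R, 0 <= s -> s < t -> t <= T ->
      ('E_P[(fun w => `|Y t w - Y s w| ^+ 2)%R]
         <= (C * (t - s) `^ (2 * (H - eps)))%:E)%E) /\
    (1/2 < H ->
      exists2 Y' : R -> {RV P >-> R}, modification T Y Y' &
        forall (w : Omega) (kappa : R), 0 < kappa < H - 1/2 ->
          hoelder_continuous T kappa (fun t => Y' t w))) /\
  (brownian_motion Z ->
    (forall p : R, 2 <= p ->
      exists C : R, forall s t : R, 0 <= s -> s < t -> t <= T ->
        ('E_P[(fun w => `|Y t w - Y s w| `^ p)%R]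
           <= (C * (t - s) `^ (p * (H - eps)))%:E)%E) /\
    (exists2 Y' : R -> {RV P >-> R}, modification T Y Y' &
      forall (w : Omega) (kappa : R), 0 < kappa < H ->
        hoelder_continuous T kappa (fun t => Y' t w))).
Proof.
split=> [/andP[_ hx2]|hB]; split.
- have [C hC] := second_moment_increment hT hH ha hsym hZchar hY heps hx2.
  by exists C => s t s0 st tT; rewrite unlock; exact: hC.
- by rewrite mul1r => H2; exact: (second_moment_Hoelder hT hH ha hsym hZchar hY hx2 H2).
- move=> p p2; have [C hC] := Brownian_moment_increment hT hH hsym hZchar hY hB heps p2.
  by exists C => s t s0 st tT; rewrite unlock; exact: hC.
- exact: (Brownian_Hoelder hT hH hsym hZchar hY hB).
Qed.
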